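(* Suppose $I\in L^2(\Omega)$. Then a minimizer pair $(P^*,m^* )$ to the piecewise constant soft Mumford-Shah energy $E[P,m\mid I]$ exists for both the unsupervised case and the supervised case.
   Context: $\Omega\subset\mathbb{R}^2$ is a bounded, smooth, open image domain, $I$ is the given image on $\Omega$, $K$ is the number of patterns, and $\lambda,\varepsilon>0$ are modeling parameters. $\Delta_{K-1}=\{(t_1,\dots,t_K)\in\mathbb{R}^K: t_i\ge 0,\ \sum_{i=1}^K t_i=1\}$ is the probability simplex. The setting is that each pattern $i$ is a homogeneous Gaussian $N(m_i,\sigma)$ with a distinct mean value $m_i$, so that the $i$-th pattern is $u_i(x)\equiv m_i$ on $\Omega$, $i=1,\dots,K$; set $m=(m_1,\dots,m_K)$. The ownerships are $P=(p_1,\dots,p_K)$ with $p_i\in H^1(\Omega)$ and $P:\Omega\to\Delta_{K-1}$. The model is to minimize over $(P,m)$ the energy $$E[P,m\mid I]=\lambda\sum_{i=1}^K\int_\Omega(I-m_i)^2p_i\,dx+\sum_{i=1}^K\int_\Omega\Big(9\varepsilon|\nabla p_i|^2+\frac{(p_i(1-p_i))^2}{\varepsilon}\Big)dx.$$ In the unsupervised case no further condition is imposed. In the supervised case, a user specifies $K$ distinct domain patches $Q_1,\dots,Q_K$ in $\Omega$, each of positive Lebesgue measure, and the ownerships are additionally required to satisfy $p_i\big|_{Q_j}=\delta_{ij}$ for $i,j=1,\dots,K$, where $\delta_{ij}$ is Kronecker's delta.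
   Formalization: In the supervised case existence is claimed when some ownership satisfies the patch constraints (proved when the patches have pairwise disjoint closures); for merely distinct patches, e.g. overlapping in positive measure, no admissible P exists and the claim fails. *)

(* Defs.v *)
From mathcomp Require Export all_boot all_order all_algebra.
From mathcomp Require Export all_classical all_reals all_analysis.

Set Implicit Arguments.
Unset Strict Implicit.
Unset Printing Implicit Defensive.

Import Order.TTheory GRing.Theory Num.Theory.
Import numFieldNormedType.Exports.

Local Open Scope classical_set_scope.
Local Open Scope ring_scope.

Section SobolevPlane.
Variable R : realType.

(* [R * R] as the carrier of the product of two copies of [lebesgue_measure];
   its sigma-algebra is the Borel one of the plane. *)
Definition plane := (measurableTypeR R * measurableTypeR R)%type.

Definition leb2 : {measure set plane -> \bar R} :=
  (@lebesgue_measure R \x @lebesgue_measure R)%E.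

Definition e_ (j : 'I_2) : R * R := if j == ord0 then (1, 0) else (0, 1).

Definition iter_partial (s : seq 'I_2) (f : R * R -> R) : R * R -> R :=
  foldr (fun j h x => 'D_(e_ j) h x) f s.

Definition smooth (f : R * R -> R) : Prop :=
  forall s : seq 'I_2,
    continuous (iter_partial s f) /\
    forall (j : 'I_2) (x : R * R), derivable (iter_partial s f) x (e_ j).

Definition smooth1 (g : R -> R) : Prop :=
  forall (n : nat) (t : R), derivable (derive1n n g) t 1.

(* Near each of its boundary points the open set is, after possibly exchanging
   the two coordinates ([swap]) and choosing the side ([below]), the set of
   points on one side of the graph of a smooth function. *)
Definition smooth_boundary (Omega : set (R * R)) : Prop :=
  forall a : R * R, (closure Omega `\` Omega) a ->
    exists (r : R) (g : R -> R) (swap below : bool),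
      [/\ 0 < r, smooth1 g &
        forall x : R * R, ball a r x ->
          let y := if swap then (x.2, x.1) else x in
          Omega x <-> (if below then y.2 < g y.1 else g y.1 < y.2)].

Definition test_function (Omega : set (R * R)) (phi : R * R -> R) : Prop :=
  [/\ smooth phi,
      compact (closure [set x | phi x != 0]) &
      closure [set x | phi x != 0] `<=` Omega].

(* L^2(Omega), for functions given on the whole plane: values outside Omega
   are irrelevant. *)
Definition L2 (Omega : set (R * R)) (f : R * R -> R) : Prop :=
  (f \_ Omega) \in Lfun leb2 2%:E.

Definition is_weak_partial (Omega : set (R * R)) (j : 'I_2)
    (f g : R * R -> R) : Prop :=
  forall phi, test_function Omega phi ->
    \int[leb2]_(x in Omega) (f x * 'D_(e_ j) phi x) =
    - \int[leb2]_(x in Omega) (g x * phi x).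

Definition H1 (Omega : set (R * R)) (f : R * R -> R) : Prop :=
  L2 Omega f /\
  forall j : 'I_2, exists g, L2 Omega g /\ is_weak_partial Omega j f g.

(* A representative of the weak partial derivative, which is unique only up to
   equality almost everywhere on Omega; junk value 0 when there is none. *)
Definition weak_partial (Omega : set (R * R)) (j : 'I_2)
    (f : R * R -> R) : R * R -> R :=
  xget (fun=> 0) [set g | L2 Omega g /\ is_weak_partial Omega j f g].

Definition normsq_grad (Omega : set (R * R)) (f : R * R -> R) (x : R * R) : R :=
  \sum_(j < 2) weak_partial Omega j f x ^+ 2.

End SobolevPlane.

Section SoftMumfordShah.
Variables (R : realType) (K : nat).

Definition simplex : set ('I_K -> R) :=
  [set t | (forall i, 0 <= t i) /\ \sum_i t i = 1].

(* Elements of H^1 are classes modulo almost everywhere equality, so pointwise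
   conditions on ownerships are imposed almost everywhere. *)
Definition ownerships (Omega : set (R * R)) : set ('I_K -> R * R -> R) :=
  [set P | (forall i, H1 Omega (P i)) /\
           {ae leb2 R, forall x, Omega x -> simplex (fun i => P i x)}].

Definition patches (Omega : set (R * R)) (Q : 'I_K -> set (R * R)) : Prop :=
  injective Q /\
  forall i, [/\ measurable (Q i : set (plane R)), Q i `<=` Omega & (0 < leb2 R (Q i))%E].

Definition supervised_ownerships (Omega : set (R * R))
    (Q : 'I_K -> set (R * R)) : set ('I_K -> R * R -> R) :=
  [set P | ownerships Omega P /\
           forall i j, {ae leb2 R, forall x, Q j x -> P i x = (i == j)%:R}].

Definition energy (Omega : set (R * R)) (lambda eps : R) (I : R * R -> R)
    (P : 'I_K -> R * R -> R) (m : 'I_K -> R) : \bar R :=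
  (lambda%:E *
     (\sum_(i < K) \int[leb2 R]_(x in Omega) ((I x - m i) ^+ 2 * P i x)%:E) +
   \sum_(i < K) \int[leb2 R]_(x in Omega)
     (9 * eps * normsq_grad Omega (P i) x
      + (P i x * (1 - P i x)) ^+ 2 / eps)%:E)%E.

Definition is_minimizer (A : set ('I_K -> R * R -> R))
    (E : ('I_K -> R * R -> R) -> ('I_K -> R) -> \bar R)
    (P : 'I_K -> R * R -> R) (m : 'I_K -> R) : Prop :=
  A P /\ forall P' m', A P' -> (E P m <= E P' m')%E.

End SoftMumfordShah.

(* Main.v *)
Require Import Defs.
From mathcomp Require Import all_boot all_order all_algebra.
From mathcomp Require Import all_classical all_reals all_analysis.
From mathcomp Require Import measurable_realfun lra ring.

(** The proof is the direct method of the calculus of variations.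

    An admissible P takes values in the simplex, hence each of its components
    lies between 0 and 1 and the energy is a nonnegative real number
    ([real_energyE]).  Along a minimizing sequence the Dirichlet integrals are
    bounded, so a subsequence converges in L^1(Omega) and almost everywhere
    ([ownership_compactness]).  Almost everywhere convergence keeps the simplex
    constraint and the values imposed on the patches; it makes the double well
    terms converge by dominated convergence; and the Dirichlet integrals are
    lower semicontinuous ([weak_partial_lsc]).

    The means need not stay bounded along a minimizing sequence.  For a fixed
    component p, however, the fidelity is a quadratic polynomial
    A - 2 m B + m^2 D in the mean m, where A, B, D are the integrals of I^2 p,
    I p and p.  It is at least A - B^2 / D, which is continuous along the
    sequence as long as the limit of D is positive; when that limit is 0, the
    limit component vanishes almost everywhere and so does its fidelity,
    whatever the mean.  This is [quadratic_eventually_above]; the optimal means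
    are B / D.

    Compactness ([rellich_L1_cauchy]) is obtained by averaging over dyadic
    squares.  The strip of Omega that no small closed dyadic square inside
    Omega covers has small measure, and there the bound by 1 suffices.  On a
    dyadic square of side h with closure in Omega the L^1 distance of p to its
    average is at most 12 h times the L^1 norm of the gradient
    ([poincare_cell]); and the averages, which are countably many bounded
    sequences, converge after a diagonal extraction.  The Poincare inequality
    itself comes from the definition of the weak derivative alone: testing with
    a tent in one variable times a bump in the other compares the integrals of
    p over the two halves of a box ([box_halves]), and summing these
    comparisons over all scales bounds the integral of p minus its average over
    every union of small squares.

    Lower semicontinuity uses the Hilbert structure instead of weak
    compactness: near-minimal elements of the convex sets of derivatives of
    functions close to the limit form a Cauchy sequence by the parallelogram
    identity, and their limit is the weak derivative sought.

    There remains to see that the admissible classes are not empty.  Constant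
    ownerships serve without supervision.  With patches whose closures are
    pairwise disjoint, C^1 cutoff functions ([C1_urysohn]) are combined by
    stick breaking ([supervised_nonempty]); C^1 functions belong to H^1 by
    integration by parts ([C1_H1]). *)
Set Implicit Arguments.
Unset Strict Implicit.
Unset Printing Implicit Defensive.
Import Order.TTheory GRing.Theory Num.Theory.
Import numFieldNormedType.Exports.
Local Open Scope classical_set_scope.
Local Open Scope ring_scope.

(** * Integrals of real functions *)

Section AlmostEverywhere.
Context d (T : measurableType d) (R : realType).
Variables (mu : {measure set T -> \bar R}).

Lemma ae_imply (P Q : T -> Prop) : (forall x, P x -> Q x) ->
  {ae mu, forall x, P x} -> {ae mu, forall x, Q x}.
Proof. by move=> PQ; apply: filterS. Qed.

Lemma ae_imply2 (P Q S : T -> Prop) : (forall x, P x -> Q x -> S x) ->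
  {ae mu, forall x, P x} -> {ae mu, forall x, Q x} -> {ae mu, forall x, S x}.
Proof. by move=> PQ; apply: filterS2. Qed.

End AlmostEverywhere.

Section RealIntegrals.
Context d (T : measurableType d) (R : realType).
Variables (mu : {measure set T -> \bar R}).
Implicit Types (D : set T) (f g : T -> R).

Lemma integrable_measurable D f :
  mu.-integrable D (EFin \o f) -> measurable_fun D f.
Proof. by move/measurable_int/measurable_EFinP. Qed.

Lemma EFin_Rintegral D f : measurable D -> mu.-integrable D (EFin \o f) ->
  (\int[mu]_(x in D) f x)%:E = (\int[mu]_(x in D) (f x)%:E)%E.
Proof. by move=> mD If; rewrite fineK//; exact: integrable_fin_num. Qed.

Lemma Rintegrable_le D f g : measurable D -> measurable_fun D f ->
  mu.-integrable D (EFin \o g) -> (forall x, D x -> `|f x| <= g x) ->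
  mu.-integrable D (EFin \o f).
Proof.
move=> mD mf Ig fg; apply: le_integrable Ig => //; first exact/measurable_EFinP.
move=> x Dx; rewrite /= lee_fin; apply: (le_trans (fg x Dx)).
exact: ler_norm.
Qed.

Lemma RintegrableD D f g : measurable D -> mu.-integrable D (EFin \o f) ->
  mu.-integrable D (EFin \o g) -> mu.-integrable D (EFin \o (fun x => f x + g x)).
Proof. by move=> mD If Ig; exact: (integrableD mD If Ig). Qed.

Lemma RintegrableB D f g : measurable D -> mu.-integrable D (EFin \o f) ->
  mu.-integrable D (EFin \o g) -> mu.-integrable D (EFin \o (fun x => f x - g x)).
Proof. by move=> mD If Ig; exact: (integrableB mD If Ig). Qed.

Lemma RintegrableZ D f k : measurable D -> mu.-integrable D (EFin \o f) ->
  mu.-integrable D (EFin \o (fun x => k * f x)).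
Proof. by move=> mD If; exact: (integrableZl mD k If). Qed.

Lemma Rintegrable_norm D f : mu.-integrable D (EFin \o f) ->
  mu.-integrable D (EFin \o (fun x => `|f x|)).
Proof. exact: integrable_norm. Qed.

Lemma Rintegrable_sum (I : Type) (s : seq I) D (F : I -> T -> R) : measurable D ->
  (forall i, mu.-integrable D (EFin \o F i)) ->
  mu.-integrable D (EFin \o (fun x => \sum_(i <- s) F i x)).
Proof.
move=> mD IF; have -> : EFin \o (fun x => \sum_(i <- s) F i x) =
    (fun x => (\sum_(i <- s) (EFin \o F i) x)%E).
  by apply/funext => x /=; rewrite sumEFin.
exact: integrable_sum.
Qed.

Lemma Rintegral_sum (I : Type) (s : seq I) D (F : I -> T -> R) : measurable D ->
  (forall i, mu.-integrable D (EFin \o F i)) ->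
  \int[mu]_(x in D) (\sum_(i <- s) F i x) = \sum_(i <- s) \int[mu]_(x in D) F i x.
Proof.
move=> mD IF; elim: s => [|a s IH].
  by rewrite big_nil; under eq_Rintegral do rewrite big_nil;
     rewrite Rintegral_cst// mul0r.
under eq_Rintegral do rewrite big_cons.
by rewrite RintegralD// ?IH ?big_cons//; exact: Rintegrable_sum.
Qed.

Lemma Rintegrable_cst D (k : R) : measurable D -> (mu D < +oo)%E ->
  mu.-integrable D (EFin \o cst k).
Proof.
move=> mD Dfin; apply: measurable_bounded_integrable => //.
by exists `|k|; split; [exact: num_real|move=> x kx y _ /=; exact: ltW].
Qed.

Lemma ae_eq_Rintegral D f g : measurable D -> measurable_fun D f ->
  measurable_fun D g -> {ae mu, forall x, D x -> f x = g x} ->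
  \int[mu]_(x in D) f x = \int[mu]_(x in D) g x.
Proof.
move=> mD mf mg fg; congr fine; apply: ae_eq_integral => //.
- exact/measurable_EFinP.
- exact/measurable_EFinP.
- by apply: filterS fg => x fgx Dx /=; rewrite fgx.
Qed.

Lemma ae_le_Rintegral D f g : measurable D -> mu.-integrable D (EFin \o f) ->
  mu.-integrable D (EFin \o g) -> {ae mu, forall x, D x -> f x <= g x} ->
  \int[mu]_(x in D) f x <= \int[mu]_(x in D) g x.
Proof.
move=> mD If Ig fg; rewrite -subr_ge0 -RintegralB//.
have mh : measurable_fun D (fun x => g x - f x).
  by apply: measurable_funB; exact: integrable_measurable.
rewrite (@ae_eq_Rintegral _ _ (fun x => `|g x - f x|))//.
- by apply: Rintegral_ge0 => x _.
- exact: measurableT_comp.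
- by apply: filterS fg => x fgx Dx; rewrite ger0_norm// subr_ge0; exact: fgx.
Qed.

Lemma Rintegral_subset D D' f : measurable D -> measurable D' -> D `<=` D' ->
  mu.-integrable D' (EFin \o f) -> (forall x, D' x -> 0 <= f x) ->
  \int[mu]_(x in D) f x <= \int[mu]_(x in D') f x.
Proof.
move=> mD mD' DD' If f0; apply: fine_le.
- by apply: integrable_fin_num => //; exact: integrableS If.
- exact: integrable_fin_num.
- by apply: ge0_subset_integral => //; exact: measurable_int If.
Qed.

Lemma Rintegral_eq0 D f : measurable D -> mu.-integrable D (EFin \o f) ->
  \int[mu]_(x in D) `|f x| = 0 -> {ae mu, forall x, D x -> f x = 0}.
Proof.
move=> mD If f0; have mf := integrable_measurable If.
have : (\int[mu]_(x in D) `|(EFin \o f) x| = 0)%E.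
  by rewrite -[RHS]/(0%:E) -f0 EFin_Rintegral//; exact: Rintegrable_norm.
move=> /(ae_eq_integral_abs mu mD); case; first exact/measurable_EFinP.
move=> N [mN N0 sub]; exists N; split => // x nx; apply: sub => /= h.
by apply: nx => Dx; have /= [] := h Dx.
Qed.

Lemma ae_forall_fin (I : finType) (P : I -> T -> Prop) :
  (forall i, {ae mu, forall x, P i x}) -> {ae mu, forall x, forall i, P i x}.
Proof. by move=> h; exact: filter_forall. Qed.

(** The real-valued form of dominated convergence, with the measurability of the
    limit as a hypothesis so that it applies to any representative. *)
Lemma Rdominated_cvg D (f_ : nat -> T -> R) f g : measurable D ->
  (forall n, measurable_fun D (f_ n)) -> measurable_fun D f ->
  {ae mu, forall x, D x -> f_ n x @[n --> \oo] --> f x} ->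
  mu.-integrable D (EFin \o g) ->
  (forall n, {ae mu, forall x, D x -> `|f_ n x| <= g x}) ->
  mu.-integrable D (EFin \o f) /\
  \int[mu]_(x in D) f_ n x @[n --> \oo] --> \int[mu]_(x in D) f x.
Proof.
move=> mD mf_ mf f_f Ig f_g.
have [||||If _ cv] := @dominated_convergence _ _ _ mu D mD
    (fun n => EFin \o f_ n) (EFin \o f) (EFin \o g) _ _ _ Ig.
- by move=> n; exact/measurable_EFinP.
- exact/measurable_EFinP.
- apply: filterS f_f => x h Dx; apply: cvg_EFin; last exact: h.
  by near=> n.
- have := ae_foralln f_g.
  by apply: filterS => x h n Dx; rewrite /= lee_fin h.
- split => //; apply: fine_cvg.
  by rewrite EFin_Rintegral.
Unshelve. all: by end_near. Qed.

(** The sequence is cut to 0 on a null set outside of which it converges; the cut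
    sequence converges everywhere, and pointwise limits are measurable. *)
Lemma measurable_ae_limit D (f_ : nat -> T -> R) : measurable D ->
  (forall n, measurable_fun D (f_ n)) ->
  {ae mu, forall x, D x -> cvgn (f_ ^~ x)} ->
  exists f, measurable_fun D f /\ {ae mu, forall x, D x -> f_ n x @[n --> \oo] --> f x}.
Proof.
move=> mD mf_ [N [mN N0 sub]].
pose g_ n := f_ n \_ (D `\` N).
pose f x := limn (g_ ^~ x).
have cg x : cvgn (g_ ^~ x).
  have [xDN|xDN] := pselect ((D `\` N) x).
    rewrite (_ : g_ ^~ x = f_ ^~ x); last first.
      by apply/funext => n; rewrite /g_ patchT// inE.
    case: xDN => Dx Nx; apply: contrapT => nc; apply: Nx; apply: sub => /= /(_ Dx).
    by [].
  rewrite (_ : g_ ^~ x = cst 0); first exact: is_cvg_cst.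
  by apply/funext => n; rewrite /g_ patchC// inE.
exists f; split.
  apply: (@measurable_fun_cvg _ _ _ D g_) => //.
    move=> n; apply: measurable_funTS; apply/(measurable_restrictT _ _).1.
      exact: measurableD.
    by apply: measurable_funS (mf_ n) => //; exact: subDsetl.
exists N; split => // x /= nx; apply: contrapT => Nx; apply: nx => Dx.
have := cg x; rewrite /f (_ : g_ ^~ x = f_ ^~ x)//; apply/funext => n.
by rewrite /g_ patchT// inE.
Qed.

(** Fatou's lemma in the form in which it is applied below: an eventual bound on
    the integrals passes to the limit. *)
Lemma Rfatou D (f_ : nat -> T -> R) f c : measurable D ->
  (forall n, mu.-integrable D (EFin \o f_ n)) -> measurable_fun D f ->
  (forall n x, D x -> 0 <= f_ n x) ->
  {ae mu, forall x, D x -> f_ n x @[n --> \oo] --> f x} ->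
  (\forall n \near \oo, \int[mu]_(x in D) f_ n x <= c) ->
  mu.-integrable D (EFin \o f) /\ \int[mu]_(x in D) f x <= c.
Proof.
move=> mD If_ mf f0 ff [N _ Nc].
have mf_ n := integrable_measurable (If_ n).
have aef0 : {ae mu, forall x, D x -> 0 <= f x}.
  apply: filterS ff => x h Dx.
  have hx := h Dx; rewrite -(cvg_lim _ hx)//.
  by apply: limr_ge; [exact: cvgP hx|near=> n; exact: f0].
(* Shifting the sequence makes the bound hold for all its terms. *)
pose F n x := f_ (n + N)%N x.
have key : (\int[mu]_(x in D) `|(f x)%:E| <= c%:E)%E.
  have -> : (\int[mu]_(x in D) `|(f x)%:E| =
      \int[mu]_(x in D) limn_einf (fun n => (F n x)%:E))%E.
    apply: ae_eq_integral => //.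
    - by apply: measurableT_comp => //; exact/measurable_EFinP.
    - have -> : (fun x => limn_einf (fun n => (F n x)%:E)) =
          (fun x => - limn_esup (fun n => - (F n x)%:E))%E.
        by apply/funext => x; rewrite limn_esupN oppeK.
      apply: measurableT_comp => //; apply: measurable_fun_limn_esup => n.
      rewrite (_ : (fun x => - (F n x)%:E)%E = EFin \o (fun x => - F n x))//.
      by apply/measurable_EFinP; apply: measurableT_comp => //; exact: mf_.
    - apply: filterS2 aef0 ff => x h0 h Dx.
      have hx : (F n x)%:E @[n --> \oo] --> (f x)%:E.
        apply: cvg_EFin; first by near=> n.
        by rewrite /F/=; have := h Dx; rewrite -(cvg_shiftn N).
      rewrite gee0_abs ?lee_fin ?h0//.
      by have [-> _] := cvg_limn_einf_sup hx.
  apply: le_trans.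
    apply: (@fatou _ _ _ mu D mD (fun n x => (F n x)%:E)).
      by move=> n; exact/measurable_EFinP/mf_.
    by move=> n x Dx; rewrite lee_fin f0.
  rewrite limn_einf_lim; apply: lime_le; first exact: is_cvg_einfs.
  apply: nearW => n; apply: (@le_trans _ _ (\int[mu]_(x in D) (F n x)%:E)%E).
    by apply: ereal_inf_lbound; exists n => /=.
  rewrite -(@EFin_Rintegral D (F n) mD (If_ _)) lee_fin.
  by apply: Nc => /=; exact: leq_addl.
have If : mu.-integrable D (EFin \o f).
  apply/integrableP; split; first exact/measurable_EFinP.
  by apply: le_lt_trans key _; rewrite ltry.
split => //; rewrite -lee_fin EFin_Rintegral//; apply: le_trans key.
apply: (@le_integral _ _ _ mu D mD _ _ If (Rintegrable_norm If)) => x _.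
by rewrite /= lee_fin ler_norm.
Unshelve. all: by end_near. Qed.

Lemma integrable_of_sqr D f : measurable D -> (mu D < +oo)%E ->
  measurable_fun D f -> mu.-integrable D (EFin \o (fun x => f x ^+ 2)) ->
  mu.-integrable D (EFin \o f).
Proof.
move=> mD Dfin mf I2; apply: (@Rintegrable_le _ _ (fun x => 1 + f x ^+ 2)) => //.
  by apply: RintegrableD => //; exact: Rintegrable_cst.
move=> x _; rewrite -real_normK ?num_real//.
have := sqr_ge0 (`|f x| - 1/2); nra.
Qed.

Lemma integrable_mul_bounded D f g k : measurable D ->
  mu.-integrable D (EFin \o f) -> measurable_fun D g ->
  (forall x, D x -> `|g x| <= k) -> mu.-integrable D (EFin \o (fun x => f x * g x)).
Proof.
move=> mD If mg gk; apply: (@Rintegrable_le _ _ (fun x => k * `|f x|)) => //.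
- by apply: measurable_funM => //; exact: integrable_measurable.
- by apply: RintegrableZ => //; exact: Rintegrable_norm.
- by move=> x Dx; rewrite normrM mulrC ler_wpM2r// gk.
Qed.

Lemma integrable_indic_mul D f (A : set T) : measurable D -> measurable A ->
  mu.-integrable D (EFin \o f) -> mu.-integrable D (EFin \o (fun x => f x * \1_A x)).
Proof.
move=> mD mA If; apply: (@integrable_mul_bounded _ _ _ 1) => //.
by move=> x _; rewrite indicE; case: (x \in A); rewrite ?normr0 ?normr1.
Qed.

(** The series of the norms of the increments has a finite integral, so it
    converges almost everywhere, and so does the telescoping series. *)
Lemma ae_summable_cvg D (u : nat -> T -> R) : measurable D ->
  (forall n, mu.-integrable D (EFin \o u n)) ->
  (forall k, \int[mu]_(x in D) `|u k.+1 x - u k x| <= 2^-1 ^+ k) ->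
  {ae mu, forall x, D x -> cvgn (u ^~ x)}.
Proof.
move=> mD Iu ku.
pose w k x := `|u k.+1 x - u k x|.
have Iw k : mu.-integrable D (EFin \o w k).
  exact: (Rintegrable_norm (RintegrableB mD (Iu k.+1) (Iu k))).
have mw k : measurable_fun D (EFin \o w k) := measurable_int mu (Iw k).
have geo n : \sum_(0 <= k < n) 2^-1 ^+ k <= 2 :> R.
  suff -> : \sum_(0 <= k < n) 2^-1 ^+ k = 2 - 2 * 2^-1 ^+ n :> R.
    by rewrite lerBlDr lerDl mulr_ge0// exprn_ge0// invr_ge0.
  elim: n => [|n IH]; first by rewrite big_geq// expr0; lra.
  by rewrite big_nat_recr//= IH exprS; lra.
have Sfin : (\int[mu]_(x in D) \sum_(k <oo) (w k x)%:E < +oo)%E.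
  rewrite integral_nneseries//; last by move=> n x _; rewrite lee_fin normr_ge0.
  apply: (@le_lt_trans _ _ 2%:E); last exact: ltry.
  apply: lime_le.
    by apply: is_cvg_nneseries => n _ _; apply: integral_ge0 => x _; rewrite lee_fin normr_ge0.
  apply: nearW => n; rewrite (le_trans _ (_ : ((\sum_(0 <= k < n) 2^-1 ^+ k)%:E <= _)%E))//; last first.
    by rewrite lee_fin.
  rewrite -sumEFin; apply: lee_sum => k _; rewrite -EFin_Rintegral// ?lee_fin.
  exact: ku.
have IS : mu.-integrable D (fun x => (\sum_(k <oo) (w k x)%:E)%E).
  apply/integrableP; split.
    apply: ge0_emeasurable_sum; last by move=> k _; exact: mw.
    by move=> k x _ _; rewrite lee_fin normr_ge0.
  apply: le_lt_trans Sfin; rewrite le_eqVlt; apply/orP; left; apply/eqP.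
  apply: eq_integral => x _; rewrite gee0_abs//.
  by apply: nneseries_ge0 => k _ _; rewrite lee_fin normr_ge0.
have := integrable_ae mD IS; apply: filterS => x h Dx; have {}h := h Dx.
have cw : cvgn (series (fun k => w k x)).
  apply: nondecreasing_is_cvgn.
    by apply: nondecreasing_series => k _ _; rewrite normr_ge0.
  exists (fine (\sum_(k <oo) (w k x)%:E)%E) => _ [n _ <-].
  rewrite -lee_fin fineK//= /series/= -sumEFin.
  by apply: nneseries_lim_ge => k _ _; rewrite lee_fin normr_ge0.
have : cvgn (series (fun k => u k.+1 x - u k x)) by exact: normed_cvg.
rewrite /series/= => ct.
suff -> : u ^~ x = (fun n => u 0%N x + \sum_(0 <= k < n) (u k.+1 x - u k x)).
  by apply: is_cvgD => //; exact: is_cvg_cst.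
by apply/funext => n; rewrite telescope_sumr// addrC subrK.
Qed.

End RealIntegrals.

(** * Approximation of measurable sets by an algebra *)

Section AlgebraApproximation.
Context d (T : measurableType d) (R : realType).
Variables (mu : {measure set T -> \bar R}) (G : set (set T)).
Hypothesis mG : @measurable d T = <<s G >>.
Hypothesis GC : forall A, G A -> G (~` A).
Hypothesis GI : setI_closed G.
Hypothesis GT : G setT.

Let GU A B : G A -> G B -> G (A `|` B).
Proof. by move=> GA GB; rewrite -(setCK (A `|` B)) setCU; apply/GC/GI; exact/GC. Qed.

Let measurableG A : G A -> measurable A.
Proof. by move=> GA; rewrite mG; exact: sub_sigma_algebra. Qed.

(** The measurable sets that can be approximated in the finite measure of density
    w by sets of the algebra G form a lambda-system containing G; Dynkin's
    theorem concludes. *)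
Lemma algebra_approximation D (w : T -> R) : measurable D ->
  mu.-integrable D (EFin \o w) -> (forall x, D x -> 0 <= w x) ->
  forall S, measurable S -> forall e, 0 < e ->
  exists2 A, G A & \int[mu]_(x in D) (w x * `|\1_S x - \1_A x|) <= e.
Proof.
move=> mD Iw w0.
have Idist S A : measurable S -> measurable A ->
    mu.-integrable D (EFin \o (fun x => w x * `|\1_S x - \1_A x|)).
  move=> mS mA; apply: (@integrable_mul_bounded _ _ _ _ _ _ _ 1) => //.
    by apply: measurableT_comp => //; apply: measurable_funB; exact: measurable_indic.
  move=> x _; rewrite normr_id !indicE.
  by case: (x \in S); case: (x \in A); rewrite ?subrr ?subr0 ?sub0r ?normrN ?normr0 ?normr1.
pose P S := measurable S /\ forall e, 0 < e ->
  exists2 A, G A & \int[mu]_(x in D) (w x * `|\1_S x - \1_A x|) <= e.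
have PU A B : P A -> P B -> P (A `|` B).
  move=> [mA PA] [mB PB]; split; first exact: measurableU.
  move=> e e0; have e2 : 0 < e / 2 by rewrite divr_gt0.
  have [A' GA' HA'] := PA _ e2; have [B' GB' HB'] := PB _ e2.
  exists (A' `|` B'); first exact: GU.
  have [mA' mB'] := (measurableG GA', measurableG GB').
  rewrite (splitr e); apply: le_trans (lerD HA' HB'); rewrite -RintegralD//; [|exact: Idist..].
  apply: le_Rintegral => //.
  - by apply: Idist; exact: measurableU.
  - by apply: RintegrableD => //; exact: Idist.
  move=> x Dx; rewrite -mulrDr ler_wpM2l ?w0// !indicE !in_setU.
  by case: (x \in A); case: (x \in B); case: (x \in A'); case: (x \in B') => /=;
    rewrite ?subrr ?subr0 ?sub0r ?normrN ?normr0 ?normr1 ?addr0 ?add0r ?lexx ?ler01 ?ler0n//; lra.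
have PG A : G A -> P A.
  move=> GA; split; first exact: measurableG.
  move=> e e0; exists A => //; under eq_Rintegral do rewrite subrr normr0 mulr0.
  by rewrite Rintegral_cst// mul0r ltW.
suff PS S : measurable S -> P S by move=> S /PS[].
rewrite mG; apply: (@dynkin_induction _ T G P) => //; first exact: PG.
- move=> S' mS [_ PS]; split; first exact: measurableC.
  move=> e /PS[A GA H]; exists (~` A); first exact: GC.
  apply: le_trans H; rewrite le_eqVlt; apply/orP; left; apply/eqP.
  apply: eq_Rintegral => x _; congr (_ * _); rewrite !indicE !in_setC.
  by case: (x \in S'); case: (x \in A) => /=; rewrite ?subrr ?subr0 ?sub0r ?normrN ?normr0 ?normr1.
- move=> F mF _ PF; have mUF : measurable (\bigcup_k F k) by exact: bigcup_measurable.
  split => // e e0; have e2 : 0 < e / 2 by rewrite divr_gt0.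
  (* A countable union is close to a finite one, by dominated convergence. *)
  pose Fn n := \big[setU/set0]_(k < n) F k.
  have PFn n : P (Fn n).
    rewrite /Fn; elim: n => [|n IH]; last by rewrite big_ord_recr/=; exact: PU.
    rewrite big_ord0 -setCT; apply: PG; exact: GC.
  have mFn n : measurable (Fn n) by case: (PFn n).
  have cvx : {ae mu, forall x, D x ->
      w x * `|\1_(\bigcup_k F k) x - \1_(Fn n) x| @[n --> \oo] --> 0}.
    apply: aeW => x Dx; apply: cvg_near_cst.
    have [[k _ Fkx]|nx] := pselect ((\bigcup_k F k) x).
      exists k.+1 => // n /= kn; rewrite !indicE !mem_set ?subrr ?normr0 ?mulr0//.
        by rewrite /Fn -bigcup_mkord; exists k.
      by exists k.
    apply: nearW => n; rewrite !indicE !memNset ?subrr ?normr0 ?mulr0//.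
    by rewrite /Fn -bigcup_mkord => -[k _ Fkx]; apply: nx; exists k.
  have bdx n : {ae mu, forall x, D x ->
      `|w x * `|\1_(\bigcup_k F k) x - \1_(Fn n) x| | <= w x}.
    apply: aeW => x Dx; rewrite ger0_norm ?mulr_ge0 ?w0// ler_piMr ?w0// !indicE.
    by case: (x \in _); case: (x \in _); rewrite ?subrr ?subr0 ?sub0r ?normrN ?normr0 ?normr1.
  have [_] := Rdominated_cvg mD (fun n => integrable_measurable (Idist _ _ mUF (mFn n)))
    (measurable_cst (0 : R)) cvx Iw bdx.
  rewrite Rintegral_cst// mul0r => /cvgrPdist_le/(_ _ e2)[n _ /(_ n (leqnn n))].
  rewrite sub0r normrN ger0_norm; last first.
    by apply: Rintegral_ge0 => x Dx; rewrite mulr_ge0 ?w0.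
  move=> H1; have [_ /(_ _ e2)[A GA H2]] := PFn n.
  exists A => //; have mA := measurableG GA.
  rewrite (splitr e); apply: le_trans (lerD H1 H2); rewrite -RintegralD//; [|exact: Idist..].
  apply: le_Rintegral => //; [exact: Idist|by apply: RintegrableD => //; exact: Idist|].
  move=> x Dx; rewrite -mulrDr ler_wpM2l ?w0//.
  by rewrite (le_trans _ (ler_normD _ _))// addrA subrK.
Qed.

(** The L^1 norm of g is 2 times its integral over the set S where g is positive
    minus its integral over D; the former is a limit of integrals over sets of
    G, and the latter is tested by the whole space. *)
Lemma algebra_norm_bound D (g : T -> R) C : measurable D ->
  mu.-integrable D (EFin \o g) ->
  (forall A, G A -> `|\int[mu]_(x in D) (g x * \1_A x)| <= C) ->
  \int[mu]_(x in D) `|g x| <= 3 * C.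
Proof.
move=> mD Ig HG; have mg := integrable_measurable Ig.
have Ind S : measurable S -> mu.-integrable D (EFin \o (fun x => g x * \1_S x)).
  by move=> mS; exact: integrable_indic_mul.
pose S := D `&` [set x | 0 < g x].
have mS : measurable S.
  have := mg mD _ (@measurable_itv R `]0, +oo[).
  by congr measurable; apply/seteqP; split => x /=; rewrite in_itv/= andbT.
have HS : \int[mu]_(x in D) (g x * \1_S x) <= C.
  apply/ler_addgt0Pr => e e0.
  have [A GA HA] := algebra_approximation mD (Rintegrable_norm Ig) (fun x _ => normr_ge0 _) mS e0.
  have mA := measurableG GA.
  apply: le_trans (lerD (HG A GA) HA); rewrite -lerBlDl.
  apply: le_trans (_ : _ <= \int[mu]_(x in D) (g x * \1_S x) - \int[mu]_(x in D) (g x * \1_A x)) _.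
    by rewrite lerB// ler_norm.
  rewrite -RintegralB//; [|exact: Ind..].
  apply: le_Rintegral => //.
  - by apply: RintegrableB => //; exact: Ind.
  - apply: (@integrable_mul_bounded _ _ _ _ _ _ _ 1) => //; first exact: Rintegrable_norm.
      by apply: measurableT_comp => //; apply: measurable_funB; exact: measurable_indic.
    move=> x _; rewrite normr_id !indicE.
    by case: (x \in S); case: (x \in A); rewrite ?subrr ?subr0 ?sub0r ?normrN ?normr0 ?normr1.
  - by move=> x Dx; rewrite -mulrBr -normrM ler_norm.
have -> : \int[mu]_(x in D) `|g x| = 2 * \int[mu]_(x in D) (g x * \1_S x) - \int[mu]_(x in D) (g x * \1_setT x).
  rewrite -RintegralZl//; last exact: Ind.
  rewrite -RintegralB//; [|by apply: RintegrableZ => //; exact: Ind|exact: Ind].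
  apply: eq_Rintegral => x /set_mem Dx; rewrite !indicE in_setT mulr1.
  have [g0|g0] := ltP 0 (g x).
    by rewrite mem_set// mulr1 gtr0_norm//; lra.
  rewrite memNset; last by move=> [_ /=]; rewrite ltNge g0.
  by rewrite ler0_norm// mulr0n !mulr0 sub0r.
have := HG _ GT; rewrite ler_norml => /andP[HT _].
by lra.
Qed.

End AlgebraApproximation.

(** * Dyadic squares of the plane *)

Section Dyadic.
Variable R : realType.
Implicit Types (N : nat) (t : R) (i j : int) (S : set (plane R)) (O : set (R * R)).

Definition dyadic N t : int := Num.floor (2 ^+ N * t).

Definition cell N i j : set (plane R) :=
  [set x | dyadic N x.1 = i /\ dyadic N x.2 = j].

(** The unions of dyadic squares of side 2^-N. *)
Definition level N S := forall x y : plane R,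
  dyadic N x.1 = dyadic N y.1 -> dyadic N x.2 = dyadic N y.2 -> S x -> S y.

(** These sets form an algebra, because a union of squares of one level is also
    a union of squares of every finer level. *)
Definition dyadic_set S := exists N, level N S.

Let pow2_gt0 N : 0 < 2 ^+ N :> R. Proof. by rewrite exprn_gt0. Qed.

Lemma dyadicP N t i :
  dyadic N t = i <-> i%:~R <= 2 ^+ N * t < (i + 1)%:~R.
Proof.
split=> [<-|]; first exact: floor_itv.
exact: floor_def.
Qed.

Lemma dyadic_itv N t i : dyadic N t = i <->
  i%:~R / 2 ^+ N <= t < (i + 1)%:~R / 2 ^+ N.
Proof.
rewrite dyadicP ler_pdivrMr ?ltr_pdivlMr// [t * _]mulrC.
by split.
Qed.

Lemma dyadic_split N t i : dyadic N t = i <->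
  dyadic N.+1 t = i * 2 \/ dyadic N.+1 t = i * 2 + 1.
Proof.
rewrite !dyadicP exprS -mulrA; set s := 2 ^+ N * t.
rewrite !intrD !intrM; split => [/andP[h1 h2]|].
  by have [h|h] := ltP (2 * s) (i%:~R * 2 + 1); [left|right]; apply/andP; split; lra.
by case=> /andP[h1 h2]; apply/andP; split; lra.
Qed.

Lemma dyadicS N s t : dyadic N.+1 s = dyadic N.+1 t -> dyadic N s = dyadic N t.
Proof.
move=> st; apply/dyadic_split; rewrite st; exact/dyadic_split.
Qed.

Lemma dyadic_leq N M s t : (N <= M)%N ->
  dyadic M s = dyadic M t -> dyadic N s = dyadic N t.
Proof.
move=> /subnKC <-; elim: (M - N)%N => [|k IH]; first by rewrite addn0.
by rewrite addnS => /dyadicS.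
Qed.

Lemma level_leq N M S : (N <= M)%N -> level N S -> level M S.
Proof.
move=> NM LS x y h1 h2; apply: LS; exact: dyadic_leq NM _.
Qed.

Lemma dyadic_setC S : dyadic_set S -> dyadic_set (~` S).
Proof. by move=> [N LS]; exists N => x y h1 h2 Sx Sy; apply: Sx; exact: LS Sy. Qed.

Lemma dyadic_setI : setI_closed dyadic_set.
Proof.
move=> A B [N LA] [M LB]; exists (maxn N M) => x y h1 h2 [Ax Bx]; split.
  exact: (level_leq (leq_maxl N M) LA) Ax.
exact: (level_leq (leq_maxr N M) LB) Bx.
Qed.

Lemma dyadic_setT : dyadic_set setT. Proof. by exists 0%N. Qed.

Lemma cellE N i j : cell N i j =
  `[i%:~R / 2 ^+ N, (i + 1)%:~R / 2 ^+ N[%classic `*`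
  `[j%:~R / 2 ^+ N, (j + 1)%:~R / 2 ^+ N[%classic.
Proof.
apply/seteqP; split => x; rewrite /cell/= !in_itv/=.
  by case=> /dyadic_itv-> /dyadic_itv->.
by case=> h1 h2; split; exact/dyadic_itv.
Qed.

Lemma measurable_cell N i j : measurable (cell N i j).
Proof. by rewrite cellE; apply: measurableX; exact: measurable_itv. Qed.

(** Numbering the squares of one level by natural numbers gives access to the
    countable additivity of measures and integrals. *)
Definition ncell N n : set (plane R) :=
  if pickle_inv n is Some p then cell N (p : int * int).1 p.2 else set0.

Lemma ncellK N (p : int * int) : ncell N (pickle p) = cell N p.1 p.2.
Proof. by rewrite /ncell pickleK_inv. Qed.

Lemma measurable_ncell N n : measurable (ncell N n).
Proof. by rewrite /ncell; case: pickle_inv => // p; exact: measurable_cell. Qed.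

Lemma trivIset_ncell N : trivIset setT (ncell N).
Proof.
apply/trivIsetP => n m _ _ nm; apply/seteqP; split => // x; rewrite /ncell.
have := pickle_invK (T := (int * int)%type) n; have := pickle_invK (T := (int * int)%type) m.
case: pickle_inv => [q|]; last by move=> _ _ [].
case: pickle_inv => [p|]; last by move=> _ _ [].
rewrite /= => qm pn [[h1 h2] [h3 h4]]; case/eqP: nm; rewrite -qm -pn.
by congr pickle; rewrite (surjective_pairing p) (surjective_pairing q) -h1 -h2 -h3 -h4.
Qed.

Lemma bigcup_ncell N : \bigcup_n ncell N n = setT.
Proof.
apply/seteqP; split; first by [].
move=> x _; exists (pickle (dyadic N x.1, dyadic N x.2)); first exact: I.
by rewrite ncellK.
Qed.

Lemma level_cell N i j S : level N S -> cell N i j `<=` S \/ cell N i j `&` S = set0.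
Proof.
move=> LS; have [[x [[h1 h2] Sx]]|h] := pselect (exists x, cell N i j x /\ S x).
  by left => y [h3 h4]; apply: LS Sx; rewrite ?h1 ?h2 ?h3 ?h4.
by right; apply/seteqP; split => // x [h1 h2]; apply: h; exists x.
Qed.

Lemma ncell_level N S n : level N S -> ncell N n `<=` S \/ ncell N n `&` S = set0.
Proof.
by move=> LS; rewrite /ncell; case: pickle_inv => [p|]; [exact: level_cell|left].
Qed.

Lemma level_measurable N S : level N S -> measurable S.
Proof.
move=> LS; rewrite -(setTI S) -(bigcup_ncell N) setI_bigcupl.
apply: bigcup_measurable => n _.
have [h|->] := ncell_level n LS => //.
by rewrite setIidl//; exact: measurable_ncell.
Qed.

Lemma level_measurable_fun N D (f : plane R -> R) : measurable D ->
  (forall x y, dyadic N x.1 = dyadic N y.1 -> dyadic N x.2 = dyadic N y.2 -> f x = f y) ->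
  measurable_fun D f.
Proof.
move=> mD Hf; apply: measurable_funTS => _ Y mY; rewrite setTI.
by apply: (@level_measurable N) => x y h1 h2 /=; rewrite (Hf x y).
Qed.

Lemma pow2_le_small (e : R) : 0 < e -> exists N, (2 ^+ N)^-1 <= e.
Proof.
move=> e0; have : 2^-1 ^+ n @[n --> \oo] --> (0 : R).
  by apply: cvg_expr; rewrite ger0_norm ?invr_ge0// invf_lt1// ltr1n.
move=> /cvgrPdist_le/(_ _ e0)[N _ /(_ N (leqnn N))]; rewrite sub0r normrN.
by rewrite ger0_norm ?exprn_ge0 ?invr_ge0// exprVn => h; exists N.
Qed.

(** A half-plane is a countable union of dyadic half-planes, one for each level,
    by approximating its bounding coordinate from below. *)
Lemma dyadic_set_generates : @measurable _ (plane R) = <<s dyadic_set>>.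
Proof.
apply/seteqP; split; last first.
  apply: smallest_sub; first exact: sigma_algebra_measurable.
  by move=> S [N]; exact: level_measurable.
rewrite measurable_prod_measurableType; apply: smallest_sub.
  exact: smallest_sigma_algebra.
have key (coordinate : plane R -> R) : (coordinate = fst \/ coordinate = snd) ->
    forall A, measurable (A : set (measurableTypeR R)) -> <<s dyadic_set>> (coordinate @^-1` A).
  move=> Hpr A mA.
  have := @measurability _ _ (g_sigma_algebraType dyadic_set) (measurableTypeR R) setT coordinate _
    (RGenInftyO.measurableE R).
  rewrite /measurable_fun => /(_ _ measurableT A mA); rewrite setTI; apply.
  move=> _ [_ [x ->] <-]; rewrite setTI.
  have -> : coordinate @^-1` `]-oo, x[%classic =
      \bigcup_N [set p | (dyadic N (coordinate p) + 1)%:~R / 2 ^+ N <= x].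
    apply/seteqP; split => [p /=|p [N _ /=]]; rewrite in_itv/=.
      move=> px; have [N HN] := pow2_le_small (etrans (subr_gt0 _ _) px).
      exists N => //=; have /dyadic_itv/andP[h _] := erefl (dyadic N (coordinate p)).
      by rewrite intrD mulrDl mul1r; lra.
    by move=> h; have /dyadic_itv/andP[_ h2] := erefl (dyadic N (coordinate p)); exact: lt_le_trans h2 h.
  apply: sigma_algebra_bigcup => N; apply: sub_sigma_algebra; exists N => p q h1 h2 /=.
  by case: Hpr => ->; rewrite ?h1 ?h2.
move=> _ [A mA [B mB <-]].
have -> : A `*` B = (fst @^-1` A) `&` (snd @^-1` B) by [].
have := @measurableI _ (g_sigma_algebraType dyadic_set) (fst @^-1` A) (snd @^-1` B).
by apply; apply: key => //; [left|right].
Qed.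

(** Closed squares are what compactly supported test functions need: a bump on
    the square has its support in the closed square. *)
Definition closed_cell N i j : set (R * R) :=
  [set x | i%:~R / 2 ^+ N <= x.1 <= (i + 1)%:~R / 2 ^+ N /\
           j%:~R / 2 ^+ N <= x.2 <= (j + 1)%:~R / 2 ^+ N].

(** The union of the squares of level N whose closure is contained in O. *)
Definition inner_cells N O : set (plane R) :=
  [set x | closed_cell N (dyadic N x.1) (dyadic N x.2) `<=` O].

Lemma cell_closed_cell N i j : cell N i j `<=` closed_cell N i j.
Proof.
by move=> x [/dyadic_itv/andP[h1 /ltW h2] /dyadic_itv/andP[h3 /ltW h4]]; split; apply/andP.
Qed.

Lemma level_inner N O : level N (inner_cells N O).
Proof. by move=> x y h1 h2; rewrite /inner_cells/= h1 h2. Qed.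

Lemma measurable_inner N O : measurable (inner_cells N O).
Proof. exact: level_measurable (@level_inner N O). Qed.

Lemma inner_sub N O : inner_cells N O `<=` O.
Proof. by move=> x h; apply/h/cell_closed_cell. Qed.

Lemma closed_cell_child N i j (a b : int) : (a = i * 2 \/ a = i * 2 + 1) ->
  (b = j * 2 \/ b = j * 2 + 1) -> closed_cell N.+1 a b `<=` closed_cell N i j.
Proof.
have key (k c : int) t : (c = k * 2 \/ c = k * 2 + 1) ->
    c%:~R / 2 ^+ N.+1 <= t <= (c + 1)%:~R / 2 ^+ N.+1 ->
    k%:~R / 2 ^+ N <= t <= (k + 1)%:~R / 2 ^+ N.
  rewrite !ler_pdivrMr// !ler_pdivlMr// exprS; set p := 2 ^+ N.
  rewrite !intrD => hc; have hc' : c%:~R = k%:~R * 2 :> R \/ c%:~R = k%:~R * 2 + 1 :> R.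
    by case: hc => ->; rewrite ?intrD intrM; [left|right].
  have -> : t * (2 * p) = 2 * (t * p) by ring.
  by move=> /andP[h1 h2]; apply/andP; case: hc' => h; split; lra.
by move=> ha hb x [h1 h2]; split; [exact: key h1|exact: key h2].
Qed.

Lemma inner_leq N M O : (N <= M)%N -> inner_cells N O `<=` inner_cells M O.
Proof.
move=> /subnKC <-; elim: (M - N)%N => [|k IH]; first by rewrite addn0.
apply: subset_trans IH _; rewrite addnS => x h; apply: subset_trans h.
by apply: closed_cell_child; apply/dyadic_split.
Qed.

(** A ball around a point of O contains every sufficiently small closed square
    through that point. *)
Lemma bigcup_inner O : open O -> \bigcup_N inner_cells N O = O.
Proof.
move=> oO; apply/seteqP; split => [x [N _ /inner_sub//]|x Ox].
have /nbhs_ballP[e /= e0 He] : nbhs x O by exact: open_nbhs_nbhs.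
have [N HN] := pow2_le_small (divr_gt0 e0 (ltr0n _ 2)).
exists N => //= y [/andP[h1 h2] /andP[h3 h4]]; apply: He.
have key (s t : R) : (dyadic N s)%:~R / 2 ^+ N <= t -> t <= (dyadic N s + 1)%:~R / 2 ^+ N ->
    `|s - t| < e.
  have /dyadic_itv/andP := erefl (dyadic N s).
  rewrite intrD mulrDl mul1r => -[h5 h6] h7 h8.
  rewrite ltr_norml; apply/andP; split; lra.
by split; rewrite /ball/=; exact: key.
Qed.

Lemma open_measurable_plane O : open O -> measurable (O : set (plane R)).
Proof.
move=> oO; rewrite -(bigcup_inner oO); apply: bigcup_measurable => N _.
exact: measurable_inner.
Qed.

Lemma continuous_measurable_plane D (f : R * R -> R) : measurable D ->
  continuous f -> measurable_fun (D : set (plane R)) f.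
Proof.
move=> mD cf; apply: measurable_funTS.
apply: (measurability _ (RGenOpens.measurableE R)) => _ [_ [a [b ->]] <-].
rewrite setTI; apply: open_measurable_plane.
by apply: open_comp => // x _; exact: cf.
Qed.

Lemma leb2X (A B : set (measurableTypeR R)) : measurable A -> measurable B ->
  leb2 R (A `*` B) = (lebesgue_measure A * lebesgue_measure B)%E.
Proof. by move=> mA mB; exact: product_measure1E. Qed.

Lemma leb2_rect (a b c d : R) : a <= b -> c <= d ->
  leb2 R (`[a, b[%classic `*` `[c, d[%classic) = ((b - a) * (d - c))%:E.
Proof.
move=> ab cd; rewrite leb2X; [|exact: measurable_itv..].
rewrite !lebesgue_measure_itv/= !lte_fin.
have [ab'|ba] := ltP a b; have [cd'|dc] := ltP c d;
  rewrite ?EFinB ?EFinM ?mule0 ?mul0e//.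
- by have -> : d - c = 0; [lra|rewrite mule0].
- by have -> : b - a = 0; [lra|rewrite mul0e].
- by have -> : b - a = 0; [lra|rewrite mul0e].
Qed.

Lemma leb2_cell N i j : leb2 R (cell N i j) = (((2 ^+ N)^-1) ^+ 2)%:E.
Proof.
rewrite cellE leb2_rect; last 2 first.
- by rewrite ler_pM2r ?invr_gt0// ler_int lerDl.
- by rewrite ler_pM2r ?invr_gt0// ler_int lerDl.
congr EFin; rewrite !intrD; set p := (2 ^+ N)^-1; ring.
Qed.

Lemma bounded_set_leb2 O : bounded_set O -> measurable (O : set (plane R)) ->
  (leb2 R O < +oo)%E.
Proof.
move=> [M [_ HM]] mO.
pose B := M + 1.
have OB' x : O x -> `|x| <= B.
  by move=> Ox; apply: (HM B _ x Ox); rewrite /B ltrDl ltr01.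
have OB : O `<=` (`[- B, B + 1[%classic `*` `[- B, B + 1[%classic : set (plane R)).
  move=> x /OB'; rewrite prod_normE ge_max !ler_norml => /andP[/andP[h1 h2] /andP[h3 h4]].
  by split; rewrite /= in_itv/=; apply/andP; split => //; lra.
have [B0|B0] := leP 0 B; last first.
  rewrite (_ : O = set0) ?measure0//; apply/seteqP; split => // x /OB'.
  by rewrite leNgt (lt_le_trans B0).
apply: (@le_lt_trans _ _ (leb2 R (`[- B, B + 1[%classic `*` `[- B, B + 1[%classic))).
  by apply: le_measure => //; rewrite inE//; apply: measurableX; exact: measurable_itv.
by rewrite leb2_rect ?ltry//; lra.
Qed.

Lemma leb2_vline (a : R) : leb2 R [set x | x.1 = a] = 0%E.
Proof.
have -> : [set x : plane R | x.1 = a] = [set a] `*` setT.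
  by apply/seteqP; split => x //= [].
by rewrite leb2X// lebesgue_measure_set1 mul0e.
Qed.

Lemma leb2_hline (a : R) : leb2 R [set x | x.2 = a] = 0%E.
Proof.
have -> : [set x : plane R | x.2 = a] = setT `*` [set a].
  by apply/seteqP; split => x //= [].
by rewrite leb2X// lebesgue_measure_set1 mule0.
Qed.

End Dyadic.

(** * Smooth bumps and tents *)

Section SmoothFunctions.
Variable R : realType.
Implicit Types (a b : R -> R).

Lemma is_deriveD1 a b (t da db : R) : is_derive t (1 : R) a da -> is_derive t (1 : R) b db ->
  is_derive t (1 : R) (fun s => a s + b s) (da + db).
Proof. by move=> ha hb; have := is_deriveD ha hb. Qed.

Lemma is_deriveM1 a b (t da db : R) : is_derive t (1 : R) a da -> is_derive t (1 : R) b db ->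
  is_derive t (1 : R) (fun s => a s * b s) (a t * db + b t * da).
Proof. by move=> ha hb; have := is_deriveM ha hb. Qed.

Lemma is_derive_affine (k l t : R) : is_derive t (1 : R) (fun s : R => k * s + l) k.
Proof.
have dk : is_derive t (1 : R) (fun t : R => k * t) k.
  by apply: is_derive_eq; rewrite /GRing.scale/= mulr1.
by have := is_deriveD1 dk (is_derive_cst l t (1 : R)); rewrite addr0.
Qed.

(** t^-n exp(-1/t) for positive t; the derivative of such a function is a
    combination of two functions of the same form, whence smoothness at 0. *)
Definition flat n (t : R) : R := if 0 < t then t^-1 ^+ n * expR (- t^-1) else 0.

Lemma expr_le_expR n (y : R) : 0 <= y -> y ^+ n <= n`!%:R * expR y.
Proof.
case: n => [|n] y0; first by rewrite expr0 fact0 mul1r; case: (ltgtP y 0) y0 => // [y1|->] _;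
  rewrite ?expR0// ltW// expR_gt1.
have := expR_ge1Dxn n y0; rewrite -lerBrDl => h.
have f0 : 0 < (n.+1)`!%:R :> R by rewrite ltr0n fact_gt0.
rewrite -ler_pdivrMl// mulrC; apply: (le_trans h); rewrite gerBl//.
Qed.

(** The quadratic decay at 0 gives the vanishing derivative there. *)
Lemma flat_bound n t : `|flat n t| <= (n.+2)`!%:R * t ^+ 2.
Proof.
rewrite /flat; case: ltP => [t0|t0]; last by rewrite normr0 mulr_ge0// sqr_ge0.
have y0 : 0 < t^-1 by rewrite invr_gt0.
rewrite ger0_norm; last by rewrite mulr_ge0 ?expR_ge0// exprn_ge0// ltW.
rewrite expRN ler_pdivrMr ?expR_gt0//.
have := expr_le_expR n.+2 (ltW y0); rewrite -(addn2 n) exprD => h.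
have -> : t^-1 ^+ n = t^-1 ^+ n * t^-1 ^+ 2 * t ^+ 2.
  by rewrite -mulrA -exprMn mulVf ?gt_eqF// expr1n mulr1.
by rewrite [leRHS]mulrAC ler_wpM2r ?sqr_ge0.
Qed.

Lemma is_derive_at0 (f : R -> R) C : f 0 = 0 -> (forall t, `|f t| <= C * t ^+ 2) ->
  is_derive (0 : R) (1 : R) f 0.
Proof.
move=> f0 fC.
have C0 : 0 <= C by have := fC 1; rewrite expr1n mulr1; exact: le_trans.
have lim0 : h^-1 *: ((f \o shift 0) (h *: 1) - f 0) @[h --> 0^'] --> (0 : R).
  apply/cvgrPdist_le => e e0; near=> h.
  rewrite sub0r normrN f0 subr0 /= addr0 /GRing.scale/= mulr1 normrM normfV.
  have h0 : h != 0 by near: h; exact: nbhs_dnbhs_neq.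
  rewrite ler_pdivrMl ?normr_gt0//; apply: (le_trans (fC h)).
  rewrite -real_normK ?num_real// expr2 mulrA mulrC ler_wpM2l//.
  apply: (@le_trans _ _ ((C + 1) * `|h|)); first by rewrite ler_wpM2r// lerDl.
  rewrite -ler_pdivlMl ?ltr_wpDl// mulrC.
  by near: h; apply: dnbhs0_le; exact: divr_gt0 e0 (ltr_wpDl C0 ltr01).
by apply: DeriveDef; [exact: cvgP lim0|exact: cvg_lim lim0].
Unshelve. all: by end_near. Qed.

Lemma is_derive_flat n t :
  is_derive t (1 : R) (flat n) (flat n.+2 t + - n%:R * flat n.+1 t).
Proof.
have [t0|t0|->] := ltgtP t 0.
- have -> : flat n.+2 t + - n%:R * flat n.+1 t = 0.
    by rewrite /flat !ltNge (ltW t0)/= mulr0 addr0.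
  apply: (@near_eq_is_derive _ _ _ (cst 0)).
    near=> s; rewrite /flat ltNge (_ : s <= 0)//; apply/ltW.
    by near: s; exact: lt_nbhsl.
- have tn : t != 0 by rewrite gt_eqF.
  have dV : is_derive t (1 : R) (fun s : R => s^-1) (- t ^- 2).
    by have := @is_deriveV _ id t _ _ tn (is_derive_id t (1 : R)); rewrite /GRing.scale/= mulr1.
  have dN : is_derive t (1 : R) (fun s : R => - s^-1) (t ^- 2).
    by apply: is_derive_eq; rewrite opprK.
  have dE : is_derive t (1 : R) (fun s : R => expR (- s^-1)) (expR (- t^-1) * t ^- 2).
    exact: (@is_derive1_comp _ expR (fun s : R => - s^-1)).
  have dX : is_derive t (1 : R) (fun s : R => s^-1 ^+ n) (n%:R * t^-1 ^+ n.-1 * - t ^- 2).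
    rewrite (_ : (fun s : R => s^-1 ^+ n) = (fun s : R => s^-1) ^+ n); last first.
      by apply/funext => s; rewrite exprfctE.
    exact: (@is_deriveX _ _ (fun s : R => s^-1) n _ _ _ dV).
  have dM := is_deriveM1 dX dE.
  apply: (near_eq_is_derive _ (is_derive_eq dM _)).
    near=> s; rewrite /flat (_ : 0 < s)//.
    by near: s; exact: lt_nbhsr.
  rewrite /flat t0 -!exprVn.
  case: n {dX dM} => [|n]; first by rewrite !expr0; ring.
  by rewrite /= !exprS; ring.
- have -> : flat n.+2 0 + - n%:R * flat n.+1 0 = 0.
    by rewrite /flat !ltxx mulr0 addr0.
  apply: (is_derive_at0 _ (flat_bound n)).
  by rewrite /flat ltxx.
Unshelve. all: by end_near. Qed.

Lemma flat0_ge0 t : 0 <= flat 0 t.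
Proof. by rewrite /flat expr0 mul1r; case: ifP => // _; exact: expR_ge0. Qed.

Lemma flat0_le1 t : flat 0 t <= 1.
Proof.
rewrite /flat expr0 mul1r; case: ifP => // t0.
by rewrite expR_le1 oppr_le0 invr_ge0 ltW.
Qed.

Lemma flat_eq0 n t : t <= 0 -> flat n t = 0.
Proof. by move=> t0; rewrite /flat ltNge t0. Qed.

(** Stretching the argument turns the function exp(-1/t) into an approximation of
    the indicator function of positive numbers. *)
Lemma flat0_cvg t : 0 < t -> flat 0 (k%:R * t) @[k --> \oo] --> (1 : R).
Proof.
move=> t0.
have H : - (k.+1%:R * t)^-1 @[k --> \oo] --> (0 : R).
  rewrite -[X in _ --> X]oppr0; apply: cvgN.
  have -> : (fun k : nat => (k.+1%:R * t)^-1) = (fun k => harmonic k * t^-1).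
    by apply/funext => k; rewrite /harmonic/= invfM.
  by rewrite -[X in _ --> X](mul0r t^-1); apply: cvgM; [exact: cvg_harmonic|exact: cvg_cst].
have : expR (- (k.+1%:R * t)^-1) @[k --> \oo] --> (1 : R).
  by rewrite -[X in _ --> X](@expR0 R); exact: (cvg_comp _ _ H (@continuous_expR R 0)).
rewrite -(cvg_shiftS (fun k => flat 0 (k%:R * t))).
have -> // : (fun k : nat => expR (- (k.+1%:R * t)^-1)) = (fun k : nat => flat 0 (k.+1%:R * t)).
by apply/funext => k; rewrite /flat expr0 mul1r mulr_gt0.
Qed.

(** A class of smooth functions closed under differentiation, and under the
    operations that produce bumps and tents; being inductive, it makes
    smoothness of all orders a consequence of its closure properties. *)
Inductive elementary : (R -> R) -> Prop :=
| elementary_flat n : elementary (flat n)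
| elementary_cst c : elementary (fun=> c)
| elementary_affine k l a : elementary a -> elementary (fun t => a (k * t + l))
| elementary_add a b : elementary a -> elementary b -> elementary (fun t => a t + b t)
| elementary_mul a b : elementary a -> elementary b -> elementary (fun t => a t * b t)
| elementary_primitive a b : elementary a -> (forall t, is_derive t (1 : R) b (a t)) -> elementary b.

Lemma elementary_derive a : elementary a ->
  exists2 b, elementary b & forall t, is_derive t (1 : R) a (b t).
Proof.
elim=> {a}.
- move=> n; exists (fun t => flat n.+2 t + - n%:R * flat n.+1 t); last exact: is_derive_flat.
  apply: elementary_add; first exact: elementary_flat.
  by apply: elementary_mul; [exact: elementary_cst|exact: elementary_flat].
- by move=> c; exists (fun=> 0); [exact: elementary_cst|move=> t; exact: is_derive_cst].
- move=> k l a ea [b eb ab]; exists (fun t => b (k * t + l) * k).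
    by apply: elementary_mul; [exact: elementary_affine|exact: elementary_cst].
  move=> t; apply: (@is_derive1_comp _ a (fun t => k * t + l)).
  exact: is_derive_affine.
- move=> a b ea [a' ea' aa'] eb [b' eb' bb']; exists (fun t => a' t + b' t).
    exact: elementary_add.
  by move=> t; exact: is_deriveD1.
- move=> a b ea [a' ea' aa'] eb [b' eb' bb']; exists (fun t => a t * b' t + b t * a' t).
    by apply: elementary_add; exact: elementary_mul.
  by move=> t; exact: is_deriveM1.
- by move=> a b ea _ ab; exists a.
Qed.

Lemma is_derive_continuous a b : (forall t, is_derive t (1 : R) a (b t)) -> continuous a.
Proof.
move=> ab t; apply: differentiable_continuous; apply/derivable1_diffP.
by case: (ab t).
Qed.

Lemma elementary_continuous a : elementary a -> continuous a.
Proof. by move=> /elementary_derive[b _]; exact: is_derive_continuous. Qed.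

Definition tensor a b (x : R * R) := a x.1 * b x.2.

Definition coordinate (j : 'I_2) (x : R * R) := if j == ord0 then x.1 else x.2.

Lemma is_derive_coordinate a a' j i (x : R * R) : (forall t, is_derive t (1 : R) a (a' t)) ->
  is_derive x (e_ R i) (fun y => a (coordinate j y)) (a' (coordinate j x) *+ (i == j)).
Proof.
move=> aa'; have [da va] := aa' (coordinate j x).
have [ij|ij] := boolP (i == j).
  have E : (fun h : R => h^-1 *: (((fun y => a (coordinate j y)) \o shift x) (h *: e_ R i) - a (coordinate j x))) =
     (fun h : R => h^-1 *: ((a \o shift (coordinate j x)) (h *: 1) - a (coordinate j x))).
    apply/funext => h /=; congr (_ *: (a _ - _)).
    rewrite /coordinate /e_ (eqP ij); by case: (j == ord0).
  by apply: DeriveDef; rewrite /derivable /derive E.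
have E : (fun h : R => h^-1 *: (((fun y => a (coordinate j y)) \o shift x) (h *: e_ R i) - a (coordinate j x))) =
     cst 0.
  apply/funext => h /=; rewrite (_ : coordinate j _ = coordinate j x) ?subrr ?scaler0//.
  have : (i == ord0) = ~~ (j == ord0).
    by clear da va; move: i j ij => [[|[|//]] ?] [[|[|//]] ?].
  rewrite /coordinate /e_ => ->; case: (j == ord0) => /=; rewrite /GRing.scale/= mulr0 add0r//.
apply: DeriveDef; rewrite /derivable /derive E; first exact: is_cvg_cst.
exact: lim_cst.
Qed.

Lemma is_derive_tensor a b a' b' j (x : R * R) :
  (forall t, is_derive t (1 : R) a (a' t)) ->
  (forall t, is_derive t (1 : R) b (b' t)) ->
  is_derive x (e_ R j) (tensor a b) (if j == ord0 then tensor a' b x else tensor a b' x).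
Proof.
move=> aa' bb'.
have da := is_derive_coordinate ord0 j x aa'; have db := is_derive_coordinate ord_max j x bb'.
have := @is_deriveM _ _ _ _ _ _ _ _ da db.
congr is_derive; rewrite /GRing.scale/= /tensor.
by move: j {da db} => [[|[|//]] ?] /=; rewrite mulr0n mulr1n ?mulr0 ?addr0 ?add0r// mulrC.
Qed.

(** All the iterated partial derivatives of a member of a class of continuous
    functions that is closed under partial derivatives are again in the class. *)
Lemma smooth_of_derivation_stable (C : (R * R -> R) -> Prop) :
  (forall u, C u -> continuous u) ->
  (forall u j, C u -> exists2 v, C v & forall x, is_derive x (e_ R j) u (v x)) ->
  forall u, C u -> smooth u.
Proof.
move=> Cc Cd u Cu s.
have Cs : C (iter_partial s u).
  elim: s => [//|j s IH]; have [v Cv dv] := Cd _ j IH.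
  rewrite /iter_partial/= -/(iter_partial s u) (_ : (fun x => _) = v)//.
  by apply/funext => x; case: (dv x).
split; first exact: Cc.
by move=> j x; have [v _ dv] := Cd _ j Cs; case: (dv x).
Qed.

Lemma continuous_tensor a b : continuous a -> continuous b -> continuous (tensor a b).
Proof.
move=> ca cb x; apply: cvgM.
  by apply: (@cvg_comp _ _ _ fst a); [exact: cvg_fst|exact: ca].
by apply: (@cvg_comp _ _ _ snd b); [exact: cvg_snd|exact: cb].
Qed.

Lemma smooth_tensor a b : elementary a -> elementary b -> smooth (tensor a b).
Proof.
move=> ea eb.
apply: (@smooth_of_derivation_stable (fun u => exists a b, [/\ elementary a, elementary b & u = tensor a b])).
- by move=> _ [a' [b' [ea' eb' ->]]]; apply: continuous_tensor; exact: elementary_continuous.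
- move=> _ j [f [g [ef eg ->]]].
  have [f' ef' ff'] := elementary_derive ef; have [g' eg' gg'] := elementary_derive eg.
  exists (if j == ord0 then tensor f' g else tensor f g').
    by case: ifP => _; [exists f', g|exists f, g'].
  by move=> x; have := is_derive_tensor j x ff' gg'; case: ifP.
- by exists a, b.
Qed.

Lemma test_tensor (O : set (R * R)) a b p q r s : elementary a -> elementary b ->
  (forall t, a t != 0 -> p <= t <= q) -> (forall t, b t != 0 -> r <= t <= s) ->
  (forall x : R * R, p <= x.1 <= q -> r <= x.2 <= s -> O x) -> test_function O (tensor a b).
Proof.
move=> ea eb ha hb hO.
have sub : closure [set x | tensor a b x != 0] `<=` `[p, q]%classic `*` `[r, s]%classic.
  have /closure_id -> : closed (`[p, q]%classic `*` `[r, s]%classic : set (R * R)).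
    apply: compact_closed; first exact: norm_hausdorff.
    by apply: compact_setX; exact: segment_compact.
  apply: closure_subset => x /=; rewrite /tensor mulf_eq0 negb_or => /andP[h1 h2].
  by split; rewrite /= in_itv/=; [exact: ha|exact: hb].
split; first exact: smooth_tensor.
- apply: subclosed_compact sub; first exact: closed_closure.
  by apply: compact_setX; exact: segment_compact.
- by move=> x /sub[] /=; rewrite !in_itv/=; exact: hO.
Qed.

(** As k grows these functions increase to the indicator function of the interval
    ]p, q[, while their support stays in [p, q]. *)
Definition smooth_bump (k : nat) (p q t : R) := flat 0 (k%:R * (t - p)) * flat 0 (k%:R * (q - t)).

Lemma elementary_bump k p q : elementary (smooth_bump k p q).
Proof.
apply: elementary_mul.
  rewrite (_ : (fun t => _) = (fun t => flat 0 (k%:R * t + (- k%:R * p)))); last first.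
    by apply/funext => t; rewrite mulrBr mulNr.
  by apply: elementary_affine; exact: elementary_flat.
rewrite (_ : (fun t => _) = (fun t => flat 0 (- k%:R * t + k%:R * q))); last first.
  by apply/funext => t; rewrite mulrBr mulNr addrC.
by apply: elementary_affine; exact: elementary_flat.
Qed.

Lemma smooth_bump_ge0 k p q t : 0 <= smooth_bump k p q t.
Proof. by rewrite mulr_ge0// flat0_ge0. Qed.

Lemma smooth_bump_le1 k p q t : smooth_bump k p q t <= 1.
Proof. by rewrite mulr_ile1// ?flat0_ge0// flat0_le1. Qed.

Lemma smooth_bump_out k p q t : ~~ (p < t < q) -> smooth_bump k p q t = 0.
Proof.
rewrite negb_and -!leNgt /smooth_bump => /orP[h|h].
  by rewrite [flat 0 _]flat_eq0 ?mul0r// mulr_ge0_le0// subr_le0.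
by rewrite [X in _ * X]flat_eq0 ?mulr0// mulr_ge0_le0// subr_le0.
Qed.

Lemma smooth_bump_neq0 k p q t : smooth_bump k p q t != 0 -> p <= t <= q.
Proof.
move=> h; suff /andP[/ltW -> /ltW ->] : p < t < q by [].
by apply: contraNT h => /smooth_bump_out ->.
Qed.

Lemma smooth_bump_cvg (p q t : R) : smooth_bump k p q t @[k --> \oo] --> ((p < t < q)%R%:R : R).
Proof.
have [/andP[h1 h2]|h] := boolP (p < t < q).
  rewrite -[X in _ --> X](mulr1 1); apply: cvgM; apply: flat0_cvg; rewrite subr_gt0//.
rewrite (_ : (fun k => smooth_bump k p q t) = cst 0); first exact: cvg_cst.
by apply/funext => k; exact: smooth_bump_out.
Qed.

Lemma primitive_exists (f : R -> R) (p : R) : continuous f -> (forall t, t <= p -> f t = 0) ->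
  exists F, forall t, is_derive t (1 : R) F (f t).
Proof.
move=> cf f0.
have If u : lebesgue_measure.-integrable `]-oo, u]%classic (EFin \o f).
  have mi : measurable (`]-oo, u]%classic : set (measurableTypeR R)) by exact: measurable_itv.
  have mp : measurable (`[p, u]%classic : set (measurableTypeR R)) by exact: measurable_itv.
  apply/(integrable_mkcond _ mi).
  rewrite (_ : _ \_ _ = (EFin \o f) \_ `[p, u]).
    apply/(integrable_mkcond _ mp).1; apply: continuous_compact_integrable.
      exact: segment_compact.
    exact: continuous_subspaceT.
  apply/funext => t; rewrite /patch !mem_setE !in_itv/=.
  have [tp|tp] := leP p t; first by [].
  by rewrite /= f0 ?(ltW tp)//; case: ifP.
exists (fun x : R => \int[lebesgue_measure]_(t in `]-oo, x]) f t) => x.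
have [d1 d2] := @continuous_FTC1 R f -oo%O x (x + 1) (ltr_pwDr ltr01 (lexx x)) (If _) (ltNyr x) (cf x).
by apply: DeriveDef => //; rewrite -derive1E.
Qed.

(** A tent is the difference of two translates of a primitive of a bump: its
    derivative is a bump on [p, p + h] minus a bump on [p + h, p + 2 h], it is
    bounded by h, and it vanishes outside [p, p + 2 h]. *)
Lemma tent k (p h : R) : 0 < h -> exists2 T, elementary T & [/\
  forall t, is_derive t (1 : R) T (smooth_bump k p (p + h) t - smooth_bump k (p + h) (p + h + h) t),
  forall t, `|T t| <= h & forall t, T t != 0 -> p <= t <= p + h + h].
Proof.
move=> h0; have eb := elementary_bump k p (p + h).
have [H HE] := @primitive_exists (smooth_bump k p (p + h)) p (elementary_continuous eb) (fun t tp =>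
  @smooth_bump_out k p (p + h) t (ltac:(by rewrite ltNge tp))).
have eH : elementary H by exact: elementary_primitive eb HE.
have eT : elementary (fun t => H t + -1 * H (1 * t + - h)).
  by apply: elementary_add => //; apply: elementary_mul; [exact: elementary_cst|exact: elementary_affine].
have cH : continuous H by exact: elementary_continuous.
(* The height and the support are read off the mean value theorem. *)
have mvt t : exists2 c, t - h <= c <= t & H t + -1 * H (1 * t + - h) = smooth_bump k p (p + h) c * h.
  have th : t - h <= t by rewrite lerBlDr lerDl ltW.
  have [c] := @MVT_segment R H (smooth_bump k p (p + h)) (t - h) t th (fun (x : R) _ => HE x)
    (continuous_subspaceT cH).
  rewrite in_itv/= => ct E; exists c => //.
  by rewrite mulN1r mul1r E opprB addrCA subrr addr0.
exists (fun t => H t + -1 * H (1 * t + - h)) => //; split.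
- move=> t.
  have dS : is_derive t (1 : R) (fun t : R => H (1 * t + - h)) (smooth_bump k (p + h) (p + h + h) t).
    have -> : smooth_bump k (p + h) (p + h + h) t = smooth_bump k p (p + h) (1 * t + - h) * 1.
      by rewrite /smooth_bump mulr1; congr (flat 0 (_ * _) * flat 0 (_ * _)); ring.
    apply: (@is_derive1_comp _ H (fun t => 1 * t + - h)).
    exact: is_derive_affine.
  have dt := HE t.
  rewrite (_ : (fun t => _) = H - (fun t : R => H (1 * t + - h))).
    exact: is_deriveB.
  by apply/funext => s; rewrite mulN1r.
- move=> t; have [c _ ->] := mvt t.
  rewrite ger0_norm; last by rewrite mulr_ge0 ?smooth_bump_ge0// ltW.
  by rewrite ler_piMl ?smooth_bump_le1// ltW.
- move=> t; have [c /andP[c1 c2] ->] := mvt t.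
  rewrite mulf_eq0 negb_or => /andP[/smooth_bump_neq0/andP[h1 h2] _].
  by apply/andP; split; lra.
Qed.

End SmoothFunctions.

(** * Weak derivatives and integrals over boxes *)

Section Poincare.
Variable R : realType.
Notation mu := (leb2 R).
Implicit Types (f g : R * R -> R) (Omega : set (R * R)).

Definition other (j : 'I_2) : 'I_2 := if j == ord0 then ord_max else ord0.

(** Half-open boxes given by the coordinate j first, so that one argument covers
    both partial derivatives. *)
Definition box j (a b c d : R) : set (plane R) :=
  [set x | a <= coordinate j x < b /\ c <= coordinate (other j) x < d].

Lemma ae_coordinate_neq j (a : R) : {ae mu, forall x, coordinate j x != a}.
Proof.
exists [set x : plane R | coordinate j x = a].
have E : [set x : plane R | coordinate j x = a] =
   if j == ord0 then [set a] `*` setT else setT `*` [set a].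
  rewrite /coordinate; case: (j == ord0); apply/seteqP; split => x //=; by case.
split.
- by rewrite E; case: ifP => _; apply: measurableX.
- by rewrite /coordinate; case: (j == ord0); [exact: leb2_vline|exact: leb2_hline].
- by move=> x /= /negP; rewrite negbK => /eqP.
Qed.

Lemma measurable_box j (a b c d : R) : measurable (box j a b c d).
Proof.
have -> : box j a b c d = if j == ord0 then `[a, b[%classic `*` `[c, d[%classic
    else `[c, d[%classic `*` `[a, b[%classic.
  rewrite /box /coordinate /other; case: (j == ord0) => /=; apply/seteqP; split => x /=;
    rewrite !in_itv/=; tauto.
by case: ifP => _; apply: measurableX; exact: measurable_itv.
Qed.

Lemma indic_box j (a b c d : R) (x : plane R) :
  \1_(box j a b c d) x = ((a <= coordinate j x < b) && (c <= coordinate (other j) x < d))%R%:R :> R.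
Proof.
rewrite indicE; congr (nat_of_bool _)%:R; apply/idP/idP => [/set_mem[-> ->]//|/andP[h1 h2]].
exact/mem_set.
Qed.

Lemma Rintegral_indic (A D : set (plane R)) f : measurable A -> measurable D -> A `<=` D ->
  \int[mu]_(x in A) f x = \int[mu]_(x in D) (f x * \1_A x).
Proof.
move=> mA mD AD; rewrite -[in LHS](setIidr AD) Rintegral_mkcondr.
apply: eq_Rintegral => x _; rewrite /patch indicE.
by case: ifP => _; rewrite ?mulr1 ?mulr0.
Qed.

Lemma box_test Omega j (p q r s : R) (a a' b : R -> R) :
  elementary a -> (forall t, is_derive t (1 : R) a (a' t)) -> elementary b ->
  (forall t, a t != 0 -> p <= t <= q) -> (forall t, b t != 0 -> r <= t <= s) ->
  (forall x : R * R, p <= coordinate j x <= q -> r <= coordinate (other j) x <= s -> Omega x) ->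
  let phi x := a (coordinate j x) * b (coordinate (other j) x) in
  test_function Omega phi /\
  forall x, 'D_(e_ R j) phi x = a' (coordinate j x) * b (coordinate (other j) x).
Proof.
move=> ea aa' eb ha hb hO phi; have [b' _ bb'] := elementary_derive eb.
have [j0|j0] := eqVneq j ord0.
  have -> : phi = tensor a b by rewrite /phi /tensor /coordinate /other j0.
  split.
    apply: test_tensor ha hb _ => // x h1 h2; apply: hO; rewrite /coordinate /other j0//.
  by move=> x; case: (is_derive_tensor j x aa' bb'); rewrite j0 /tensor /coordinate /other eqxx.
have j1 : (j == ord0) = false by exact/negbTE.
have -> : phi = tensor b a.
  by apply/funext => x; rewrite /phi /tensor /coordinate /other j1/= mulrC.
split.
  apply: test_tensor hb ha _ => // x h1 h2; apply: hO; rewrite /coordinate /other j1//.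
move=> x; case: (is_derive_tensor j x bb' aa') => _ ->.
by rewrite /tensor /coordinate /other j1/= mulrC.
Qed.

Lemma measurable_coordinate j D (a : R -> R) : measurable D -> continuous a ->
  measurable_fun (D : set (plane R)) (fun x => a (coordinate j x)).
Proof.
move=> mD ca; apply: continuous_measurable_plane => // x.
rewrite /coordinate; case: (j == ord0).
  by apply: (@cvg_comp _ _ _ fst a); [exact: cvg_fst|exact: ca].
by apply: (@cvg_comp _ _ _ snd a); [exact: cvg_snd|exact: ca].
Qed.

Lemma smooth_bump2_le1 k (a b c d s t : R) : `|smooth_bump k a b s * smooth_bump k c d t| <= 1.
Proof.
rewrite normrM !(ger0_norm (smooth_bump_ge0 _ _ _ _)).
by apply: mulr_ile1; rewrite ?smooth_bump_ge0 ?smooth_bump_le1.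
Qed.

(** The bumps converge to the indicator function except on two lines, which are
    null sets. *)
Lemma smooth_bump_box_cvg D j (a b c d : R) f : measurable (D : set (plane R)) ->
  mu.-integrable D (EFin \o f) ->
  \int[mu]_(x in D) (f x * (smooth_bump k a b (coordinate j x) * smooth_bump k c d (coordinate (other j) x)))
    @[k --> \oo] --> \int[mu]_(x in D) (f x * \1_(box j a b c d) x).
Proof.
move=> mD If; have mf := integrable_measurable If.
apply: (Rdominated_cvg mD _ _ _ (Rintegrable_norm If) _).2.
- move=> k; apply: measurable_funM => //; apply: measurable_funM;
    apply: measurable_coordinate => //; apply: elementary_continuous; exact: elementary_bump.
- apply: measurable_funM => //; apply: measurable_indic; exact: measurable_box.
- have h1 := ae_coordinate_neq j a; have h2 := ae_coordinate_neq (other j) c.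
  near=> x => Dx; apply: cvgM; first exact: cvg_cst.
  rewrite indic_box.
  have -> : (a <= coordinate j x < b) && (c <= coordinate (other j) x < d) =
      (a < coordinate j x < b) && (c < coordinate (other j) x < d).
    rewrite !(lt_neqAle a) !(lt_neqAle c) !(eq_sym a) !(eq_sym c).
    by rewrite (near h1 x)// (near h2 x).
  rewrite -mulnb natrM; apply: cvgM; exact: smooth_bump_cvg.
- move=> k; apply: aeW => x Dx; rewrite normrM ler_piMr//.
  exact: smooth_bump2_le1.
Unshelve. all: by end_near. Qed.

(** Testing the weak derivative with a tent in the coordinate j times a bump in
    the other one gives, on the side of f, the difference of the integrals of f
    against bumps on the two halves; on the side of g, the test function is
    bounded by the height h of the tent.  The bumps then tend to indicator
    functions. *)
Lemma box_halves Omega j (p h c d : R) f g :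
  open Omega -> is_weak_partial Omega j f g ->
  mu.-integrable Omega (EFin \o f) -> mu.-integrable Omega (EFin \o g) -> 0 < h ->
  (forall x : R * R, p <= coordinate j x <= p + h + h -> c <= coordinate (other j) x <= d -> Omega x) ->
  `|\int[mu]_(x in box j p (p + h) c d) f x - \int[mu]_(x in box j (p + h) (p + h + h) c d) f x|
   <= h * \int[mu]_(x in box j p (p + h + h) c d) `|g x|.
Proof.
move=> oO wp If Ig h0 hO.
have mO : measurable (Omega : set (plane R)) := open_measurable_plane oO.
have [mL mR mB] : [/\ measurable (box j p (p + h) c d),
    measurable (box j (p + h) (p + h + h) c d) &
    measurable (box j p (p + h + h) c d)] by split; exact: measurable_box.
have BO : box j p (p + h + h) c d `<=` Omega.
  by move=> x [/andP[h1 /ltW h2] /andP[h3 /ltW h4]]; apply: hO; apply/andP.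
have LO : box j p (p + h) c d `<=` Omega.
  move=> x [/andP[h1 h2] h3]; apply: BO; split => //; rewrite h1/=.
  by apply: (lt_trans h2); rewrite ltrDl.
have RO : box j (p + h) (p + h + h) c d `<=` Omega.
  move=> x [/andP[h1 h2] h3]; apply: BO; split => //; rewrite h2 andbT.
  by apply: le_trans h1; rewrite lerDl ltW.
rewrite (Rintegral_indic _ mL mO LO) (Rintegral_indic _ mR mO RO).
rewrite (Rintegral_indic _ mB mO BO).
pose u a b k := \int[mu]_(x in Omega) (f x * (smooth_bump k a b (coordinate j x) * smooth_bump k c d (coordinate (other j) x))).
have cv : `|u p (p + h) k - u (p + h) (p + h + h) k| @[k --> \oo] -->
    `|\int[mu]_(x in Omega) (f x * \1_(box j p (p + h) c d) x) -
      \int[mu]_(x in Omega) (f x * \1_(box j (p + h) (p + h + h) c d) x)|.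
  by apply: cvg_norm; apply: cvgB; exact: smooth_bump_box_cvg.
rewrite -(cvg_lim _ cv)//; apply: limr_le; first exact: cvgP cv.
apply: nearW => k; rewrite /u.
have [T eT [dT Th T0]] := tent k p h0.
have eb := elementary_bump k c d.
have [test dphi] := box_test eT dT eb T0 (@smooth_bump_neq0 _ k c d) hO.
have Ib (a b : R) : mu.-integrable Omega (EFin \o (fun x =>
    f x * (smooth_bump k a b (coordinate j x) * smooth_bump k c d (coordinate (other j) x)))).
  apply: (@integrable_mul_bounded _ _ _ _ _ _ _ 1) => //.
    by apply: measurable_funM; apply: measurable_coordinate => //; apply: elementary_continuous; exact: elementary_bump.
  by move=> x _; exact: smooth_bump2_le1.
have mphi : measurable_fun (Omega : set (plane R)) (fun x => T (coordinate j x) * smooth_bump k c d (coordinate (other j) x)).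
  by apply: measurable_funM; apply: measurable_coordinate => //; apply: elementary_continuous.
have Iphi : mu.-integrable Omega (EFin \o (fun x => g x * (T (coordinate j x) * smooth_bump k c d (coordinate (other j) x)))).
  apply: (@integrable_mul_bounded _ _ _ _ _ _ _ h) => // x _.
  rewrite normrM (ger0_norm (smooth_bump_ge0 _ _ _ _)) -[leRHS]mulr1.
  by rewrite ler_pM ?smooth_bump_ge0 ?smooth_bump_le1.
have := wp _ test.
under eq_Rintegral do rewrite dphi mulrBl mulrBr.
rewrite RintegralB// => ->; rewrite normrN.
apply: le_trans (le_normr_Rintegral _ _) _ => //.
rewrite -RintegralZl//; last first.
  by apply: integrable_indic_mul => //; exact: Rintegrable_norm.
apply: ae_le_Rintegral => //.
- exact: Rintegrable_norm.
- by apply: RintegrableZ => //; apply: integrable_indic_mul => //; exact: Rintegrable_norm.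
- have h1 := ae_coordinate_neq j (p + h + h).
  near=> x => Ox; rewrite normrM [leRHS]mulrCA ler_wpM2l// indic_box.
  have [Tx|Tx] := eqVneq (T (coordinate j x)) 0.
    by rewrite Tx mul0r normr0 mulr_ge0// ltW.
  have [bx|bx] := boolP (c < coordinate (other j) x < d); last first.
    by rewrite (smooth_bump_out _ bx) mulr0 normr0 mulr_ge0// ltW.
  have /andP[-> h2] := T0 _ Tx; have /andP[/ltW -> ->] := bx.
  rewrite lt_neqAle (near h1 x)// h2/= mulr1 normrM (ger0_norm (smooth_bump_ge0 _ _ _ _)).
  by rewrite -[leRHS]mulr1 ler_pM ?smooth_bump_ge0 ?smooth_bump_le1.
Unshelve. all: by end_near. Qed.

End Poincare.

(** * The Poincare inequality on a dyadic square *)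

(** The arithmetic of one step of the recursion over scales.  The f's are the
    integrals of the function over the four quarters of a square, the G's those
    of the gradient, the I's those of the deviation from the average restricted
    to a set; the first four hypotheses are the bounds for the quarters, the
    next four the comparisons between halves.  The constant 4 reproduces itself
    because the four errors add up to at most 4 h S, and 4 + 4 = 4 * 2. *)
Lemma quadrant_bound (F : realFieldType) (h u v S f1 f2 f3 f4 G1 G2 G3 G4 I1 I2 I3 I4 : F) :
  `|I1| <= 4 * h * G1 + `|f1 - (f1 + f2 + (f3 + f4)) / 4| ->
  `|I2| <= 4 * h * G2 + `|f2 - (f1 + f2 + (f3 + f4)) / 4| ->
  `|I3| <= 4 * h * G3 + `|f3 - (f1 + f2 + (f3 + f4)) / 4| ->
  `|I4| <= 4 * h * G4 + `|f4 - (f1 + f2 + (f3 + f4)) / 4| ->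
  `|f1 - f3| <= h * u -> `|f2 - f4| <= h * u ->
  `|f1 - f2| <= h * v -> `|f3 - f4| <= h * v ->
  S = G1 + G2 + (G3 + G4) -> u + v = S -> 0 <= h * u -> 0 <= h * v ->
  `|I1 + I2 + (I3 + I4)| <= 4 * (2 * h) * S.
Proof.
move=> c1 c2 c3 c4 x1 x2 y1 y2 e2 uv hu hv.
have hS : h * S = h * u + h * v by rewrite -uv mulrDr.
have k (t a b c : F) : t = (a + b + c) / 4 -> `|a| <= h * u + h * v -> `|b| <= h * u + h * v ->
    `|c| <= h * u + h * v -> `|t| <= h * S.
  move=> ->; rewrite !ler_norml hS => /andP[? ?] /andP[? ?] /andP[? ?].
  by apply/andP; split; lra.
have d1 : `|f1 - (f1 + f2 + (f3 + f4)) / 4| <= h * S.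
  apply: (k _ (f1 - f2) (f1 - f3) ((f1 - f2) + (f2 - f4))); first by field.
  - lra.
  - lra.
  - by apply: le_trans (ler_normD _ _) _; lra.
have d2 : `|f2 - (f1 + f2 + (f3 + f4)) / 4| <= h * S.
  apply: (k _ (f2 - f1) (f2 - f4) ((f2 - f1) + (f1 - f3))); first by field.
  - by rewrite distrC; lra.
  - lra.
  - by apply: le_trans (ler_normD _ _) _; rewrite (distrC f2 f1); lra.
have d3 : `|f3 - (f1 + f2 + (f3 + f4)) / 4| <= h * S.
  apply: (k _ (f3 - f4) (f3 - f1) ((f3 - f1) + (f1 - f2))); first by field.
  - lra.
  - by rewrite distrC; lra.
  - by apply: le_trans (ler_normD _ _) _; rewrite (distrC f3 f1); lra.
have d4 : `|f4 - (f1 + f2 + (f3 + f4)) / 4| <= h * S.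
  apply: (k _ (f4 - f3) (f4 - f2) ((f4 - f3) + (f3 - f1))); first by field.
  - by rewrite distrC; lra.
  - by rewrite distrC; lra.
  - by apply: le_trans (ler_normD _ _) _; rewrite (distrC f4 f3) (distrC f3 f1); lra.
have n1 := ler_normD (I1 + I2) (I3 + I4); have n2 := ler_normD I1 I2; have n3 := ler_normD I3 I4.
have e3 : h * S = h * G1 + h * G2 + (h * G3 + h * G4) by rewrite e2 !mulrDr.
have -> : 4 * (2 * h) * S = 8 * (h * S) by ring.
have a1 : 4 * h * G1 = 4 * (h * G1) by ring.
have a2 : 4 * h * G2 = 4 * (h * G2) by ring.
have a3 : 4 * h * G3 = 4 * (h * G3) by ring.
have a4 : 4 * h * G4 = 4 * (h * G4) by ring.
lra.
Qed.

Section CellPoincare.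
Variable R : realType.
Notation mu := (leb2 R).
Implicit Types (f g : R * R -> R) (Omega : set (R * R)).

Let pow2_gt0 N : 0 < (2 ^+ N)^-1 :> R. Proof. by rewrite invr_gt0 exprn_gt0. Qed.

Lemma half_pow2 N : (2 ^+ N)^-1 = 2 * (2 ^+ N.+1)^-1 :> R.
Proof. by rewrite exprS invfM mulrA divff// mul1r. Qed.

Lemma cell_box0 N i j : cell N i j = box ord0
  (i%:~R / 2 ^+ N) ((i + 1)%:~R / 2 ^+ N) (j%:~R / 2 ^+ N) ((j + 1)%:~R / 2 ^+ N) :> set (plane R).
Proof. by rewrite cellE; apply/seteqP; split => x; rewrite /box/= !in_itv. Qed.

Lemma cell_box1 N i j : cell N i j = box ord_max
  (j%:~R / 2 ^+ N) ((j + 1)%:~R / 2 ^+ N) (i%:~R / 2 ^+ N) ((i + 1)%:~R / 2 ^+ N) :> set (plane R).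
Proof. by rewrite cellE; apply/seteqP; split => x; rewrite /box/= !in_itv/= => -[]. Qed.

Lemma cell_child N i j (a b : int) : (a = i * 2 \/ a = i * 2 + 1) ->
  (b = j * 2 \/ b = j * 2 + 1) -> @cell R N.+1 a b `<=` cell N i j.
Proof. by move=> ha hb x [h1 h2]; split; apply/dyadic_split; rewrite ?h1 ?h2. Qed.

Lemma cell_disjoint N (i j i' j' : int) : i <> i' \/ j <> j' ->
  [disjoint @cell R N i j & cell N i' j'].
Proof.
by move=> h; apply/disj_setPS => x [[h1 h2] [h3 h4]]; case: h; rewrite -?h1 -?h2 -?h3 -?h4.
Qed.

Lemma neq_child (i : int) : i * 2 <> i * 2 + 1.
Proof. by move/esym/eqP; rewrite -subr_eq0 addrAC subrr add0r. Qed.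

Lemma Rintegral_cell_split N i j f : mu.-integrable (cell N i j) (EFin \o f) ->
  \int[mu]_(x in cell N i j) f x =
  \int[mu]_(x in cell N.+1 (i * 2) (j * 2)) f x +
  \int[mu]_(x in cell N.+1 (i * 2) (j * 2 + 1)) f x +
  (\int[mu]_(x in cell N.+1 (i * 2 + 1) (j * 2)) f x +
  \int[mu]_(x in cell N.+1 (i * 2 + 1) (j * 2 + 1)) f x).
Proof.
move=> If.
have E : cell N i j = (@cell R N.+1 (i * 2) (j * 2) `|` cell N.+1 (i * 2) (j * 2 + 1)) `|`
   (cell N.+1 (i * 2 + 1) (j * 2) `|` cell N.+1 (i * 2 + 1) (j * 2 + 1)).
  apply/seteqP; split => x.
    by move=> [/dyadic_split h1 /dyadic_split h2]; case: h1 => h1; case: h2 => h2;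
     [left; left|left; right|right; left|right; right].
  by case=> -[]; apply: cell_child; tauto.
have mc a b := @measurable_cell R N.+1 a b.
have mcU a b a' b' : measurable (@cell R N.+1 a b `|` cell N.+1 a' b') by exact: measurableU.
have Is (A : set (plane R)) : measurable A -> A `<=` cell N i j -> mu.-integrable A (EFin \o f).
  by move=> mA AC; apply: integrableS If => //; exact: measurable_cell.
have nc := @neq_child.
rewrite [in LHS]E Rintegral_setU//; last 2 first.
- by rewrite -E.
- apply/disj_setPS => x [h1 h2]; apply: (nc i).
  have e1 : dyadic N.+1 x.1 = i * 2 by case: h1 => -[].
  have e2 : dyadic N.+1 x.1 = i * 2 + 1 by case: h2 => -[].
  exact: etrans (esym e1) e2.
congr (_ + _); rewrite Rintegral_setU//.
- by apply: Is => //; rewrite E; left.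
- by apply: cell_disjoint; right.
- by apply: Is => //; rewrite E; right.
- by apply: cell_disjoint; right.
Qed.

Lemma Rintegrable_cell Omega N i j f : open Omega -> closed_cell N i j `<=` Omega ->
  mu.-integrable Omega (EFin \o f) -> mu.-integrable (cell N i j) (EFin \o f).
Proof.
move=> oO cO If; apply: integrableS If; first exact: open_measurable_plane.
  exact: measurable_cell.
by apply: subset_trans cO; exact: cell_closed_cell.
Qed.

(** [box_halves] in both directions, each box being a pair of adjacent quarters of
    the square; the integral of the gradient is extended to the whole square. *)
Lemma cell_halves Omega (g : 'I_2 -> R * R -> R) f N i1 i2 : open Omega ->
  (forall j, is_weak_partial Omega j f (g j)) ->
  mu.-integrable Omega (EFin \o f) -> (forall j, mu.-integrable Omega (EFin \o g j)) ->
  @closed_cell R N i1 i2 `<=` Omega ->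
  (forall b, (b = i2 * 2 \/ b = i2 * 2 + 1) ->
   `|\int[mu]_(x in cell N.+1 (i1 * 2) b) f x - \int[mu]_(x in cell N.+1 (i1 * 2 + 1) b) f x|
   <= (2 ^+ N.+1)^-1 * \int[mu]_(x in cell N i1 i2) `|g ord0 x|) /\
  (forall a, (a = i1 * 2 \/ a = i1 * 2 + 1) ->
   `|\int[mu]_(x in cell N.+1 a (i2 * 2)) f x - \int[mu]_(x in cell N.+1 a (i2 * 2 + 1)) f x|
   <= (2 ^+ N.+1)^-1 * \int[mu]_(x in cell N i1 i2) `|g ord_max x|).
Proof.
move=> oO wp If Ig cO; set h := (2 ^+ N.+1)^-1 : R.
have h0 : 0 < h := pow2_gt0 _.
have stp (k : int) : (k + 1)%:~R * h = k%:~R * h + h by rewrite intrD mulrDl mul1r.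
have sub (j : 'I_2) (B : set (plane R)) : measurable B -> B `<=` cell N i1 i2 ->
    h * \int[mu]_(x in B) `|g j x| <= h * \int[mu]_(x in cell N i1 i2) `|g j x|.
  move=> mB BC; rewrite ler_wpM2l ?(ltW h0)//; apply: Rintegral_subset => //.
    exact: measurable_cell.
  by apply: Rintegrable_norm; exact: Rintegrable_cell oO cO (Ig j).
have big (k c : int) (t : R) : (c = k * 2 \/ c = k * 2 + 1) ->
    c%:~R * h <= t <= (c + 1)%:~R * h -> k%:~R / 2 ^+ N <= t <= (k + 1)%:~R / 2 ^+ N.
  rewrite (half_pow2 N) -/h !intrD => hc /andP[h1 h2].
  by apply/andP; case: hc h1 h2 => ->; rewrite ?intrD !intrM => h1 h2; split; nra.
have big2 (k : int) (t : R) : (k * 2)%:~R * h <= t <= (k * 2)%:~R * h + h + h ->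
    k%:~R / 2 ^+ N <= t <= (k + 1)%:~R / 2 ^+ N.
  rewrite (half_pow2 N) -/h !intrD !intrM => /andP[h1 h2].
  by apply/andP; split; nra.
split=> [b hb|a ha].
- rewrite !(@cell_box0 N.+1) -/h !stp.
  apply: le_trans (box_halves oO (wp ord0) If (Ig ord0) h0 _) _.
    move=> x h1 h2; apply: cO; split; first exact: big2 h1.
    by apply: (big i2 b) => //; rewrite stp.
  apply: sub; first exact: measurable_box.
  move=> x [/andP[h1 h2] h3]; rewrite cellE; split; rewrite /= in_itv/=.
    rewrite (half_pow2 N) -/h !intrD; rewrite !intrM in h1 h2.
    by apply/andP; split; rewrite /coordinate/= in h1 h2; nra.
  move/andP: h3 => []; rewrite /coordinate/= (half_pow2 N) -/h !intrD => h3 h4.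
  by apply/andP; case: hb h3 h4 => ->; rewrite ?intrD !intrM => h3 h4; split; nra.
- rewrite !(@cell_box1 N.+1) -/h !stp.
  apply: le_trans (box_halves oO (wp ord_max) If (Ig ord_max) h0 _) _.
    move=> x h1 h2; apply: cO; split; last exact: big2 h1.
    by apply: (big i1 a) => //; rewrite stp.
  apply: sub; first exact: measurable_box.
  move=> x [/andP[h1 h2] h3]; rewrite cellE; split; rewrite /= in_itv/=; last first.
    rewrite (half_pow2 N) -/h !intrD; rewrite !intrM in h1 h2.
    by apply/andP; split; rewrite /coordinate/= in h1 h2; nra.
  move/andP: h3 => []; rewrite /coordinate/= (half_pow2 N) -/h !intrD => h3 h4.
  by apply/andP; case: ha h3 h4 => ->; rewrite ?intrD !intrM => h3 h4; split; nra.
Qed.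

Definition cell_average N i j f : R := (2 ^+ N) ^+ 2 * \int[mu]_(x in cell N i j) f x.

Lemma cell_average_area N i j f : cell_average N i j f * ((2 ^+ N)^-1 ^+ 2) = \int[mu]_(x in cell N i j) f x.
Proof.
by rewrite /cell_average mulrAC -exprMn divff ?expf_neq0// expr1n mul1r.
Qed.

Lemma Rintegral_cell_cst N i j (r : R) : \int[mu]_(_ in cell N i j) r = r * (2 ^+ N)^-1 ^+ 2.
Proof. by rewrite Rintegral_cst ?leb2_cell//; exact: measurable_cell. Qed.

Lemma cell_lty N i j : (mu (cell N i j) < +oo)%E.
Proof. by rewrite leb2_cell ltry. Qed.

(** By induction on M, the difference of levels.  The integral over A splits into
    the four quarters; in each of them the average over the square is replaced
    by the average over the quarter, at the price of the differences controlled
    by [cell_halves].  When M is 0 the set A contains the square or misses it,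
    and the integral is 0. *)
Lemma poincare_dyadic Omega (g : 'I_2 -> R * R -> R) f : open Omega ->
  (forall j, is_weak_partial Omega j f (g j)) ->
  mu.-integrable Omega (EFin \o f) -> (forall j, mu.-integrable Omega (EFin \o g j)) ->
  forall M N i1 i2 A, @closed_cell R N i1 i2 `<=` Omega -> level (N + M) A ->
  `|\int[mu]_(x in cell N i1 i2) ((f x - cell_average N i1 i2 f) * \1_A x)| <=
  4 * (2 ^+ N)^-1 * \int[mu]_(x in cell N i1 i2) (`|g ord0 x| + `|g ord_max x|).
Proof.
move=> oO wp If Ig; elim=> [|M IH] N i1 i2 A cO LA; have mC := @measurable_cell R N i1 i2;
  have IfC := Rintegrable_cell oO cO If; have IgC j := Rintegrable_norm (Rintegrable_cell oO cO (Ig j)).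
- apply: (@le_trans _ _ 0); last first.
    by rewrite mulr_ge0// ?mulr_ge0 ?(ltW (pow2_gt0 _))//; apply: Rintegral_ge0 => x _; exact: addr_ge0.
  rewrite normr_le0; apply/eqP; rewrite addn0 in LA.
  have [CA|CA] := level_cell i1 i2 LA.
    transitivity (\int[mu]_(x in cell N i1 i2) (f x - cell_average N i1 i2 f)).
      by apply: eq_Rintegral => x /set_mem/CA Ax; rewrite indicE mem_set// mulr1.
    rewrite RintegralB//; last exact: Rintegrable_cst (cell_lty _ _ _).
    by rewrite Rintegral_cell_cst cell_average_area subrr.
  transitivity (\int[mu]_(x in cell N i1 i2) (0 : R)).
    apply: eq_Rintegral => x /set_mem Cx; rewrite indicE memNset ?mulr0// => Ax.
    by have : set0 x by rewrite -CA.
  by rewrite Rintegral_cst// mul0r.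
rewrite addnS -addSn in LA; have mA := level_measurable LA.
set G := fun x => `|g ord0 x| + `|g ord_max x|.
have IG : mu.-integrable (cell N i1 i2) (EFin \o G) by exact: RintegrableD.
set h := (2 ^+ N.+1)^-1 : R; have h0 : 0 < h := pow2_gt0 _.
set IG0 := \int[mu]_(x in cell N i1 i2) G x.
have [Hx Hy] := cell_halves oO wp If Ig cO.
have G0le : \int[mu]_(x in cell N i1 i2) `|g ord0 x| + \int[mu]_(x in cell N i1 i2) `|g ord_max x| = IG0.
  by rewrite -RintegralD.
have G1 : 0 <= \int[mu]_(x in cell N i1 i2) `|g ord0 x| by apply: Rintegral_ge0.
have G2 : 0 <= \int[mu]_(x in cell N i1 i2) `|g ord_max x| by apply: Rintegral_ge0.
have If1 : mu.-integrable (cell N i1 i2) (EFin \o (fun x => (f x - cell_average N i1 i2 f) * \1_A x)).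
  apply: integrable_indic_mul => //; apply: RintegrableB => //.
  exact: Rintegrable_cst (cell_lty _ _ _).
have child a b : (a = i1 * 2 \/ a = i1 * 2 + 1) -> (b = i2 * 2 \/ b = i2 * 2 + 1) ->
    `|\int[mu]_(x in cell N.+1 a b) ((f x - cell_average N i1 i2 f) * \1_A x)| <=
    4 * h * \int[mu]_(x in cell N.+1 a b) G x +
    `|\int[mu]_(x in cell N.+1 a b) f x - (\int[mu]_(x in cell N i1 i2) f x) / 4|.
  move=> ha hb; have cO' : closed_cell N.+1 a b `<=` Omega.
    by apply: subset_trans cO; exact: closed_cell_child.
  have mC' := @measurable_cell R N.+1 a b.
  have IfC' := Rintegrable_cell oO cO' If.
  have Ic r := Rintegrable_cst r mC' (cell_lty N.+1 a b).
  have -> : \int[mu]_(x in cell N.+1 a b) ((f x - cell_average N i1 i2 f) * \1_A x) =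
      \int[mu]_(x in cell N.+1 a b) ((f x - cell_average N.+1 a b f) * \1_A x) +
      \int[mu]_(x in cell N.+1 a b) ((cell_average N.+1 a b f - cell_average N i1 i2 f) * \1_A x).
    rewrite -RintegralD//; last 2 first.
    - by apply: integrable_indic_mul => //; apply: RintegrableB => //; exact: Ic.
    - by apply: integrable_indic_mul => //; exact: Ic.
    by apply: eq_Rintegral => x _; rewrite -mulrDl; congr (_ * _); ring.
  apply: le_trans (ler_normD _ _) _; apply: lerD; first exact: IH.
  apply: le_trans (le_normr_Rintegral _ _) _ => //.
    by apply: integrable_indic_mul => //; exact: Ic.
  apply: (@le_trans _ _ (\int[mu]_(x in cell N.+1 a b) `|cell_average N.+1 a b f - cell_average N i1 i2 f|)).
    apply: le_Rintegral => //.
    - by apply: Rintegrable_norm; apply: integrable_indic_mul => //; exact: Ic.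
    - exact: Ic.
    - by move=> x _; rewrite indicE; case: (x \in A); rewrite ?mulr1// mulr0 normr0.
  rewrite Rintegral_cell_cst -[(2 ^+ N.+1)^-1 ^+ 2]ger0_norm ?sqr_ge0// -normrM mulrBl cell_average_area.
  rewrite le_eqVlt; apply/orP; left; apply/eqP; congr (`| _ - _|).
  have E4 : (2 ^+ N.+1)^-1 ^+ 2 = (2 ^+ N)^-1 ^+ 2 / 4 :> R by rewrite (half_pow2 N); field.
  by rewrite E4 mulrA cell_average_area.
have e0 : \int[mu]_(x in cell N i1 i2) ((f x - cell_average N i1 i2 f) * \1_A x) = _ := Rintegral_cell_split If1.
have e1 := Rintegral_cell_split IfC; have e2 := Rintegral_cell_split IG.
rewrite half_pow2 -/h -/IG0.
have hl (i : int) : i * 2 = i * 2 \/ i * 2 = i * 2 + 1 by left.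
have hr (i : int) : i * 2 + 1 = i * 2 \/ i * 2 + 1 = i * 2 + 1 by right.
have c1 := child _ _ (hl i1) (hl i2); have c2 := child _ _ (hl i1) (hr i2).
have c3 := child _ _ (hr i1) (hl i2); have c4 := child _ _ (hr i1) (hr i2).
have x1 := Hx _ (hl i2); have x2 := Hx _ (hr i2).
have y1 := Hy _ (hl i1); have y2 := Hy _ (hr i1).
rewrite -/h in x1 x2 y1 y2; rewrite e1 in c1 c2 c3 c4; rewrite e0.
rewrite -/IG0 in e2.
by apply: (quadrant_bound c1 c2 c3 c4 x1 x2 y1 y2 e2 G0le); rewrite mulr_ge0// ltW.
Qed.

End CellPoincare.

(** * Compactness in L1 *)

Section Rellich.
Variable R : realType.
Notation mu := (leb2 R).
Implicit Types (f : R * R -> R) (Omega : set (R * R)).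

(** By duality: dyadic sets form an algebra that generates the Borel sets. *)
Lemma dyadic_norm_bound (D : set (plane R)) (u : plane R -> R) C : measurable D ->
  mu.-integrable D (EFin \o u) ->
  (forall N A, @level R N A -> `|\int[mu]_(x in D) (u x * \1_A x)| <= C) ->
  \int[mu]_(x in D) `|u x| <= 3 * C.
Proof.
move=> mD Iu H; apply: (@algebra_norm_bound _ _ _ mu (@dyadic_set R)) => //.
- exact: dyadic_set_generates.
- exact: dyadic_setC.
- exact: dyadic_setI.
- exact: dyadic_setT.
- by move=> A [N LA]; exact: H LA.
Qed.

(** The duality costs a factor 3, hence 12 = 3 * 4. *)
Lemma poincare_cell Omega (g : 'I_2 -> R * R -> R) f : open Omega ->
  (forall j, is_weak_partial Omega j f (g j)) ->
  mu.-integrable Omega (EFin \o f) -> (forall j, mu.-integrable Omega (EFin \o g j)) ->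
  forall N i1 i2, @closed_cell R N i1 i2 `<=` Omega ->
  \int[mu]_(x in cell N i1 i2) `|f x - cell_average N i1 i2 f| <=
  12 * (2 ^+ N)^-1 * \int[mu]_(x in cell N i1 i2) (`|g ord0 x| + `|g ord_max x|).
Proof.
move=> oO wp If Ig N i1 i2 cO.
set S := \int[mu]_(x in _) (_ + _).
have -> : 12 * (2 ^+ N)^-1 * S = 3 * (4 * (2 ^+ N)^-1 * S) by ring.
have mC := @measurable_cell R N i1 i2.
apply: dyadic_norm_bound => //.
  apply: RintegrableB => //; first exact: Rintegrable_cell oO cO If.
  exact: (Rintegrable_cst _ mC (cell_lty _ N i1 i2)).
move=> M A LA; apply: (@poincare_dyadic _ _ _ _ oO wp If Ig M) => //.
by apply: level_leq LA; exact: leq_addl.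
Qed.

Lemma le_integral_level N (U : set (plane R)) (u w : plane R -> R) : level N U ->
  mu.-integrable U (EFin \o u) -> mu.-integrable U (EFin \o w) ->
  (forall x, 0 <= u x) -> (forall x, 0 <= w x) ->
  (forall i j, cell N i j `<=` U ->
     \int[mu]_(x in cell N i j) u x <= \int[mu]_(x in cell N i j) w x) ->
  \int[mu]_(x in U) u x <= \int[mu]_(x in U) w x.
Proof.
move=> LU Iu Iw u0 w0 H; have mU := level_measurable LU.
pose F n := if `[< ncell N n `<=` U >] then @ncell R N n else set0.
have mF n : measurable (F n) by rewrite /F; case: ifP => // _; exact: measurable_ncell.
have FU n : F n `<=` U by rewrite /F; case: asboolP => // _; exact: sub0set.
have UF : \bigcup_n F n = U.
  apply/seteqP; split => [x [n _ /FU//]|x Ux].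
  have : (\bigcup_n @ncell R N n) x by rewrite bigcup_ncell.
  move=> [n _ nx]; exists n => //; rewrite /F; case: asboolP => // h.
  have [//|h0] := ncell_level n LU.
  by have : set0 x by rewrite -h0.
have tF : trivIset setT F.
  apply/trivIsetP => n m _ _ nm; rewrite /F.
  case: ifP => _; last by rewrite set0I.
  case: ifP => _; last by rewrite setI0.
  exact: (trivIsetP.1 (@trivIset_ncell R N)).
have IF (v : plane R -> R) n : mu.-integrable U (EFin \o v) -> mu.-integrable (F n) (EFin \o v).
  by move=> Iv; apply: integrableS Iv.
rewrite -lee_fin !EFin_Rintegral// -UF !ge0_integral_bigcup//; last 4 first.
- by rewrite UF; exact: measurable_int Iw.
- by move=> x _; rewrite lee_fin.
- by rewrite UF; exact: measurable_int Iu.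
- by move=> x _; rewrite lee_fin.
apply: lee_nneseries => [n _ _|n _]; first by apply: integral_ge0 => x _; rewrite lee_fin.
rewrite -!EFin_Rintegral//; [|exact: IF..].
rewrite lee_fin /F; case: asboolP => h; last by rewrite !Rintegral_set0.
move: h; rewrite /ncell; case: pickle_inv => [p|] h; last by rewrite !Rintegral_set0.
exact: H.
Qed.

(** Integrals over unions of small squares are finite sums of integrals over
    squares. *)
Lemma dyadic_null (d : plane R -> R) M N i j (A : set (plane R)) : level (N + M) A ->
  mu.-integrable (cell N i j) (EFin \o d) ->
  (forall N' i' j', cell N' i' j' `<=` @cell R N i j -> (N <= N')%N ->
     \int[mu]_(x in cell N' i' j') d x = 0) ->
  \int[mu]_(x in cell N i j) (d x * \1_A x) = 0.
Proof.
elim: M N i j => [|M IH] N i j LA Id d0; have mC := @measurable_cell R N i j.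
  rewrite addn0 in LA; have [CA|CA] := level_cell i j LA.
    rewrite -[RHS](d0 N i j (fun x h => h) (leqnn _)).
    by apply: eq_Rintegral => x /set_mem/CA Ax; rewrite indicE mem_set// mulr1.
  transitivity (\int[mu]_(x in cell N i j) (0 : R)); last by rewrite Rintegral_cst// mul0r.
  apply: eq_Rintegral => x /set_mem Cx; rewrite indicE memNset ?mulr0// => Ax.
  by have : set0 x by rewrite -CA.
rewrite addnS -addSn in LA; have mA := level_measurable LA.
have child a b : (a = i * 2 \/ a = i * 2 + 1) -> (b = j * 2 \/ b = j * 2 + 1) ->
    \int[mu]_(x in cell N.+1 a b) (d x * \1_A x) = 0.
  move=> ha hb; have sub := @cell_child R N i j a b ha hb; apply: IH => //.
    by apply: integrableS Id => //; exact: measurable_cell.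
  by move=> N' i' j' h1 h2; apply: d0; [exact: subset_trans h1 sub|exact: ltnW].
rewrite Rintegral_cell_split; last exact: integrable_indic_mul.
by rewrite !child ?addr0; tauto.
Qed.

(** Piecewise constant on the squares of level N: the conditional expectation of
    f given these squares. *)
Definition dyadic_average N f (x : R * R) : R := cell_average N (dyadic N x.1) (dyadic N x.2) f.

Lemma measurable_dyadic_average N f D : measurable D -> measurable_fun (D : set (plane R)) (dyadic_average N f).
Proof.
by move=> mD; apply: (@level_measurable_fun R N) => // x y h1 h2; rewrite /dyadic_average h1 h2.
Qed.

Lemma dyadic_averageE N i j f x : cell N i j x -> dyadic_average N f x = cell_average N i j f.
Proof. by move=> [<- <-]. Qed.

Lemma inner_cell Omega N i j x : inner_cells N Omega x -> cell N i j x -> closed_cell N i j `<=` Omega.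
Proof. by move=> h [<- <-]. Qed.

Lemma cell_nonempty N i j : exists x, @cell R N i j x.
Proof.
exists (i%:~R / 2 ^+ N, j%:~R / 2 ^+ N).
have p0 : 0 < 2 ^+ N :> R by rewrite exprn_gt0.
by split; apply/dyadic_itv; rewrite lexx/= ltr_pM2r ?invr_gt0// ltr_int ltrDl.
Qed.

Lemma cell_inner_closed_cell Omega N i j : cell N i j `<=` inner_cells N Omega -> @closed_cell R N i j `<=` Omega.
Proof. by have [x cx] := cell_nonempty N i j => h; exact: inner_cell (h x cx) cx. Qed.

(** The fundamental lemma of the calculus of variations.  Bumps approximate the
    indicator function of a dyadic square, so all integrals of d over dyadic
    squares inside Omega vanish; by duality d is 0 almost everywhere on each of
    them, and they cover Omega. *)
Lemma ae_eq0_of_tests Omega (d : R * R -> R) : open Omega ->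
  mu.-integrable Omega (EFin \o d) ->
  (forall phi, test_function Omega phi -> \int[mu]_(x in Omega) (d x * phi x) = 0) ->
  {ae mu, forall x, Omega x -> d x = 0}.
Proof.
move=> oO Id d0; have mO := open_measurable_plane oO.
have cell0 N i j : closed_cell N i j `<=` Omega -> \int[mu]_(x in cell N i j) d x = 0.
  move=> cO; have mC := @measurable_cell R N i j.
  rewrite (Rintegral_indic _ mC mO (subset_trans (@cell_closed_cell _ _ _ _) cO)) cell_box0.
  have cv := @smooth_bump_box_cvg R Omega (ord0 : 'I_2) (i%:~R / 2 ^+ N) ((i + 1)%:~R / 2 ^+ N)
    (j%:~R / 2 ^+ N) ((j + 1)%:~R / 2 ^+ N) d mO Id.
  apply: (cvg_unique _ cv) => //; apply: cvg_near_cst; apply: nearW => k.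
  have eb := @elementary_bump R k (i%:~R / 2 ^+ N) ((i + 1)%:~R / 2 ^+ N).
  have [b' _ bb'] := elementary_derive eb.
  have [|tst _] := @box_test R Omega (ord0 : 'I_2) _ _ _ _ _ _ _ eb bb'
    (@elementary_bump R k (j%:~R / 2 ^+ N) ((j + 1)%:~R / 2 ^+ N)) (@smooth_bump_neq0 _ _ _ _) (@smooth_bump_neq0 _ _ _ _).
    by move=> x h1 h2; apply: cO.
  exact: (d0 _ tst).
have cellae N n : {ae mu, forall x, ncell N n x -> inner_cells N Omega x -> d x = 0}.
  rewrite /ncell; case: pickle_inv => [[i j]|]/=; last by apply: aeW.
  have [cO|cO] := pselect (closed_cell N i j `<=` Omega); last first.
    by apply: aeW => x cx Ix; exfalso; apply: cO; exact: inner_cell Ix cx.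
  have mC := @measurable_cell R N i j; have IdC := Rintegrable_cell oO cO Id.
  have dn : \int[mu]_(x in cell N i j) `|d x| = 0.
    apply/eqP; rewrite eq_le; apply/andP; split; last exact: Rintegral_ge0.
    rewrite -[leRHS](mulr0 3); apply: dyadic_norm_bound => // M A LA.
    rewrite (@dyadic_null _ M) ?normr0//.
      by apply: level_leq LA; exact: leq_addl.
    move=> N' i' j' sub NN'; apply: cell0.
    apply: subset_trans cO; have [x cx] := cell_nonempty N' i' j'.
    have [h1 h2] := sub x cx; have [h3 h4] := cx; rewrite -h1 -h2 -h3 -h4.
    have : inner_cells N (closed_cell N (dyadic N x.1) (dyadic N x.2)) x by [].
    by move/(inner_leq NN').
  by apply: ae_imply (Rintegral_eq0 mC IdC dn) => x h cx _; exact: h.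
have {}cellae := ae_foralln (fun N => ae_foralln (cellae N)).
apply: ae_imply cellae => x h Ox.
have [N _ Ix] : (\bigcup_N inner_cells N Omega) x by rewrite bigcup_inner.
have [n _ nx] : (\bigcup_n @ncell R N n) x by rewrite bigcup_ncell.
exact: (h N n nx Ix).
Qed.

Lemma ae_le1_Rintegral D f : measurable D -> (mu D < +oo)%E -> mu.-integrable D (EFin \o f) ->
  {ae mu, forall x, D x -> `|f x| <= 1} -> `|\int[mu]_(x in D) f x| <= fine (mu D).
Proof.
move=> mD Dfin If f1; apply: le_trans (le_normr_Rintegral _ _) _ => //.
rewrite -[leRHS]mul1r -Rintegral_cst//; apply: ae_le_Rintegral => //.
- exact: Rintegrable_norm.
- exact: Rintegrable_cst.
Qed.

Lemma cell_average_le1 Omega N i j f : open Omega -> mu.-integrable Omega (EFin \o f) ->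
  {ae mu, forall x, Omega x -> `|f x| <= 1} -> @closed_cell R N i j `<=` Omega ->
  `|cell_average N i j f| <= 1.
Proof.
move=> oO If f1 cO; rewrite /cell_average normrM ger0_norm ?exprn_ge0//.
have p0 : 0 < 2 ^+ N :> R by rewrite exprn_gt0.
rewrite -ler_pdivlMl ?exprn_gt0// mulr1 -exprVn.
have f1c : {ae mu, forall x, cell N i j x -> `|f x| <= 1}.
  by apply: ae_imply f1 => x h Cx; apply/h/cO/cell_closed_cell.
have := @ae_le1_Rintegral (cell N i j) f (@measurable_cell R N i j) (cell_lty _ N i j)
  (Rintegrable_cell oO cO If).
move=> /(_ f1c); by rewrite leb2_cell.
Qed.

Lemma inner_poincare Omega (g : 'I_2 -> R * R -> R) f N : open Omega -> (mu Omega < +oo)%E ->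
  (forall j, is_weak_partial Omega j f (g j)) ->
  mu.-integrable Omega (EFin \o f) -> (forall j, mu.-integrable Omega (EFin \o g j)) ->
  {ae mu, forall x, Omega x -> `|f x| <= 1} ->
  \int[mu]_(x in inner_cells N Omega) `|f x - dyadic_average N f x| <=
  12 * (2 ^+ N)^-1 * \int[mu]_(x in Omega) (`|g ord0 x| + `|g ord_max x|).
Proof.
move=> oO Ofin wp If Ig f1; have mO := open_measurable_plane oO.
have mI := @measurable_inner R N Omega; have IO := @inner_sub R N Omega.
have IIf : mu.-integrable (inner_cells N Omega) (EFin \o f) by apply: integrableS If.
have Ifin : (mu (inner_cells N Omega) < +oo)%E.
  by apply: le_lt_trans Ofin; apply: le_measure => //; rewrite inE.
have Im : mu.-integrable (inner_cells N Omega) (EFin \o dyadic_average N f).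
  apply: (@Rintegrable_le _ _ _ _ _ _ (cst 1)) => //.
  - exact: measurable_dyadic_average.
  - exact: Rintegrable_cst.
  - by move=> x Ix; exact: cell_average_le1 oO If f1 Ix.
have IG : mu.-integrable Omega (EFin \o (fun x => `|g ord0 x| + `|g ord_max x|)).
  by apply: RintegrableD => //; exact: Rintegrable_norm.
apply: (@le_trans _ _ (\int[mu]_(x in inner_cells N Omega) (12 * (2 ^+ N)^-1 * (`|g ord0 x| + `|g ord_max x|)))).
  apply: (@le_integral_level N) => //.
  - exact: level_inner.
  - by apply: Rintegrable_norm; exact: RintegrableB.
  - by apply: RintegrableZ => //; apply: integrableS IG.
  move=> i j CI; have cO := cell_inner_closed_cell CI.
  have mC := @measurable_cell R N i j.
  rewrite RintegralZl//; last by apply: integrableS IG => //; apply: subset_trans IO.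
  apply: le_trans (poincare_cell oO wp If Ig cO).
  rewrite le_eqVlt; apply/orP; left; apply/eqP; apply: eq_Rintegral => x /set_mem Cx.
  by rewrite (dyadic_averageE _ Cx).
rewrite RintegralZl//; last by apply: integrableS IG.
rewrite ler_wpM2l ?mulr_ge0 ?invr_ge0 ?exprn_ge0//.
by apply: Rintegral_subset => // x _; exact: addr_ge0.
Qed.

(** The inner squares increase to Omega, so the remaining strip has vanishing
    measure. *)
Lemma inner_exhaust Omega : open Omega -> (mu Omega < +oo)%E ->
  \int[mu]_(x in Omega) (1 - \1_(inner_cells N Omega) x) @[N --> \oo] --> (0 : R).
Proof.
move=> oO Ofin; have mO := open_measurable_plane oO.
have -> : 0 = \int[mu]_(x in Omega) (0 : R) by rewrite Rintegral_cst// mul0r.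
apply: (Rdominated_cvg mO _ _ _ (Rintegrable_cst 1 mO Ofin) _).2 => //.
- by move=> N; apply: measurable_funB => //; apply: measurable_indic; exact: measurable_inner.
- apply: aeW => x Ox; apply: cvg_near_cst.
  have : (\bigcup_N inner_cells N Omega) x by rewrite bigcup_inner.
  move=> [N _ Nx]; exists N => // M /= NM.
  by rewrite indicE mem_set ?subrr//; exact: inner_leq Nx.
- move=> N; apply: aeW => x Ox; rewrite indicE.
  by case: (_ \in _); rewrite ?subrr ?subr0 ?normr0 ?normr1.
Qed.

(** At a fixed small scale, f n is within e / 8 of its dyadic average on the inner
    squares, uniformly in n; the remaining strip has measure at most e / 8 and
    both functions are bounded by 1 there; and the averages converge. *)
Lemma rellich_L1_cauchy Omega (f : nat -> R * R -> R) (g : nat -> 'I_2 -> R * R -> R) C :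
  open Omega -> (mu Omega < +oo)%E ->
  (forall n j, is_weak_partial Omega j (f n) (g n j)) ->
  (forall n, mu.-integrable Omega (EFin \o f n)) ->
  (forall n j, mu.-integrable Omega (EFin \o g n j)) ->
  (forall n, {ae mu, forall x, Omega x -> `|f n x| <= 1}) ->
  (forall n, \int[mu]_(x in Omega) (`|g n ord0 x| + `|g n ord_max x|) <= C) ->
  (forall N i j, closed_cell N i j `<=` Omega -> cvgn (fun n => cell_average N i j (f n))) ->
  forall e, 0 < e -> exists M, forall n m, (M <= n)%N -> (M <= m)%N ->
     \int[mu]_(x in Omega) `|f n x - f m x| <= e.
Proof.
move=> oO Ofin wp If Ig f1 gC cm e e0; have mO := open_measurable_plane oO.
have C0 : 0 <= C by apply: le_trans (gC 0%N); apply: Rintegral_ge0 => x _; exact: addr_ge0.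
have e8 : 0 < e / 8 by rewrite divr_gt0.
have /cvgrPdist_le/(_ _ e8)[N1 _ HN1] := inner_exhaust oO Ofin.
have [N2 HN2] : exists N2 : nat, forall N, (N2 <= N)%N -> 12 * (2 ^+ N)^-1 * C <= e / 8.
  have D0 : 0 < 12 * (C + 1) by rewrite mulr_gt0// ltr_wpDl.
  have [N2 h] := pow2_le_small (divr_gt0 e8 D0); exists N2 => N N2N.
  have : (2 ^+ N)^-1 <= e / 8 / (12 * (C + 1)).
    apply: le_trans h; rewrite lef_pV2 ?posrE ?exprn_gt0// ler_weXn2l// ler1n//.
  rewrite ler_pdivlMr// => h2; apply: le_trans h2.
  rewrite -mulrA [leRHS]mulrCA ler_wpM2l// ler_wpM2l ?invr_ge0 ?exprn_ge0// lerDl//.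
pose N := maxn N1 N2.
have HNa := HN1 N (leq_maxl _ _); have HNb := HN2 N (leq_maxr _ _).
set In := inner_cells N Omega in HNa *.
have mI : measurable In := @measurable_inner R N Omega.
(* Averages on the inner squares, and 0 on the strip. *)
pose P n x : R := dyadic_average N (f n) x * \1_In x.
pose l x : R := limn (P ^~ x).
have cP x : cvgn (P ^~ x).
  have [Ix|Ix] := pselect (In x).
    rewrite (_ : P ^~ x = fun n => cell_average N (dyadic N x.1) (dyadic N x.2) (f n)); first exact: cm.
    by apply/funext => n; rewrite /P indicE mem_set// mulr1.
  rewrite (_ : P ^~ x = cst 0); first exact: is_cvg_cst.
  by apply/funext => n; rewrite /P indicE memNset// mulr0.
have P1 n x : `|P n x| <= 1.
  rewrite /P indicE; have [Ix|Ix] := boolP (x \in In); last by rewrite mulr0 normr0.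
  by rewrite mulr1; apply: cell_average_le1 oO (If n) (f1 n) _; exact: set_mem Ix.
have mP n : measurable_fun (Omega : set (plane R)) (P n).
  by apply: measurable_funM; [exact: measurable_dyadic_average|exact: measurable_indic].
have ml : measurable_fun (Omega : set (plane R)) l.
  by apply: (@measurable_fun_cvg _ _ _ _ P) => // x _; exact: cP.
have IP n : mu.-integrable Omega (EFin \o P n).
  by apply: (@Rintegrable_le _ _ _ _ _ _ (cst 1)) => //; exact: Rintegrable_cst.
have l1 x : `|l x| <= 1.
  rewrite /l -lim_norm//; apply: limr_le; first exact: is_cvg_norm.
  exact: nearW.
have Il : mu.-integrable Omega (EFin \o l).
  by apply: (@Rintegrable_le _ _ _ _ _ _ (cst 1)) => //; exact: Rintegrable_cst.
have IPl n : mu.-integrable Omega (EFin \o (fun x => `|P n x - l x|)).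
  by apply: Rintegrable_norm; exact: RintegrableB.
have cvP : \int[mu]_(x in Omega) `|P n x - l x| @[n --> \oo] --> (0 : R).
  have -> : 0 = \int[mu]_(x in Omega) (0 : R) by rewrite Rintegral_cst// mul0r.
  apply: (Rdominated_cvg mO _ _ _ (Rintegrable_cst 2 mO Ofin) _).2 => //.
  - by move=> n; exact: integrable_measurable (IPl n).
  - apply: aeW => x Ox; rewrite -(normr0 R) -(subrr (l x)).
    by apply: cvg_norm; apply: cvgB; [exact: cP|exact: cvg_cst].
  - move=> n; apply: aeW => x Ox; rewrite normr_id (le_trans (ler_normB _ _))//.
    by rewrite -[2]/(1 + 1) lerD.
have /cvgrPdist_le/(_ _ e8)[M _ HM] := cvP.
have Iin n : mu.-integrable Omega (EFin \o (fun x => `|f n x - dyadic_average N (f n) x| * \1_In x)).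
  apply: (@Rintegrable_le _ _ _ _ _ _ (fun x : plane R => `|f n x| + `|P n x|)) => //.
  - apply: measurable_funM; last exact: measurable_indic.
    apply: measurableT_comp => //; apply: measurable_funB.
      exact: integrable_measurable (If n).
    exact: measurable_dyadic_average.
  - by apply: RintegrableD => //; exact: Rintegrable_norm.
  - move=> x Ox; rewrite /P indicE; case: (x \in In).
      by rewrite !mulr1 normr_id ler_normB.
    by rewrite !mulr0 normr0 addr_ge0.
have I1 : mu.-integrable Omega (EFin \o (fun x => 1 - \1_In x)).
  apply: (@Rintegrable_le _ _ _ _ _ _ (cst 1)) => //.
  - by apply: measurable_funB => //; exact: measurable_indic.
  - exact: Rintegrable_cst.
  - move=> x _; rewrite indicE; case: (x \in In); by rewrite ?subrr ?subr0 ?normr0 ?normr1.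
have bnd n : (M <= n)%N -> \int[mu]_(x in Omega) `|f n x - l x| <= e / 2.
  move=> Mn.
  have H1 : \int[mu]_(x in Omega) (`|f n x - dyadic_average N (f n) x| * \1_In x) <= e / 8.
    rewrite -Rintegral_indic//; last exact: inner_sub.
    apply: le_trans (inner_poincare N oO Ofin (wp n) (If n) (Ig n) (f1 n)) _.
    by apply: le_trans HNb; rewrite ler_wpM2l// mulr_ge0// invr_ge0 exprn_ge0.
  have H2 : \int[mu]_(x in Omega) `|P n x - l x| <= e / 8.
    have := HM n Mn; rewrite sub0r normrN ger0_norm//.
    by apply: Rintegral_ge0.
  have H3 : \int[mu]_(x in Omega) (2 * (1 - \1_In x)) <= e / 4.
    rewrite RintegralZl//; move: HNa; rewrite sub0r normrN ger0_norm; first lra.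
    by apply: Rintegral_ge0 => x _; rewrite indicE; case: (x \in In); rewrite ?subrr ?subr0.
  have -> : e / 2 = e / 8 + e / 8 + e / 4 by field.
  apply: le_trans (lerD (lerD H1 H2) H3).
  rewrite -!RintegralD//; last 2 first.
  - exact: RintegrableD.
  - exact: RintegrableZ.
  apply: ae_le_Rintegral => //.
  - by apply: Rintegrable_norm; exact: RintegrableB.
  - by apply: RintegrableD => //; [exact: RintegrableD|exact: RintegrableZ].
  apply: ae_imply (f1 n) => x h Ox; have := h Ox; rewrite /P indicE.
  have [Ix|Ix] := boolP (x \in In).
    rewrite !mulr1 subrr mulr0 addr0 => _.
    by rewrite -[f n x - l x](subrKA (dyadic_average N (f n) x)) ler_normD.
  rewrite !mulr0 add0r subr0 mulr1 sub0r normrN => fx.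
  rewrite (le_trans (ler_normB _ _))// addrC lerD2l (le_trans fx)// ler1n//.
exists M => n m Mn Mm.
have Ifl k : mu.-integrable Omega (EFin \o (fun x => `|f k x - l x|)).
  by apply: Rintegrable_norm; exact: RintegrableB.
rewrite [e]splitr; apply: le_trans (lerD (bnd _ Mn) (bnd _ Mm)); rewrite -RintegralD//.
apply: le_Rintegral => //.
- by apply: Rintegrable_norm; exact: RintegrableB.
- exact: RintegrableD.
by move=> x _; rewrite (distrC (f m x)) -[f n x - f m x](subrKA (l x)) ler_normD.
Qed.

End Rellich.

(** * Subsequences and completeness *)

Lemma cvg_subseq (T : topologicalType) (u : nat -> T) (phi : nat -> nat) (l : T) :
  (forall n, (n <= phi n)%N) -> u @ \oo --> l -> u (phi n) @[n --> \oo] --> l.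
Proof.
move=> hphi ul; apply: cvg_comp ul => A [N _ NA]; exists N => // n /= Nn.
by apply: NA => /=; exact: leq_trans Nn (hphi n).
Qed.

(** Diagonal argument through Tychonoff's theorem: a cluster point of the
    sequence in the compact product of the intervals [-B t, B t] is approached
    within 2^-N on its first N + 1 coordinates by some term of index at least N. *)
Lemma diagonal_extraction (R : realType) (I : countType) (a : I -> nat -> R) (B : I -> R) :
  (forall t n, `|a t n| <= B t) ->
  exists phi : nat -> nat, (forall n, (n <= phi n)%N) /\
    forall t, cvgn (fun n => a t (phi n)).
Proof.
move=> aB.
pose X (n : nat) : prod_topology (fun _ : nat => R) :=
  fun k => if unpickle k is Some t then a t n else 0.
pose b k := if unpickle k is Some t then B t else 0.
have cpt : compact [set f : prod_topology (fun _ : nat => R) | forall k, `[- b k, b k]%classic (f k)].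
  by apply: (@tychonoff nat (fun _ => R) (fun k => `[- b k, b k]%classic)) => k; exact: segment_compact.
have XA n : [set f : prod_topology (fun _ : nat => R) | forall k, `[- b k, b k]%classic (f k)] (X n).
  move=> k /=; rewrite in_itv/= /X /b; case: (unpickle k) => [t|]; last by rewrite oppr0 lexx.
  by rewrite -ler_norml.
have [l [_ cl]] := cpt (X @ \oo) _ (@filterE _ \oo _ _ XA).
(* Only finitely many coordinates are constrained. *)
have near_l N : nbhs l [set f : prod_topology (fun _ : nat => R) |
    forall k : 'I_N.+1, `|l k - f k| < 2^-1 ^+ N].
  have FF : Filter (nbhs l) by exact: nbhs_filter.
  have : nbhs l (fun f : prod_topology (fun _ : nat => R) => forall k : 'I_N.+1, `|l k - f k| < 2^-1 ^+ N).
    apply: (@filter_forall _ _ (fun (k : 'I_N.+1) (f : prod_topology (fun _ : nat => R)) =>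
      `|l k - f k| < 2^-1 ^+ N) _ FF) => k; have := @proj_continuous nat (fun _ => R) k l.
    by move=> /cvgrPdist_lt; apply; rewrite exprn_gt0// invr_gt0.
  by [].
have /choice[phi Hphi] : forall N, exists n, (N <= n)%N /\
    forall k : 'I_N.+1, `|l k - X n k| < 2^-1 ^+ N.
  move=> N.
  have inf : (X @ \oo) (X @` [set n | (N <= n)%N]).
    by exists N => // n /= Nn; exists n.
  have [_ [[n /= Nn <-] h]] := cl _ _ inf (near_l N).
  by exists n.
exists phi; split; first by move=> n; case: (Hphi n).
move=> t; suff h : a t (phi n) @[n --> \oo] --> (l (pickle t) : R) by exact: cvgP h.
apply/cvgrPdist_le => e e0.
have c0 : 2^-1 ^+ n @[n --> \oo] --> (0 : R).
  by apply: cvg_expr; rewrite ger0_norm ?invr_ge0// invf_lt1// ltr1n.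
move/cvgrPdist_le : c0 => /(_ _ e0) ce.
near=> n.
have tn : (pickle t < n.+1)%N by rewrite ltnS; near: n; exact: nbhs_infty_ge.
have [_ /(_ (Ordinal tn))] := Hphi n; rewrite /X/= pickleK => /ltW h.
apply: (le_trans h); rewrite -[leLHS]ger0_norm ?exprn_ge0 ?invr_ge0//.
by rewrite -normrN -sub0r; near: n.
Unshelve. all: by end_near. Qed.

Section L1Complete.
Context d (T : measurableType d) (R : realType).
Variables (mu : {measure set T -> \bar R}).

(** The Riesz-Fischer theorem in L^1, with one almost everywhere convergent
    subsequence for all the members of a finite family. *)
Lemma L1_complete_family (I : finType) (D : set T) (u : I -> nat -> T -> R) : measurable D ->
  (forall i n, mu.-integrable D (EFin \o u i n)) ->
  (forall i e, 0 < e -> exists N, forall n m, (N <= n)%N -> (N <= m)%N ->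
     \int[mu]_(x in D) `|u i n x - u i m x| <= e) ->
  exists v, exists phi : nat -> nat, (forall k, (k <= phi k)%N) /\
    forall i, [/\ mu.-integrable D (EFin \o v i),
        {ae mu, forall x, D x -> u i (phi k) x @[k --> \oo] --> v i x} &
        \int[mu]_(x in D) `|u i n x - v i x| @[n --> \oo] --> 0].
Proof.
move=> mD Iu cu.
have /choice[N HN] : forall k, exists N, forall i n m, (N <= n)%N -> (N <= m)%N ->
     \int[mu]_(x in D) `|u i n x - u i m x| <= 2^-1 ^+ k.
  move=> k; have k0 : 0 < 2^-1 ^+ k :> R by rewrite exprn_gt0// invr_gt0.
  have /choice[N HN] := fun i => cu i _ k0; exists (\max_i N i)%N => i n m Nn Nm.
  by apply: HN; [apply: leq_trans Nn|apply: leq_trans Nm]; exact: leq_bigmax.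
(* Summing makes the index at least k and at least every N i with i <= k. *)
pose phi k := (\sum_(i < k.+1) N i + k)%N.
have Nphi k : (N k <= phi k)%N by rewrite /phi big_ord_recr/= -addnA addnCA leq_addr.
have Nphi1 k : (N k <= phi k.+1)%N.
  by rewrite (leq_trans (Nphi k))// /phi [in leqRHS]big_ord_recr/= leq_add// leq_addr.
suff /choice[v Hv] i : exists v, [/\ mu.-integrable D (EFin \o v),
    {ae mu, forall x, D x -> u i (phi k) x @[k --> \oo] --> v x} &
    \int[mu]_(x in D) `|u i n x - v x| @[n --> \oo] --> 0].
  by exists v, phi; split=> // k; exact: leq_addl.
have Iphi k := Iu i (phi k).
have cphi := @ae_summable_cvg _ _ _ mu D (fun k => u i (phi k)) mD Iphi
  (fun k => HN k i _ _ (Nphi1 k) (Nphi k)).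
have [v [mv cv]] := measurable_ae_limit mD (fun k => integrable_measurable (Iphi k)) cphi.
have fat e : 0 < e -> exists M, forall n, (M <= n)%N ->
    mu.-integrable D (EFin \o (fun x => `|u i n x - v x|)) /\
    \int[mu]_(x in D) `|u i n x - v x| <= e.
  move=> e0; have [M HM] := cu i e e0; exists M => n Mn.
  apply: (@Rfatou _ _ _ mu D (fun k x => `|u i n x - u i (phi k) x|)) => //.
  - by move=> k; exact: (Rintegrable_norm (RintegrableB mD (Iu i n) (Iphi k))).
  - apply: measurableT_comp => //; apply: measurable_funB => //.
    exact: integrable_measurable (Iu i n).
  - apply: filterS cv => x h Dx; apply: cvg_norm; apply: cvgB; first exact: cvg_cst.
    exact: h.
  - exists M => // k /= Mk; apply: HM => //; apply: (leq_trans Mk); exact: leq_addl.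
have [M /(_ M (leqnn M))[IMv _]] := fat 1 ltr01.
have Iv : mu.-integrable D (EFin \o v).
  apply: (@Rintegrable_le _ _ _ _ _ _ (fun x => `|u i M x| + `|u i M x - v x|)) => //.
    by apply: RintegrableD => //; exact: Rintegrable_norm.
  move=> x _; rewrite addrC -[in leLHS](subKr (u i M x) (v x)).
  by rewrite (le_trans (ler_normB _ _))// addrC.
exists v; split => //.
apply/cvgrPdist_le => e e0; have [M' HM'] := fat e e0.
near=> n; rewrite sub0r normrN ger0_norm; last by apply: Rintegral_ge0.
by apply HM'; near: n; exact: nbhs_infty_ge.
Unshelve. all: by end_near. Qed.

End L1Complete.

(** * Square integrable functions and limits of weak derivatives *)

Section SobolevTools.
Variable R : realType.
Notation mu := (leb2 R).
Implicit Types (f g u v : R * R -> R) (Omega : set (R * R)) (j : 'I_2).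

Lemma L2P Omega f : measurable (Omega : set (plane R)) -> L2 Omega f <->
  measurable_fun (Omega : set (plane R)) f /\ mu.-integrable Omega (EFin \o (fun x => f x ^+ 2)).
Proof.
move=> mO.
have E : (EFin \o (fun x => f x ^+ 2)) \_ Omega = EFin \o (fun x => (f \_ Omega) x ^+ 2).
  by apply/funext => x; rewrite /patch/=; case: ifP => //; rewrite expr0n.
split=> [L2f|[mf If]].
  have := L2f; rewrite /L2 inE => /andP[/[!inE]/= mf _]; split.
    by apply/(measurable_restrictT _ mO).
  apply/(integrable_mkcond _ mO); rewrite E.
  exact: Lfun2_integrable_sqr.
rewrite /L2 inE; apply/andP; split; rewrite inE/=.
  exact/(measurable_restrictT _ mO).
have {}If : mu.-integrable setT (EFin \o (fun x => (f \_ Omega) x ^+ 2)).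
  by rewrite -E; apply/(integrable_mkcond _ mO).1.
rewrite /finite_norm unlock; apply: poweR_lty.
move/integrableP : If => [_]; apply: le_lt_trans.
rewrite le_eqVlt; apply/orP; left; apply/eqP; apply: eq_integral => x _.
by rewrite /= normrX -powR_mulrn.
Qed.

Lemma test_derive_continuous Omega phi j : test_function Omega phi ->
  continuous phi /\ continuous (fun x => 'D_(e_ R j) phi x).
Proof. by case=> sm _ _; split; [exact: (sm [::]).1|exact: (sm [:: j]).1]. Qed.

Lemma continuous_compact_bound (A : set (R * R)) f : compact A -> continuous f ->
  exists2 M, 0 <= M & forall x, A x -> `|f x| <= M.
Proof.
move=> cA cf; have := compact_bounded (continuous_compact (continuous_subspaceT cf) cA).
move=> [M [_ HM]]; exists (`|M| + 1); first by rewrite addr_ge0.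
move=> x Ax; apply: (HM (`|M| + 1)); last by exists x.
by rewrite (le_lt_trans (ler_norm M))// ltrDl.
Qed.

Lemma test_off_support (phi : R * R -> R) j (x : R * R) :
  ~ closure [set y | phi y != 0] x -> phi x = 0 /\ 'D_(e_ R j) phi x = 0.
Proof.
move=> nSx; have nb : \forall y \near x, phi y = 0.
  have : open (~` closure [set y | phi y != 0]) by rewrite openC; exact: closed_closure.
  rewrite openE => /(_ x nSx); apply: filterS => y ny.
  by apply: contrapT => /eqP py; apply: ny; exact: subset_closure.
split; first exact: nbhs_singleton nb.
by rewrite (@near_eq_derive _ _ _ phi (cst 0)) ?derive_cst.
Qed.

Lemma test_bounded Omega phi j : test_function Omega phi ->
  exists2 M, 0 <= M & forall x, `|phi x| <= M /\ `|'D_(e_ R j) phi x| <= M.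
Proof.
move=> tphi; have [c1 c2] := test_derive_continuous j tphi; have [_ cK _] := tphi.
have [M1 M10 H1] := continuous_compact_bound cK c1.
have [M2 M20 H2] := continuous_compact_bound cK c2.
exists (M1 + M2); first exact: addr_ge0.
move=> x; have [Sx|Sx] := pselect (closure [set y | phi y != 0] x).
  by split; [rewrite (le_trans (H1 x Sx))// lerDl|rewrite (le_trans (H2 x Sx))// lerDr].
by have [-> ->] := test_off_support j Sx; rewrite normr0 addr_ge0.
Qed.

Lemma integrable_test Omega phi j u : open Omega -> test_function Omega phi ->
  mu.-integrable Omega (EFin \o u) ->
  mu.-integrable Omega (EFin \o (fun x => u x * phi x)) /\
  mu.-integrable Omega (EFin \o (fun x => u x * 'D_(e_ R j) phi x)).
Proof.
move=> oO tphi Iu; have mO := open_measurable_plane oO.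
have [c1 c2] := test_derive_continuous j tphi.
have [M M0 HM] := test_bounded j tphi.
split; apply: (@integrable_mul_bounded _ _ _ _ _ _ _ M) => //.
- exact: continuous_measurable_plane.
- by move=> x _; case: (HM x).
- exact: continuous_measurable_plane.
- by move=> x _; case: (HM x).
Qed.

Lemma is_weak_partial_mid Omega j u1 v1 u2 v2 : open Omega ->
  mu.-integrable Omega (EFin \o u1) -> mu.-integrable Omega (EFin \o v1) ->
  mu.-integrable Omega (EFin \o u2) -> mu.-integrable Omega (EFin \o v2) ->
  is_weak_partial Omega j u1 v1 -> is_weak_partial Omega j u2 v2 ->
  is_weak_partial Omega j (fun x => 2^-1 * (u1 x + u2 x)) (fun x => 2^-1 * (v1 x + v2 x)).
Proof.
move=> oO Iu1 Iv1 Iu2 Iv2 w1 w2 phi tphi; have mO := open_measurable_plane oO.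
have [Iu1p Iu1d] := integrable_test j oO tphi Iu1; have [Iu2p Iu2d] := integrable_test j oO tphi Iu2.
have [Iv1p _] := integrable_test j oO tphi Iv1; have [Iv2p _] := integrable_test j oO tphi Iv2.
under eq_Rintegral do rewrite -mulrA mulrDl.
under [in RHS]eq_Rintegral do rewrite -mulrA mulrDl.
rewrite !RintegralZl//; [|exact: RintegrableD..].
by rewrite !RintegralD// w1// w2// -mulrN opprD.
Qed.

Lemma L1_test_cvg Omega (h : R * R -> R) M (u : nat -> R * R -> R) f : open Omega ->
  measurable_fun (Omega : set (plane R)) h -> (forall x, `|h x| <= M) ->
  (forall n, mu.-integrable Omega (EFin \o u n)) -> mu.-integrable Omega (EFin \o f) ->
  \int[mu]_(x in Omega) `|u n x - f x| @[n --> \oo] --> (0 : R) ->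
  \int[mu]_(x in Omega) (u n x * h x) @[n --> \oo] --> \int[mu]_(x in Omega) (f x * h x).
Proof.
move=> oO mh hM Iu If cu; have mO := open_measurable_plane oO.
have Im (w : R * R -> R) : mu.-integrable Omega (EFin \o w) ->
    mu.-integrable Omega (EFin \o (fun x => w x * h x)).
  by move=> Iw; apply: (@integrable_mul_bounded _ _ _ _ _ _ _ M).
have M0 : 0 <= M := le_trans (normr_ge0 _) (hM 0).
have Iuf n : mu.-integrable Omega (EFin \o (fun x => `|u n x - f x|)).
  by apply: Rintegrable_norm; exact: RintegrableB.
apply/cvgrPdist_le => e e0.
have eM : 0 < e / (M + 1) by rewrite divr_gt0// ltr_wpDl.
have /cvgrPdist_le/(_ _ eM) := cu; apply: filterS => n.
rewrite sub0r normrN ger0_norm; last by apply: Rintegral_ge0.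
rewrite ler_pdivlMr ?ltr_wpDl// => h1; apply: le_trans h1.
rewrite -RintegralB//; [|exact: Im..].
apply: le_trans (le_normr_Rintegral _ _) _ => //.
  by apply: RintegrableB => //; exact: Im.
rewrite -RintegralZr//; apply: le_Rintegral => //.
- by apply: Rintegrable_norm; apply: RintegrableB => //; exact: Im.
- by under eq_fun do rewrite mulrC; exact: RintegrableZ.
- move=> x _; rewrite -mulrBl normrM distrC ler_wpM2l//.
  by rewrite (le_trans (hM x))// lerDl.
Qed.

(** Both sides of the defining identity are continuous for L^1 convergence,
    because test functions and their derivatives are bounded. *)
Lemma is_weak_partial_cvg Omega j (u v : nat -> R * R -> R) f g : open Omega ->
  (forall n, mu.-integrable Omega (EFin \o u n)) -> (forall n, mu.-integrable Omega (EFin \o v n)) ->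
  mu.-integrable Omega (EFin \o f) -> mu.-integrable Omega (EFin \o g) ->
  (forall n, is_weak_partial Omega j (u n) (v n)) ->
  \int[mu]_(x in Omega) `|u n x - f x| @[n --> \oo] --> (0 : R) ->
  \int[mu]_(x in Omega) `|v n x - g x| @[n --> \oo] --> (0 : R) ->
  is_weak_partial Omega j f g.
Proof.
move=> oO Iu Iv If Ig wuv cu cv phi tphi; have mO := open_measurable_plane oO.
have [c1 c2] := test_derive_continuous j tphi.
have [M M0 HM] := test_bounded j tphi.
have l1 := L1_test_cvg oO (continuous_measurable_plane mO c2) (fun x => (HM x).2) Iu If cu.
have l2 : (- \int[mu]_(x in Omega) (v n x * phi x)) @[n --> \oo] -->
    - \int[mu]_(x in Omega) (g x * phi x).
  apply: cvgN.
  exact: (L1_test_cvg oO (continuous_measurable_plane mO c1) (fun x => (HM x).1) Iv Ig cv).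
have E : (fun n => \int[mu]_(x in Omega) (u n x * 'D_(e_ R j) phi x)) =
    (fun n => - \int[mu]_(x in Omega) (v n x * phi x)).
  by apply/funext => n; exact: wuv.
by rewrite E in l1; exact: cvg_unique l1 l2.
Qed.

(** Membership in L^2(Omega), without the cut by 0 outside Omega; see [L2P]. *)
Definition sq_integrable Omega v :=
  measurable_fun (Omega : set (plane R)) v /\ mu.-integrable Omega (EFin \o (fun x => v x ^+ 2)).

Lemma norm_le_sqr (t x : R) : 0 < t -> `|x| <= t * x ^+ 2 + t^-1.
Proof.
move=> t0; rewrite -(real_normK (num_real x)); set y := `|x|.
have ti : t * t^-1 = 1 by rewrite divff// gt_eqF.
have i0 : 0 < t^-1 by rewrite invr_gt0.
rewrite -(ler_pM2l t0) mulrDr ti.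
have := sqr_ge0 (t * y - 1/2); nra.
Qed.

(** A bound on the L^2 norm of derivatives passes to the limit.  Let S e be the
    convex set of the weak derivatives of the functions that are e-close to f in
    L^1, and D e the infimum of the squared norm over it; D is bounded by c and
    increases as e decreases to 0, so it converges.  By the parallelogram
    identity, elements of S e that almost reach D e form a Cauchy sequence; its
    limit is a weak derivative of f, and Fatou's lemma bounds its norm. *)
Lemma weak_partial_lsc Omega j f c : open Omega -> (mu Omega < +oo)%E ->
  mu.-integrable Omega (EFin \o f) ->
  (forall e, 0 < e -> exists u v, [/\ mu.-integrable Omega (EFin \o u), sq_integrable Omega v,
     is_weak_partial Omega j u v, \int[mu]_(x in Omega) `|u x - f x| <= e &
     \int[mu]_(x in Omega) (v x ^+ 2) <= c + e]) ->
  exists v, [/\ sq_integrable Omega v, is_weak_partial Omega j f v &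
     \int[mu]_(x in Omega) (v x ^+ 2) <= c].
Proof.
move=> oO Ofin If H; have mO := open_measurable_plane oO.
have IL2 v : sq_integrable Omega v -> mu.-integrable Omega (EFin \o v).
  by move=> [mv Iv]; exact: integrable_of_sqr.
pose nrm v := \int[mu]_(x in Omega) (v x ^+ 2).
have nrm0 v : 0 <= nrm v by apply: Rintegral_ge0 => x _; exact: sqr_ge0.
pose S e := [set v | sq_integrable Omega v /\ exists u, [/\ mu.-integrable Omega (EFin \o u),
     is_weak_partial Omega j u v & \int[mu]_(x in Omega) `|u x - f x| <= e]].
have SS e1 e2 : e1 <= e2 -> S e1 `<=` S e2.
  by move=> e12 v [h [u [h1 h2 h3]]]; split => //; exists u; split => //; exact: le_trans e12.
have Smid e v1 v2 : S e v1 -> S e v2 -> S e (fun x => 2^-1 * (v1 x + v2 x)).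
  move=> [L1 [u1 [Iu1 w1 d1]]] [L2 [u2 [Iu2 w2 d2]]].
  have [[m1 I1] [m2 I2]] := (L1, L2); split.
    split; first by apply: measurable_funM => //; exact: measurable_funD.
    apply: (@Rintegrable_le _ _ _ _ _ _ (fun x : plane R => v1 x ^+ 2 + v2 x ^+ 2)) => //.
    - by apply: measurable_funX; apply: measurable_funM => //; exact: measurable_funD.
    - exact: RintegrableD.
    - by move=> x _; rewrite ger0_norm ?sqr_ge0//; have := sqr_ge0 (v1 x - v2 x); nra.
  exists (fun x => 2^-1 * (u1 x + u2 x)); split.
  - by apply: RintegrableZ => //; exact: RintegrableD.
  - by apply: is_weak_partial_mid => //; exact: IL2.
  - have Id1 : mu.-integrable Omega (EFin \o (fun x => `|u1 x - f x|)).
      by apply: Rintegrable_norm; exact: RintegrableB.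
    have Id2 : mu.-integrable Omega (EFin \o (fun x => `|u2 x - f x|)).
      by apply: Rintegrable_norm; exact: RintegrableB.
    apply: (@le_trans _ _ (\int[mu]_(x in Omega) (2^-1 * (`|u1 x - f x| + `|u2 x - f x|)))).
      apply: le_Rintegral => //.
      + apply: Rintegrable_norm; apply: RintegrableB => //.
        by apply: RintegrableZ => //; exact: RintegrableD.
      + by apply: RintegrableZ => //; exact: RintegrableD.
      + move=> x _; have -> : 2^-1 * (u1 x + u2 x) - f x = 2^-1 * ((u1 x - f x) + (u2 x - f x)).
          by field.
        by rewrite normrM ger0_norm ?invr_ge0// ler_wpM2l ?invr_ge0// ler_normD.
    by rewrite RintegralZl//; [rewrite RintegralD//; lra|exact: RintegrableD].
pose D e := inf (nrm @` S e).
have lbS e : has_lbound (nrm @` S e) by exists 0 => _ [v _ <-].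
have Sne e : 0 < e -> exists2 v, S e v & nrm v <= c + e.
  by move=> /H[u [v [h1 h2 h3 h4 h5]]]; exists v => //; split => //; exists u.
have infS e : 0 < e -> has_inf (nrm @` S e).
  by move=> /Sne[v Sv _]; split => //; exists (nrm v), v.
have Dlb e v : S e v -> D e <= nrm v by move=> Sv; apply: ge_inf => //; exists v.
have Dc e : 0 < e -> D e <= c.
  move=> e0; apply/ler_addgt0Pr => e' e'0.
  pose m := Num.min e e'; have m0 : 0 < m by rewrite lt_min e0.
  have [v Sv nv] := Sne m m0; apply: (le_trans (Dlb e v _)).
    by apply: SS Sv; rewrite ge_min lexx.
  by apply: (le_trans nv); rewrite lerD2l ge_min lexx orbT.
pose d n : R := n.+1%:R^-1.
have d0 n : 0 < d n by rewrite invr_gt0.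
have dle n m : (n <= m)%N -> d m <= d n.
  by move=> nm; rewrite lef_pV2 ?posrE// ler_nat ltnS.
have cD : cvgn (fun n => D (d n)).
  apply: nondecreasing_is_cvgn; last by exists c => _ [n _ <-]; exact: Dc.
  move=> n m nm; apply: lb_le_inf; first by case: (infS _ (d0 m)).
  by move=> _ [v Sv <-]; apply: Dlb; apply: SS Sv; exact: dle.
have /choice[v Hv] : forall n, exists v, S (d n) v /\ nrm v <= D (d n) + d n.
  move=> n; have [_ [v Sv <-] nv] := inf_adherent (d0 n) (infS _ (d0 n)).
  by exists v; split => //; exact: ltW.
have Sv n : S (d n) (v n) by case: (Hv n).
have Lv n : sq_integrable Omega (v n) by case: (Sv n).
have Iv n : mu.-integrable Omega (EFin \o v n) := IL2 _ (Lv n).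
have Iv2 n : mu.-integrable Omega (EFin \o (fun x => v n x ^+ 2)) by case: (Lv n).
have Id2 n m : mu.-integrable Omega (EFin \o (fun x => (v n x - v m x) ^+ 2)).
  apply: (@Rintegrable_le _ _ _ _ _ _ (fun x : plane R => 2 * (v n x ^+ 2 + v m x ^+ 2))) => //.
  - by apply: measurable_funX; apply: measurable_funB; case: (Lv n); case: (Lv m).
  - by apply: RintegrableZ => //; exact: RintegrableD.
  - by move=> x _; rewrite ger0_norm ?sqr_ge0//; have := sqr_ge0 (v n x + v m x); nra.
have par n m : (n <= m)%N ->
    \int[mu]_(x in Omega) ((v n x - v m x) ^+ 2) <= 2 * (D (d m) - D (d n)) + 4 * d n.
  move=> nm; have Svm : S (d n) (v m) by apply: SS (Sv m); exact: dle.
  have Smd := Smid _ _ _ (Sv n) Svm; have := Dlb _ _ Smd.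
  have [[_ Im] _] := Smd.
  have E : \int[mu]_(x in Omega) ((v n x - v m x) ^+ 2) = 2 * nrm (v n) + 2 * nrm (v m) -
      4 * nrm (fun x => 2^-1 * (v n x + v m x)).
    rewrite /nrm -!RintegralZl// -RintegralD//; last 2 first.
    - exact: RintegrableZ.
    - exact: RintegrableZ.
    rewrite -RintegralB//; last 2 first.
    - by apply: RintegrableD => //; exact: RintegrableZ.
    - exact: RintegrableZ.
    by apply: eq_Rintegral => x _; field.
  rewrite E => hD.
  have [_ h1] := Hv n; have [_ h2] := Hv m; have h3 := dle _ _ nm.
  lra.
have fO : 0 <= fine (mu Omega) by exact: fine_ge0.
have cauchy e : 0 < e -> exists N, forall n m, (N <= n)%N -> (N <= m)%N ->
    \int[mu]_(x in Omega) `|v n x - v m x| <= e.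
  (* From L^2 to L^1 by |x| <= t x^2 + 1 / t, with t so large that the constant
     contributes at most e / 2. *)
  move=> e0; pose t := 2 * (fine (mu Omega) + 1) / e.
  have t0 : 0 < t by rewrite divr_gt0// mulr_gt0// ltr_wpDl.
  pose eta := e / 2 / t / 8.
  have eta0 : 0 < eta by rewrite !divr_gt0.
  have /cvg_cauchy/cauchyP := cD.
  move=> /(_ _ eta0)[l /=]; rewrite /ball/=.
  move=> [N1 _ HN1].
  have [N2 _ HN2] : \forall n \near \oo, d n <= eta.
    have /cvgrPdist_le/(_ _ eta0) := @cvg_harmonic R; apply: filterS => n.
    by rewrite sub0r normrN ger0_norm// invr_ge0.
  pose N := maxn N1 N2.
  have main n m : (N <= n)%N -> (n <= m)%N -> \int[mu]_(x in Omega) `|v n x - v m x| <= e.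
    move=> Nn nm; have Nm := leq_trans Nn nm.
    have a1 := HN1 n (leq_trans (leq_maxl _ _) Nn).
    have a2 := HN1 m (leq_trans (leq_maxl _ _) Nm).
    have a3 := HN2 n (leq_trans (leq_maxr _ _) Nn).
    have pnm : \int[mu]_(x in Omega) ((v n x - v m x) ^+ 2) <= 8 * eta.
      apply: (le_trans (par _ _ nm)).
      move: a1 a2; rewrite /ball/= !ltr_norml => /andP[? ?] /andP[? ?]; lra.
    apply: (@le_trans _ _ (\int[mu]_(x in Omega) (t * (v n x - v m x) ^+ 2 + t^-1))).
      apply: le_Rintegral => //.
      - by apply: Rintegrable_norm; exact: RintegrableB.
      - by apply: RintegrableD; [|exact: RintegrableZ|exact: Rintegrable_cst].
      - by move=> x _; exact: norm_le_sqr.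
    rewrite RintegralD//; [|exact: RintegrableZ|exact: Rintegrable_cst].
    rewrite RintegralZl// Rintegral_cst//.
    have b1 : t * \int[mu]_(x in Omega) ((v n x - v m x) ^+ 2) <= e / 2.
      apply: (le_trans (ler_wpM2l (ltW t0) pnm)).
      rewrite le_eqVlt; apply/orP; left; apply/eqP; rewrite /eta.
      by field; rewrite gt_eqF.
    have b2 : t^-1 * fine (mu Omega) <= e / 2.
      rewrite mulrC ler_pdivrMr// /t.
      have -> : e / 2 * (2 * (fine (mu Omega) + 1) / e) = fine (mu Omega) + 1.
        by field; rewrite gt_eqF.
      by rewrite lerDl.
    lra.
  exists N => n m Nn Nm; have [nm|mn] := leqP n m; first exact: main.
  by under eq_Rintegral do rewrite distrC; exact: main (ltnW mn).
have [w [phi [kphi Hw]]] := L1_complete_family mO (fun (_ : unit) => Iv) (fun _ => cauchy).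
have [Iw aew cw] := Hw tt.
have fat e : 0 < e -> mu.-integrable Omega (EFin \o (fun x => w tt x ^+ 2)) /\
    \int[mu]_(x in Omega) (w tt x ^+ 2) <= c + e.
  move=> e0; apply: (@Rfatou _ _ _ mu Omega (fun k x => v (phi k) x ^+ 2)) => //.
  - by apply: measurable_funX; exact: integrable_measurable Iw.
  - by move=> k x _; exact: sqr_ge0.
  - apply: ae_imply aew => x h Ox; rewrite expr2; under eq_fun do rewrite expr2.
    by apply: cvgM; exact: h.
  - have [N2 _ HN2] : \forall n \near \oo, d n <= e.
      have /cvgrPdist_le/(_ _ e0) := @cvg_harmonic R; apply: filterS => n.
      by rewrite sub0r normrN ger0_norm// invr_ge0.
    exists N2 => // k /= Nk; have [_ h1] := Hv (phi k).
    apply: (le_trans h1); apply: lerD; first exact: Dc.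
    by apply: HN2; exact: leq_trans Nk (kphi k).
exists (w tt); split.
- by split; [exact: integrable_measurable Iw|exact: (fat 1 ltr01).1].
- have /choice[u Hu] : forall n, exists u, [/\ mu.-integrable Omega (EFin \o u),
     is_weak_partial Omega j u (v n) & \int[mu]_(x in Omega) `|u x - f x| <= d n].
    by move=> n; case: (Sv n).
  apply: (@is_weak_partial_cvg Omega j u v) => //.
  + by move=> n; case: (Hu n).
  + by move=> n; case: (Hu n).
  + apply: (squeeze_cvgr (f := cst 0) (h := d)).
    * apply: nearW => n; case: (Hu n) => _ _ ->; rewrite andbT.
      by apply: Rintegral_ge0.
    * exact: cvg_cst.
    * exact: cvg_harmonic.
- by apply/ler_addgt0Pr => e e0; exact: (fat e e0).2.
Qed.

End SobolevTools.

(** * Asymptotic lower bounds *)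

Section EventuallyAbove.
Variable R : realType.
Implicit Types (u v : nat -> R) (x y : R).

(** The limit inferior of u is at least x, in a form that is stable under sums. *)
Definition eventually_above u x := forall e, 0 < e -> \forall n \near \oo, x <= u n + e.

Lemma eventually_aboveD u v x y : eventually_above u x -> eventually_above v y ->
  eventually_above (fun n => u n + v n) (x + y).
Proof.
move=> hx hy e e0; have e2 : 0 < e / 2 by rewrite divr_gt0.
near=> n; have h1 : x <= u n + e / 2 by near: n; exact: hx.
have h2 : y <= v n + e / 2 by near: n; exact: hy.
lra.
Unshelve. all: by end_near. Qed.

Lemma eventually_aboveZ u x k : 0 < k -> eventually_above u x ->
  eventually_above (fun n => k * u n) (k * x).
Proof.
move=> k0 hx e e0; have e2 : 0 < e / k by rewrite divr_gt0.
near=> n; have h1 : x <= u n + e / k by near: n; exact: hx.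
have -> : k * u n + e = k * (u n + e / k).
  by rewrite mulrDr mulrCA divff ?mulr1// gt_eqF.
by rewrite ler_pM2l.
Unshelve. all: by end_near. Qed.

Lemma eventually_above_sum (I : Type) (s : seq I) (u : I -> nat -> R) (x : I -> R) :
  (forall i, eventually_above (u i) (x i)) ->
  eventually_above (fun n => \sum_(i <- s) u i n) (\sum_(i <- s) x i).
Proof.
move=> h; elim: s => [|i s IH].
  by rewrite big_nil => e e0; apply: nearW => n; rewrite big_nil add0r ltW.
rewrite big_cons => e e0; have := eventually_aboveD (h i) IH e0.
by apply: filterS => n; rewrite big_cons.
Qed.

Lemma cvg_eventually_above u x y : y <= x -> u @ \oo --> x -> eventually_above u y.
Proof.
move=> yx /cvgrPdist_le cu e e0; have := cu _ e0; apply: filterS => n.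
by rewrite ler_distl => /andP[_ h]; lra.
Qed.

Lemma eventually_above_le_lim u x l : eventually_above u x -> u @ \oo --> l -> x <= l.
Proof.
move=> hx /cvgrPdist_le cu; apply/ler_addgt0Pr => e e0.
have e2 : 0 < e / 2 by rewrite divr_gt0.
near \oo => n; have h1 : x <= u n + e / 2 by near: n; exact: hx.
have : `|l - u n| <= e / 2 by near: n; exact: cu.
by rewrite ler_distl => /andP[h2 _]; lra.
Unshelve. all: by end_near. Qed.

(** Completing the square, the quadratic polynomial is at least A n - B n ^ 2 / D n
    for every value of m n.  When d = 0, the quotient b / d is 0 by convention
    and the lower bound to be proved is 0. *)
Lemma quadratic_eventually_above (A B D : nat -> R) (a b d : R) (m : nat -> R) :
  A @ \oo --> a -> B @ \oo --> b -> D @ \oo --> d -> 0 <= d ->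
  (forall n, 0 <= A n - 2 * m n * B n + m n ^+ 2 * D n) ->
  (d = 0 -> a = 0 /\ b = 0) ->
  eventually_above (fun n => A n - 2 * m n * B n + m n ^+ 2 * D n)
    (a - 2 * (b / d) * b + (b / d) ^+ 2 * d).
Proof.
move=> cA cB cD; rewrite le_eqVlt => /predU1P[<-|d0] pos dz.
  have [-> ->] := dz erefl => e e0.
  rewrite !mul0r !mulr0 subr0 addr0.
  by apply: nearW => n; rewrite addr_ge0// ltW.
have dn0 : d != 0 by rewrite gt_eqF.
have cv : (A n - B n ^+ 2 / D n) @[n --> \oo] --> a - b ^+ 2 / d.
  apply: cvgB => //; apply: cvgM; last exact: cvgV.
  by rewrite expr2; under eq_fun do rewrite expr2; exact: cvgM.
have -> : a - 2 * (b / d) * b + (b / d) ^+ 2 * d = a - b ^+ 2 / d by field.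
move=> e e0; have := cvg_eventually_above (lexx _) cv e0.
have Dpos : \forall n \near \oo, 0 < D n by exact: (cvgr_gt _ cD).
apply: filterS2 Dpos => n Dn h; apply: (le_trans h); rewrite lerD2r.
rewrite -subr_ge0.
have -> : A n - 2 * m n * B n + m n ^+ 2 * D n - (A n - B n ^+ 2 / D n) = D n * (m n - B n / D n) ^+ 2.
  by field; rewrite gt_eqF.
by rewrite mulr_ge0 ?sqr_ge0// ltW.
Qed.

End EventuallyAbove.

(** * Weak derivatives of H1 functions *)

Section H1Facts.
Variable R : realType.
Notation mu := (leb2 R).
Implicit Types (f g u v : R * R -> R) (Omega : set (R * R)) (j : 'I_2).

Lemma weak_partialP Omega j f : open Omega -> H1 Omega f ->
  sq_integrable Omega (weak_partial Omega j f) /\ is_weak_partial Omega j f (weak_partial Omega j f).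
Proof.
move=> oO [_ /(_ j) ex]; have mO := open_measurable_plane oO.
have [L w] := xgetPex (fun=> 0) ex.
by split => //; exact/L2P.
Qed.

Lemma H1_sq Omega f : open Omega -> H1 Omega f -> sq_integrable Omega f.
Proof. by move=> oO [L _]; have mO := open_measurable_plane oO; exact/L2P. Qed.

Lemma sq_integrable_L1 Omega v : open Omega -> (mu Omega < +oo)%E -> sq_integrable Omega v ->
  mu.-integrable Omega (EFin \o v).
Proof. by move=> oO Of [mv Iv]; apply: integrable_of_sqr => //; exact: open_measurable_plane. Qed.

(** The difference of two weak derivatives integrates to 0 against every test
    function. *)
Lemma weak_partial_unique Omega j f v : open Omega -> (mu Omega < +oo)%E -> H1 Omega f ->
  sq_integrable Omega v -> is_weak_partial Omega j f v ->
  {ae mu, forall x, Omega x -> v x = weak_partial Omega j f x}.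
Proof.
move=> oO Of Hf sv wv; have mO := open_measurable_plane oO.
have [sw ww] := weak_partialP j oO Hf.
have Iv := sq_integrable_L1 oO Of sv; have Iw := sq_integrable_L1 oO Of sw.
have := @ae_eq0_of_tests R Omega (fun x => v x - weak_partial Omega j f x) oO (RintegrableB mO Iv Iw).
have h : (forall phi, test_function Omega phi ->
   \int[mu]_(x in Omega) ((v x - weak_partial Omega j f x) * phi x) = 0).
  move=> phi tphi; under eq_Rintegral do rewrite mulrBl.
  have [Ivp _] := integrable_test j oO tphi Iv; have [Iwp _] := integrable_test j oO tphi Iw.
  rewrite RintegralB//; apply/eqP; rewrite subr_eq0; apply/eqP/oppr_inj.
  by rewrite -(wv _ tphi) -(ww _ tphi).
by move=> /(_ h); apply: ae_imply => x hx Ox; apply/eqP; rewrite -subr_eq0; exact/eqP/hx.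
Qed.

Definition dirichlet Omega j f := \int[mu]_(x in Omega) (weak_partial Omega j f x ^+ 2).

(** The Dirichlet integral does not depend on the representative chosen by
    [weak_partial]. *)
Lemma dirichlet_eq Omega j f v : open Omega -> (mu Omega < +oo)%E -> H1 Omega f ->
  sq_integrable Omega v -> is_weak_partial Omega j f v ->
  dirichlet Omega j f = \int[mu]_(x in Omega) (v x ^+ 2).
Proof.
move=> oO Of Hf sv wv; have mO := open_measurable_plane oO.
have [[mw Iw] ww] := weak_partialP j oO Hf; case: (sv) => mv Iv.
apply: ae_eq_Rintegral => //.
- exact: integrable_measurable Iw.
- exact: integrable_measurable Iv.
- by apply: ae_imply (weak_partial_unique oO Of Hf sv wv) => x h Ox; rewrite h.
Qed.

Lemma dirichlet_ge0 Omega j f : 0 <= dirichlet Omega j f.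
Proof. by apply: Rintegral_ge0 => x _; exact: sqr_ge0. Qed.

(** Dominated convergence with the multiplier as dominating function. *)
Lemma ae_bounded_mul_cvg Omega h (u : nat -> R * R -> R) v : open Omega ->
  mu.-integrable Omega (EFin \o h) ->
  (forall n, measurable_fun (Omega : set (plane R)) (u n)) ->
  measurable_fun (Omega : set (plane R)) v ->
  (forall n, {ae mu, forall x, Omega x -> `|u n x| <= 1}) ->
  {ae mu, forall x, Omega x -> u n x @[n --> \oo] --> v x} ->
  mu.-integrable Omega (EFin \o (fun x => h x * v x)) /\
  \int[mu]_(x in Omega) (h x * u n x) @[n --> \oo] --> \int[mu]_(x in Omega) (h x * v x).
Proof.
move=> oO Ih mu_ mv u1 cu; have mO := open_measurable_plane oO.
have mh := integrable_measurable Ih.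
apply: (@Rdominated_cvg _ _ _ mu Omega (fun n x => h x * u n x) (fun x => h x * v x) (fun x => `|h x|)) => //.
- by move=> n; exact: measurable_funM.
- exact: measurable_funM.
- by apply: ae_imply cu => x cx Ox; apply: cvgM; [exact: cvg_cst|exact: cx].
- exact: Rintegrable_norm.
- by move=> n; apply: ae_imply (u1 n) => x h1 Ox; rewrite normrM ler_piMr// h1.
Qed.

Lemma ae_bounded_mul_integrable Omega h v : open Omega ->
  mu.-integrable Omega (EFin \o h) -> measurable_fun (Omega : set (plane R)) v ->
  {ae mu, forall x, Omega x -> `|v x| <= 1} ->
  mu.-integrable Omega (EFin \o (fun x => h x * v x)).
Proof.
move=> oO Ih mv v1; apply: (proj1 (@ae_bounded_mul_cvg Omega h (fun=> v) v oO Ih _ mv _ _)) => //.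
by apply: ae_imply v1 => x _ _; exact: cvg_cst.
Qed.

End H1Facts.

(** * The energy *)

Section Energy.
Variables (R : realType) (K : nat) (Omega : set (R * R)) (lambda eps : R) (I : R * R -> R).
Hypotheses (oO : open Omega) (Ofin : (leb2 R Omega < +oo)%E).
Hypotheses (lambda_gt0 : 0 < lambda) (eps_gt0 : 0 < eps) (sqI : sq_integrable Omega I).
Notation mu := (leb2 R).
Implicit Types (f : R * R -> R) (P : 'I_K -> R * R -> R) (m : 'I_K -> R).

Let mO : measurable (Omega : set (plane R)) := open_measurable_plane oO.

Definition fidelity f (t : R) := \int[mu]_(x in Omega) ((I x - t) ^+ 2 * f x).
Definition double_well f := \int[mu]_(x in Omega) ((f x * (1 - f x)) ^+ 2).
Definition real_energy P m :=
  lambda * \sum_i fidelity (P i) (m i) +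
  \sum_i (9 * eps * \sum_(j < 2) dirichlet Omega j (P i) + eps^-1 * double_well (P i)).

Definition unit_valued f := measurable_fun (Omega : set (plane R)) f /\
  {ae mu, forall x, Omega x -> 0 <= f x <= 1}.

Lemma ownership_unit_valued P i : ownerships Omega P -> unit_valued (P i).
Proof.
move=> [HP sP]; split; first by have [] := H1_sq oO (HP i).
apply: ae_imply sP => x h Ox; have [P0 P1] := h Ox.
by rewrite P0/= -P1 (bigD1 i)//= lerDl sumr_ge0.
Qed.

Lemma unit_valued_norm f : unit_valued f -> {ae mu, forall x, Omega x -> `|f x| <= 1}.
Proof.
move=> [_]; apply: ae_imply => x h Ox; have /andP[f0 f1] := h Ox.
by rewrite ger0_norm.
Qed.

Lemma integrable_constant (k : R) : mu.-integrable Omega (EFin \o cst k).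
Proof. exact: Rintegrable_cst. Qed.

Lemma integrable_I : mu.-integrable Omega (EFin \o I).
Proof. exact: sq_integrable_L1. Qed.

Lemma integrable_I2 : mu.-integrable Omega (EFin \o (fun x => I x ^+ 2)).
Proof. by case: sqI. Qed.

Lemma integrable_shift2 t : mu.-integrable Omega (EFin \o (fun x => (I x - t) ^+ 2)).
Proof.
have -> : (fun x => (I x - t) ^+ 2) = (fun x => (I x ^+ 2 - (2 * t) * I x) + t ^+ 2).
  by apply/funext => x; ring.
apply: RintegrableD => //; last exact: integrable_constant.
by apply: RintegrableB => //; [exact: integrable_I2|apply: RintegrableZ => //; exact: integrable_I].
Qed.

Lemma integrable_mul_unit h f : unit_valued f -> mu.-integrable Omega (EFin \o h) ->
  mu.-integrable Omega (EFin \o (fun x => h x * f x)).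
Proof.
by move=> uf Ih; apply: ae_bounded_mul_integrable => //; [exact: uf.1|exact: unit_valued_norm].
Qed.

Lemma integrable_well f : unit_valued f ->
  mu.-integrable Omega (EFin \o (fun x => (f x * (1 - f x)) ^+ 2)).
Proof.
move=> uf; have [mf f01] := uf.
have mw : measurable_fun (Omega : set (plane R)) (fun x => (f x * (1 - f x)) ^+ 2).
  apply: measurable_funX; apply: measurable_funM => //; exact: measurable_funB.
have := @ae_bounded_mul_integrable R Omega (cst 1) _ oO (integrable_constant 1) mw.
under [X in EFin \o X]eq_fun do rewrite mul1r; apply.
apply: ae_imply f01 => x h Ox; have /andP[f0 f1] := h Ox.
by rewrite ger0_norm ?sqr_ge0//; rewrite expr_le1//; nra.
Qed.

Lemma Rintegral_zero : \int[mu]_(x in Omega) (0 : R) = 0.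
Proof. by rewrite Rintegral_cst// mul0r. Qed.

Lemma ae_Rintegral_ge0 f : mu.-integrable Omega (EFin \o f) ->
  {ae mu, forall x, Omega x -> 0 <= f x} -> 0 <= \int[mu]_(x in Omega) f x.
Proof.
by move=> If f0; rewrite -Rintegral_zero; apply: ae_le_Rintegral => //; exact: (integrable_constant 0).
Qed.

Lemma fidelity_ge0 f t : unit_valued f -> 0 <= fidelity f t.
Proof.
move=> uf; apply: ae_Rintegral_ge0.
  by apply: integrable_mul_unit => //; exact: integrable_shift2.
by apply: ae_imply uf.2 => x h Ox; rewrite mulr_ge0 ?sqr_ge0//; case/andP: (h Ox).
Qed.

Lemma fidelity_moments f t : unit_valued f ->
  fidelity f t = \int[mu]_(x in Omega) (I x ^+ 2 * f x)
    - 2 * t * \int[mu]_(x in Omega) (I x * f x) + t ^+ 2 * \int[mu]_(x in Omega) (1 * f x).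
Proof.
move=> uf; rewrite /fidelity.
have I2 := integrable_mul_unit uf integrable_I2; have I1 := integrable_mul_unit uf integrable_I.
have I0 := integrable_mul_unit uf (integrable_constant 1).
rewrite -!RintegralZl// -RintegralB//; last exact: RintegrableZ.
rewrite -RintegralD//; last 2 first.
- by apply: RintegrableB => //; exact: RintegrableZ.
- exact: RintegrableZ.
by apply: eq_Rintegral => x _; ring.
Qed.

Lemma double_well_ge0 f : 0 <= double_well f.
Proof. by apply: Rintegral_ge0 => x _; exact: sqr_ge0. Qed.

(** All the integrands are integrable, so the energy, which is defined in the
    extended reals, is a real number. *)
Lemma real_energyE P m : ownerships Omega P ->
  energy Omega lambda eps I P m = (real_energy P m)%:E.
Proof.
move=> oP; rewrite /energy /real_energy EFinD EFinM -!sumEFin; congr (_ * _ + _)%E.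
  apply: eq_bigr => i _; rewrite /fidelity EFin_Rintegral//.
  by apply: integrable_mul_unit; [exact: ownership_unit_valued|exact: integrable_shift2].
apply: eq_bigr => i _; have uf := ownership_unit_valued i oP; case: oP => HP _.
have Iw j := (weak_partialP j oO (HP i)).1.2.
rewrite /dirichlet /double_well -Rintegral_sum// -!RintegralZl//; last 2 first.
- exact: integrable_well.
- exact: Rintegrable_sum.
rewrite -RintegralD//; last 2 first.
- by apply: RintegrableZ => //; exact: Rintegrable_sum.
- by apply: RintegrableZ => //; exact: integrable_well.
rewrite EFin_Rintegral//; last first.
  by apply: RintegrableD => //; apply: RintegrableZ => //; [exact: Rintegrable_sum|exact: integrable_well].
apply: eq_integral => x _; rewrite /normsq_grad.
by congr (_ + _)%:E; rewrite mulrC.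
Qed.

(** All the terms of the energy are nonnegative: each one is bounded by the sum. *)
Lemma real_energy_ge P m i j : ownerships Omega P -> 9 * eps * dirichlet Omega j (P i) <= real_energy P m.
Proof.
move=> oP; rewrite /real_energy.
have F0 : 0 <= lambda * \sum_i fidelity (P i) (m i).
  rewrite mulr_ge0 ?(ltW lambda_gt0)// sumr_ge0// => k _.
  by apply: fidelity_ge0; exact: ownership_unit_valued.
have e9 : 0 <= 9 * eps by rewrite mulr_ge0 ?(ltW eps_gt0).
have S0 k : 0 <= 9 * eps * \sum_(j < 2) dirichlet Omega j (P k) + eps^-1 * double_well (P k).
  rewrite addr_ge0// mulr_ge0 ?invr_ge0 ?(ltW eps_gt0) ?double_well_ge0//.
  by rewrite sumr_ge0// => l _; exact: dirichlet_ge0.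
rewrite (le_trans _ (ler_wpDl F0 (lexx _)))//.
rewrite (bigD1 i)//= (le_trans _ (ler_wpDr _ (lexx _)))//; last by apply: sumr_ge0 => k _.
rewrite (le_trans _ (ler_wpDr _ (lexx _)))//; last first.
  by rewrite mulr_ge0 ?invr_ge0 ?(ltW eps_gt0) ?double_well_ge0.
rewrite ler_wpM2l// (bigD1 j)//= lerDl sumr_ge0// => k _; exact: dirichlet_ge0.
Qed.

Lemma real_energy_ge0 P m : ownerships Omega P -> 0 <= real_energy P m.
Proof.
move=> oP; rewrite addr_ge0//.
  rewrite mulr_ge0 ?(ltW lambda_gt0)// sumr_ge0// => k _.
  by apply: fidelity_ge0; exact: ownership_unit_valued.
have e9 : 0 <= 9 * eps by rewrite mulr_ge0 ?(ltW eps_gt0).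
apply: sumr_ge0 => k _.
rewrite addr_ge0// mulr_ge0 ?invr_ge0 ?(ltW eps_gt0) ?double_well_ge0//.
by rewrite sumr_ge0// => l _; exact: dirichlet_ge0.
Qed.

(** The three moments converge by dominated convergence; if the limit of the
    masses is 0 then f vanishes almost everywhere, and all moments of f do. *)
Lemma fidelity_eventually_above (u : nat -> R * R -> R) f (t : nat -> R) :
  (forall n, unit_valued (u n)) -> unit_valued f ->
  {ae mu, forall x, Omega x -> u n x @[n --> \oo] --> f x} ->
  exists s, eventually_above (fun n => fidelity (u n) (t n)) (fidelity f s).
Proof.
move=> uu uf cu.
have cv h : mu.-integrable Omega (EFin \o h) ->
    \int[mu]_(x in Omega) (h x * u n x) @[n --> \oo] --> \int[mu]_(x in Omega) (h x * f x).
  move=> Ih; apply: (proj2 (@ae_bounded_mul_cvg _ Omega h u f oO Ih _ _ _ _)) => //.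
  - by move=> n; case: (uu n).
  - by case: uf.
  - by move=> n; exact: unit_valued_norm.
have c2 := cv _ integrable_I2; have c1 := cv _ integrable_I; have c0 := cv _ (integrable_constant 1).
set b := \int[mu]_(x in Omega) (I x * f x) in c1.
set d := \int[mu]_(x in Omega) (cst 1 x * f x) in c0.
exists (b / d); rewrite fidelity_moments//.
under eq_fun do rewrite fidelity_moments//.
apply: quadratic_eventually_above => //.
- apply: ae_Rintegral_ge0.
  + exact: integrable_mul_unit (integrable_constant 1).
  + by apply: ae_imply uf.2 => x h Ox; rewrite mul1r; case/andP: (h Ox).
- by move=> n; rewrite -fidelity_moments//; exact: fidelity_ge0.
- move=> d0.
  have f0 : {ae mu, forall x, Omega x -> f x = 0}.
    apply: Rintegral_eq0 => //.
      have := integrable_mul_unit uf (integrable_constant 1).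
      by under [X in EFin \o X]eq_fun do rewrite mul1r.
    rewrite -d0; apply: ae_eq_Rintegral => //.
    + by apply: measurableT_comp => //; case: uf.
    + by apply: measurable_funM => //; case: uf.
    + apply: ae_imply uf.2 => x h Ox; have /andP[f0 _] := h Ox.
      by rewrite mul1r ger0_norm.
  have z h : mu.-integrable Omega (EFin \o h) -> \int[mu]_(x in Omega) (h x * f x) = 0.
    move=> Ih; rewrite -Rintegral_zero; apply: ae_eq_Rintegral => //.
    + by apply: measurable_funM; [exact: integrable_measurable Ih|case: uf].
    + by apply: ae_imply f0 => x h0 Ox; rewrite h0// mulr0.
  by split; apply: z; [exact: integrable_I2|exact: integrable_I].
Qed.

Lemma double_well_cvg (u : nat -> R * R -> R) f :
  (forall n, unit_valued (u n)) -> unit_valued f ->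
  {ae mu, forall x, Omega x -> u n x @[n --> \oo] --> f x} ->
  double_well (u n) @[n --> \oo] --> double_well f.
Proof.
move=> uu uf cu.
have mw v : unit_valued v -> measurable_fun (Omega : set (plane R)) (fun x => (v x * (1 - v x)) ^+ 2).
  by move=> uv; exact: integrable_measurable (integrable_well uv).
apply: (proj2 (@Rdominated_cvg _ _ _ mu Omega (fun n x => (u n x * (1 - u n x)) ^+ 2)
   (fun x => (f x * (1 - f x)) ^+ 2) (cst 1) _ _ _ _ _ _)) => //.
- by move=> n; exact: mw.
- exact: mw.
- apply: ae_imply cu => x cx Ox; rewrite expr2; under eq_fun do rewrite expr2.
  have c := cx Ox; have c' : (1 - u n x) @[n --> \oo] --> 1 - f x by apply: cvgB => //; exact: cvg_cst.
  by apply: cvgM; exact: cvgM.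
- exact: integrable_constant.
- move=> n; apply: ae_imply (uu n).2 => x h Ox; have /andP[f0 f1] := h Ox.
  by rewrite ger0_norm ?sqr_ge0//; rewrite expr_le1//; nra.
Qed.

End Energy.

(** * The direct method *)

Section DirectMethod.
Variables (R : realType) (K : nat) (Omega : set (R * R)) (lambda eps : R) (I : R * R -> R).
Hypotheses (oO : open Omega) (Ofin : (leb2 R Omega < +oo)%E).
Hypotheses (lambda_gt0 : 0 < lambda) (eps_gt0 : 0 < eps) (sqI : sq_integrable Omega I).
Notation mu := (leb2 R).
Implicit Types (f : R * R -> R) (P : 'I_K -> R * R -> R) (m : 'I_K -> R).

Let mO : measurable (Omega : set (plane R)) := open_measurable_plane oO.

Lemma cvg_sum_seq (J : Type) (s : seq J) (t : nat -> J -> R) (l : J -> R) :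
  (forall i, t n i @[n --> \oo] --> l i) ->
  (\sum_(i <- s) t n i) @[n --> \oo] --> \sum_(i <- s) l i.
Proof.
move=> cl; elim: s => [|i s IH].
  by rewrite big_nil; under eq_fun do rewrite big_nil; exact: cvg_cst.
by rewrite big_cons; under eq_fun do rewrite big_cons; exact: cvgD.
Qed.

Lemma simplex_closed (t : nat -> 'I_K -> R) (s : 'I_K -> R) :
  (forall n, simplex (t n)) -> (forall i, t n i @[n --> \oo] --> s i) -> simplex s.
Proof.
move=> st cs; split=> [i|].
  by apply: (cvgr_to_ge (cs i)); apply: nearW => n; case: (st n).
have cS := @cvg_sum_seq _ (index_enum 'I_K) t s cs.
have S1 : (fun n => \sum_i t n i) = cst 1 by apply/funext => n; case: (st n).
by rewrite -(cvg_lim _ cS)// S1 lim_cst.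
Qed.

(** The diagonal extraction makes two countable families converge at once: the
    averages over the dyadic squares inside Omega, which compactness needs, and
    the Dirichlet integrals, whose limits bound those of P'. *)
Lemma ownership_compactness (P : nat -> 'I_K -> R * R -> R) C :
  (forall n, ownerships Omega (P n)) ->
  (forall n i j, dirichlet Omega j (P n i) <= C) ->
  exists (phi : nat -> nat) (P' : 'I_K -> R * R -> R),
    [/\ forall n, (n <= phi n)%N, ownerships Omega P',
        {ae mu, forall x, Omega x -> forall i, P (phi n) i x @[n --> \oo] --> P' i x} &
        forall i j, eventually_above (fun n => dirichlet Omega j (P (phi n) i)) (dirichlet Omega j (P' i))].
Proof.
move=> oP dC.
have uP n i := ownership_unit_valued oO i (oP n).
have IP n i : mu.-integrable Omega (EFin \o P n i).
  by apply: sq_integrable_L1 => //; apply: H1_sq => //; case: (oP n).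
pose G n i j := weak_partial Omega j (P n i).
have GP n i j : sq_integrable Omega (G n i j) /\ is_weak_partial Omega j (P n i) (G n i j).
  by apply: weak_partialP => //; case: (oP n).
have IG n i j : mu.-integrable Omega (EFin \o G n i j).
  by apply: sq_integrable_L1 => //; case: (GP n i j).
pose a (t : ('I_K * 'I_2) + ('I_K * (nat * int * int))) (n : nat) : R :=
  match t with
  | inl (i, j) => dirichlet Omega j (P n i)
  | inr (i, (N, k, l)) => if pselect (@closed_cell R N k l `<=` Omega) then cell_average N k l (P n i) else 0
  end.
pose B (t : ('I_K * 'I_2) + ('I_K * (nat * int * int))) : R := if t is inl _ then C else 1.
have aB t n : `|a t n| <= B t.
  case: t => [[i j]|[i [[N k] l]]] /=; first by rewrite ger0_norm ?dirichlet_ge0.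
  case: pselect => cO; last by rewrite normr0.
  by apply: cell_average_le1 cO => //; exact: unit_valued_norm.
have [phi0 [hphi0 ca]] := diagonal_extraction aB.
(* The L^1 norms of the derivatives, by |x| <= x^2 + 1. *)
have L1b n i : \int[mu]_(x in Omega) (`|G n i ord0 x| + `|G n i ord_max x|) <= 2 * (C + fine (mu Omega)).
  have nb j : \int[mu]_(x in Omega) `|G n i j x| <= C + fine (mu Omega).
    have [[mG IG2] _] := GP n i j.
    apply: (@le_trans _ _ (\int[mu]_(x in Omega) (G n i j x ^+ 2 + 1))).
      apply: ae_le_Rintegral => //.
      - exact: Rintegrable_norm.
      - by apply: RintegrableD => //; exact: Rintegrable_cst.
      - by apply: aeW => x _; have := @norm_le_sqr R 1 (G n i j x) ltr01; rewrite mul1r invr1.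
    rewrite RintegralD//; last exact: Rintegrable_cst.
    by rewrite Rintegral_cst// mul1r lerD2r; exact: dC.
  rewrite RintegralD//; try exact: Rintegrable_norm.
  by rewrite mulr2n mulrDl mul1r lerD.
have cauchy i e : 0 < e -> exists M, forall n m : nat, (M <= n)%N -> (M <= m)%N ->
    \int[mu]_(x in Omega) `|P (phi0 n) i x - P (phi0 m) i x| <= e.
  apply: (@rellich_L1_cauchy R Omega (fun n => P (phi0 n) i) (fun n j => G (phi0 n) i j)) => //.
  - by move=> n j; case: (GP (phi0 n) i j).
  - by move=> n; exact: unit_valued_norm.
  - move=> N k l cO; have := ca (inr (i, (N, k, l))).
    by rewrite /a; case: pselect.
have [v [phi1 [hphi1 Hv]]] := @L1_complete_family _ _ R mu 'I_K Omega
  (fun i n => P (phi0 n) i) mO (fun i n => IP (phi0 n) i) cauchy.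
pose phi n := phi0 (phi1 n).
have aecv : {ae mu, forall x, Omega x -> forall i, P (phi n) i x @[n --> \oo] --> v i x}.
  have : {ae mu, forall x, forall i, Omega x -> P (phi n) i x @[n --> \oo] --> v i x}.
    by apply: ae_forall_fin => i; case: (Hv i).
  by apply: ae_imply => x h Ox i; exact: h.
have Iv i : mu.-integrable Omega (EFin \o v i) by case: (Hv i).
have sv : {ae mu, forall x, Omega x -> simplex (fun i => v i x)}.
  have : {ae mu, forall x, forall n, Omega x -> simplex (fun i => P n i x)}.
    by apply/ae_foralln => n; case: (oP n).
  move=> h; apply: ae_imply2 h aecv => x h1 h2 Ox.
  by apply: (@simplex_closed (fun n i => P (phi n) i x)) => [n|i]; [exact: h1|exact: h2].
pose c i j : R := lim ((fun n => dirichlet Omega j (P (phi0 n) i)) @ \oo).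
have cvc i j : dirichlet Omega j (P (phi0 n) i) @[n --> \oo] --> c i j.
  exact: (ca (inl (i, j))).
have limv i j : exists w, [/\ sq_integrable Omega w, is_weak_partial Omega j (v i) w &
    \int[mu]_(x in Omega) (w x ^+ 2) <= c i j].
  apply: weak_partial_lsc => // e e0.
  have [_ _ cL1] := Hv i.
  near \oo => n; exists (P (phi0 n) i), (G (phi0 n) i j); split => //.
  - by case: (GP (phi0 n) i j).
  - by case: (GP (phi0 n) i j).
  - have : `|0 - \int[mu]_(x in Omega) `|P (phi0 n) i x - v i x| | <= e.
      by near: n; move/cvgrPdist_le : cL1 => /(_ _ e0).
    by rewrite sub0r normrN; apply: le_trans; exact: ler_norm.
  - have : `|c i j - dirichlet Omega j (P (phi0 n) i)| <= e.
      by near: n; move/cvgrPdist_le : (cvc i j) => /(_ _ e0).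
    by rewrite ler_distl /dirichlet => /andP[h _]; rewrite -lerBlDr.
have sqv i : sq_integrable Omega (v i).
  have mv := integrable_measurable (Iv i); split => //.
  have := @ae_bounded_mul_integrable R Omega (v i) (v i) oO (Iv i) mv.
  under [X in EFin \o X]eq_fun do rewrite -expr2; apply.
  apply: ae_imply sv => x h Ox; have [v0 v1] := h Ox.
  by rewrite ger0_norm// -v1 (bigD1 i)//= lerDl sumr_ge0.
have ov : ownerships Omega v.
  split => // i; split; first by apply/(L2P _ mO); exact: sqv.
  by move=> j; have [w [sw ww _]] := limv i j; exists w; split => //; apply/(L2P _ mO).
exists phi, v; split => //.
- by move=> n; rewrite (leq_trans (hphi1 n))// hphi0.
- move=> i j; have [w [sw ww wc]] := limv i j.
  rewrite (dirichlet_eq oO Ofin (ov.1 i) sw ww).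
  apply: cvg_eventually_above wc _.
  exact: (cvg_subseq hphi1 (cvc i j)).
Unshelve. all: by end_near. Qed.

(** The direct method, for any class of ownerships that is closed under almost
    everywhere convergence. *)
Lemma minimizer_exists (A : set ('I_K -> R * R -> R)) :
  A `<=` ownerships Omega -> A !=set0 ->
  (forall (u : nat -> 'I_K -> R * R -> R) P, (forall n, A (u n)) -> ownerships Omega P ->
     {ae mu, forall x, Omega x -> forall i, u n i x @[n --> \oo] --> P i x} -> A P) ->
  exists P m, is_minimizer A (energy Omega lambda eps I) P m.
Proof.
move=> Aown [P0 AP0] Acl.
pose E (P : 'I_K -> R * R -> R) m := real_energy Omega lambda eps I P m.
pose S : set R := [set r | exists P m, A P /\ r = E P m].
have hiS : has_inf S.
  split; first by exists (E P0 (fun=> 0)), P0, (fun=> 0).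
  exists 0 => _ [P [m [AP ->]]]; apply: real_energy_ge0 => //; exact: Aown.
pose e := inf S.
have /choice[Pm HPm] : forall n : nat, exists Pm : ('I_K -> R * R -> R) * ('I_K -> R),
    A Pm.1 /\ E Pm.1 Pm.2 < e + n.+1%:R^-1.
  move=> n; have n0 : 0 < n.+1%:R^-1 :> R by rewrite invr_gt0.
  have [_ [P [m [AP ->]]] h] := inf_adherent n0 hiS.
  by exists (P, m).
have oP n : ownerships Omega (Pm n).1 by apply: Aown; case: (HPm n).
have cvE : E (Pm n).1 (Pm n).2 @[n --> \oo] --> e.
  apply: (@squeeze_cvgr _ _ _ _ (fun=> e) (fun n => e + n.+1%:R^-1)).
  - apply: nearW => n; have [AP /ltW ->] := HPm n; rewrite andbT.
    by apply: ge_inf; [exact: hiS.2|exists (Pm n).1, (Pm n).2].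
  - exact: cvg_cst.
  - by rewrite -[X in _ --> X]addr0; apply: cvgD; [exact: cvg_cst|exact: cvg_harmonic].
have e9 : 0 < 9 * eps by rewrite mulr_gt0.
have dC n i j : dirichlet Omega j ((Pm n).1 i) <= (e + 1) / (9 * eps).
  rewrite ler_pdivlMr// mulrC.
  rewrite (le_trans (real_energy_ge oO Ofin lambda_gt0 eps_gt0 sqI (Pm n).2 i j (oP n)))//.
  have [_ /ltW h] := HPm n; rewrite (le_trans h)// lerD2l.
  by rewrite invf_le1// ler1n.
have [phi [P' [hphi oP' aec ev]]] := ownership_compactness oP dC.
have uP n i := ownership_unit_valued oO i (oP n).
have uP' i := ownership_unit_valued oO i oP'.
have aei i : {ae mu, forall x, Omega x -> (Pm (phi n)).1 i x @[n --> \oo] --> P' i x}.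
  by apply: ae_imply aec => x h Ox; exact: h.
have /choice[m' Hm'] : forall i, exists s, eventually_above
    (fun n => fidelity Omega I ((Pm (phi n)).1 i) ((Pm (phi n)).2 i)) (fidelity Omega I (P' i) s).
  move=> i; apply: (@fidelity_eventually_above R Omega I oO Ofin sqI
    (fun n => (Pm (phi n)).1 i) (P' i) (fun n => (Pm (phi n)).2 i)) => //.
have EV : eventually_above (fun n => E (Pm (phi n)).1 (Pm (phi n)).2) (E P' m').
  apply: eventually_aboveD.
    by apply: eventually_aboveZ => //; exact: eventually_above_sum.
  apply: eventually_above_sum => i; apply: eventually_aboveD.
    by apply: eventually_aboveZ => //; exact: eventually_above_sum.
  apply: eventually_aboveZ; first by rewrite invr_gt0.
  apply: cvg_eventually_above (lexx _) _.
  exact: (@double_well_cvg R Omega oO Ofin (fun n => (Pm (phi n)).1 i)).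
have AP' : A P'.
  by apply: (Acl (fun n => (Pm (phi n)).1)) => // n; case: (HPm (phi n)).
exists P', m'; split => // P'' m'' AP''.
rewrite !real_energyE//; last exact: Aown.
rewrite lee_fin (le_trans (eventually_above_le_lim EV (cvg_subseq hphi cvE)))//.
by apply: ge_inf; [exact: hiS.2|exists P'', m''].
Qed.

Lemma unsupervised_minimizer : @ownerships R K Omega !=set0 ->
  exists (P : 'I_K -> R * R -> R) (m : 'I_K -> R),
    is_minimizer (ownerships Omega) (energy Omega lambda eps I) P m.
Proof. by move=> ne; apply: minimizer_exists. Qed.

Lemma supervised_minimizer (Q : 'I_K -> set (R * R)) : patches Omega Q ->
  supervised_ownerships Omega Q !=set0 ->
  exists (P : 'I_K -> R * R -> R) (m : 'I_K -> R),
    is_minimizer (supervised_ownerships Omega Q) (energy Omega lambda eps I) P m.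
Proof.
move=> [_ QO] ne; apply: minimizer_exists => // [P []//|u P su oP cu].
split => // i j; have [_ QjO _] := QO j.
have h : {ae mu, forall x, forall n, Q j x -> u n i x = (i == j)%:R}.
  by apply/ae_foralln => n; case: (su n).
apply: ae_imply2 h cu => x h1 h2 Qx.
apply: (cvg_unique _ (h2 (QjO _ Qx) i)) => //.
by apply: cvg_near_cst; apply: nearW => n; exact: h1.
Qed.

End DirectMethod.

(** * Continuously differentiable functions are in H1 *)

Section C1Functions.
Variable R : realType.
Notation mu := (leb2 R).
Implicit Types (f g u v : R * R -> R) (Omega : set (R * R)) (j : 'I_2).

(** Directional derivatives are derivatives along lines, which gives access to the
    chain rule and to the fundamental theorem of calculus in one variable. *)
Lemma is_derive_line f (x v : R * R) (s d : R) :
  is_derive (s *: v + x) v f d <-> is_derive s (1 : R) (fun t => f (t *: v + x)) d.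
Proof.
have E : (fun h : R => h^-1 *: ((f \o shift (s *: v + x)) (h *: v) - f (s *: v + x))) =
    (fun h : R => h^-1 *: (((fun t => f (t *: v + x)) \o shift s) (h *: (1 : R)) - f (s *: v + x))).
  by apply/funext => h /=; rewrite addrA -scalerDl /GRing.scale/= mulr1.
by split=> -[da va]; apply: DeriveDef;
  move: da va; rewrite /derivable /derive E.
Qed.

Definition C1_function f := continuous f /\
  forall j, exists2 w, continuous w & forall x, is_derive x (e_ R j) f (w x).

Lemma C1_cst (k : R) : C1_function (fun=> k).
Proof.
split=> [|j]; first exact: cst_continuous.
by exists (fun=> 0); [exact: cst_continuous|move=> x; exact: is_derive_cst].
Qed.

Lemma C1_add f g : C1_function f -> C1_function g -> C1_function (fun x => f x + g x).
Proof.
move=> [cf df] [cg dg]; split=> [x|j]; first by apply: cvgD; [exact: cf|exact: cg].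
have [a ca fa] := df j; have [b cb gb] := dg j; exists (fun x => a x + b x).
  by move=> x; apply: cvgD; [exact: ca|exact: cb].
by move=> x; have := is_deriveD (fa x) (gb x).
Qed.

Lemma C1_mul f g : C1_function f -> C1_function g -> C1_function (fun x => f x * g x).
Proof.
move=> [cf df] [cg dg]; split=> [x|j]; first by apply: cvgM; [exact: cf|exact: cg].
have [a ca fa] := df j; have [b cb gb] := dg j; exists (fun x => f x * b x + g x * a x).
  by move=> x; apply: cvgD; apply: cvgM; [exact: cf|exact: cb|exact: cg|exact: ca].
by move=> x; have := is_deriveM (fa x) (gb x).
Qed.

Lemma C1_affine k l f : C1_function f -> C1_function (fun x => k * f x + l).
Proof. by move=> C1f; apply: C1_add (C1_cst l); apply: C1_mul (C1_cst k) C1f. Qed.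

Lemma C1_prod (T : Type) (s : seq T) (F : T -> R * R -> R) :
  (forall i, C1_function (F i)) -> C1_function (fun x => \prod_(i <- s) F i x).
Proof.
move=> CF; elim: s => [|i s IH].
  by under eq_fun do rewrite big_nil; exact: C1_cst.
by under eq_fun do rewrite big_cons; exact: C1_mul.
Qed.

Lemma C1_comp (a a' : R -> R) f : (forall t, is_derive t (1 : R) a (a' t)) -> continuous a' ->
  C1_function f -> C1_function (fun x => a (f x)).
Proof.
move=> da ca' [cf df]; have ca := is_derive_continuous da.
split=> [x|j]; first exact: (continuous_comp (@cf x) (@ca _)).
have [w cw fw] := df j; exists (fun x => a' (f x) * w x).
  move=> x; apply: cvgM; last exact: cw.
  exact: (continuous_comp (@cf x) (@ca' _)).
move=> x; have E : x = (0 : R) *: e_ R j + x by rewrite scale0r add0r.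
rewrite [X in is_derive X]E; apply/is_derive_line.
apply: (@is_derive1_comp _ a (fun t => f (t *: e_ R j + x)) 0 (a' (f x)) (w x)).
  by rewrite -E; exact: da.
by apply/is_derive_line; rewrite -E; exact: fw.
Qed.

Lemma C1_coordinate j : C1_function (coordinate j).
Proof.
split; first by case: j => -[|[|//]] ? x; [exact: cvg_fst|exact: cvg_snd].
move=> i; exists (fun=> 1 *+ (i == j)); first exact: cst_continuous.
by move=> x; exact: (@is_derive_coordinate _ id (fun=> 1)).
Qed.

Lemma integral_derivative0 (h w : R -> R) M : (forall t, is_derive t (1 : R) h (w t)) ->
  continuous w -> 0 < M -> (forall t, M <= `|t| -> h t = 0 /\ w t = 0) ->
  (\int[lebesgue_measure]_t (w t)%:E = 0)%E.
Proof.
move=> dh cw M0 out; have ch := is_derive_continuous dh.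
have -> : (fun t => (w t)%:E) = (EFin \o w) \_ `[- M, M].
  apply/funext => t; rewrite /patch; case: ifPn => //.
  rewrite notin_setE/= in_itv/= -ler_norml => /negP; rewrite -real_ltNge ?num_real// => /ltW.
  by move=> /out[_ ->].
rewrite -integral_mkcond.
have MM : - M < M by rewrite gtrN.
rewrite (@continuous_FTC2 _ w h (- M) M MM).
- have [-> _] := out M (ler_norm _).
  have [|-> _] := out (- M); first by rewrite normrN ler_norm.
  by rewrite sube0.
- exact: continuous_subspaceT.
- split.
  + by move=> t _; case: (dh t).
  + by apply: cvg_at_right_filter; exact: ch.
  + by apply: cvg_at_left_filter; exact: ch.
- by move=> t _; rewrite derive1E; case: (dh t).
Qed.

(** Fubini's theorem, integrating first along the lines parallel to e_ j. *)
Lemma integral_partial0 j (h w : R * R -> R) M : (forall x, is_derive x (e_ R j) h (w x)) ->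
  continuous w -> mu.-integrable setT (EFin \o w) -> 0 < M ->
  (forall x, M <= `|x| -> h x = 0 /\ w x = 0) ->
  \int[mu]_x w x = 0.
Proof.
move=> dh cw Iw M0 out; rewrite /Rintegral.
suff -> : (\int[mu]_x (w x)%:E = 0)%E by [].
have slice (y : R * R) : (forall t : R, `|t| <= `|t *: e_ R j + y|) ->
    (\int[lebesgue_measure]_t (w (t *: e_ R j + y))%:E = 0)%E.
  move=> ty; apply: (@integral_derivative0 (fun t => h (t *: e_ R j + y)) _ M) => //.
  - by move=> t; apply/is_derive_line; exact: dh.
  - move=> t; apply: (@continuous_comp _ _ _ (fun t : R => t *: e_ R j + y) w); last exact: cw.
    by apply: cvgD; [apply: cvgZr_tmp; exact: cvg_id|exact: cvg_cst].
  - by move=> t Mt; apply: out; exact: le_trans Mt (ty t).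
case: j {dh} slice => -[|[|//]] lj slice.
- rewrite -(integral21_prod_meas1 Iw) integral0_eq// => y _; rewrite /fubini_G.
  rewrite -(slice (0, y)).
    apply: eq_integral => t _ /=; congr (w _)%:E.
    by apply: injective_projections; rewrite /e_/= /GRing.scale/= ?mulr1 ?mulr0 ?addr0 ?add0r.
  by move=> t; rewrite prod_normE /e_/= le_max /GRing.scale/= mulr1 addr0 lexx.
- rewrite -(integral12_prod_meas1 Iw) integral0_eq// => y _; rewrite /fubini_F.
  rewrite -(slice (y, 0)).
    apply: eq_integral => t _ /=; congr (w _)%:E.
    by apply: injective_projections; rewrite /e_/= /GRing.scale/= ?mulr1 ?mulr0 ?addr0 ?add0r.
  by move=> t; rewrite prod_normE /e_/= le_max /GRing.scale/= mulr1 addr0 lexx orbT.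
Qed.

Definition square (M : R) : set (R * R) := `[- M, M]%classic `*` `[- M, M]%classic.

Lemma squareP M x : square M x <-> `|x| <= M.
Proof.
rewrite /square prod_normE ge_max !ler_norml /= !in_itv/=; split; first by case=> /= -> ->.
by case/andP.
Qed.

Lemma compact_square M : compact (square M).
Proof. by apply: compact_setX; exact: segment_compact. Qed.

Lemma bounded_set_square O : bounded_set O -> exists2 M, 0 < M & O `<=` square M.
Proof.
move=> [M [_ HM]]; exists (`|M| + 1); first by rewrite ltr_wpDl.
move=> x Ox; apply/squareP; apply: (HM (`|M| + 1) _ x Ox).
by rewrite (le_lt_trans (ler_norm M))// ltrDl.
Qed.

Lemma continuous_sq_integrable Omega f : open Omega -> bounded_set Omega -> continuous f ->
  sq_integrable Omega f.
Proof.
move=> oO bO cf; have mO := open_measurable_plane oO.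
have [M _ OM] := bounded_set_square bO; have [B B0 HB] := continuous_compact_bound (@compact_square M) cf.
split; first exact: continuous_measurable_plane.
apply: (@Rintegrable_le _ _ _ _ _ _ (cst (B ^+ 2))) => //.
- by apply: measurable_funX; exact: continuous_measurable_plane.
- by apply: Rintegrable_cst => //; exact: bounded_set_leb2.
- by move=> x Ox; rewrite normrX /= lerXn2r ?nnegrE// HB//; exact: OM.
Qed.

(** The product of u with a test function is a C^1 function on the plane with
    compact support in Omega; the integral of its partial
    derivative is 0. *)
Lemma C1_is_weak_partial Omega j u w : open Omega -> bounded_set Omega ->
  continuous u -> continuous w -> (forall x, is_derive x (e_ R j) u (w x)) ->
  is_weak_partial Omega j u w.
Proof.
move=> oO bO cu cw dw phi tphi; have mO := open_measurable_plane oO.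
have Ofin := bounded_set_leb2 bO mO.
have L1 f : continuous f -> mu.-integrable Omega (EFin \o f).
  by move=> cf; apply: sq_integrable_L1 => //; exact: continuous_sq_integrable.
have [cp cdp] := test_derive_continuous j tphi.
have [_ Iud] := integrable_test j oO tphi (L1 _ cu).
have [Iwp _] := integrable_test j oO tphi (L1 _ cw).
apply/eqP; rewrite -addr_eq0 -RintegralD//.
pose g x := u x * 'D_(e_ R j) phi x + w x * phi x.
have Ig : mu.-integrable Omega (EFin \o g) by exact: RintegrableD.
have cg : continuous g.
  by move=> x; apply: cvgD; apply: cvgM; [exact: cu|exact: cdp|exact: cw|exact: cp].
have [M M0 OM] := bounded_set_square bO.
case: (tphi) => sm _ SO.
have out x : ~ Omega x -> phi x = 0 /\ 'D_(e_ R j) phi x = 0.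
  by move=> nOx; apply: test_off_support => Sx; exact: nOx (SO _ Sx).
have gout x : ~ Omega x -> g x = 0.
  by move=> /out[p0 d0]; rewrite /g p0 d0 !mulr0 addr0.
have gE : (EFin \o g) \_ Omega = EFin \o g.
  apply/funext => x; rewrite /patch; case: ifPn => //; rewrite notin_setE => nOx /=.
  by rewrite gout.
apply/eqP; transitivity (\int[mu]_x g x).
  by rewrite /Rintegral integral_mkcond gE.
apply: (@integral_partial0 j (fun x => u x * phi x) g (M + 1)) => //.
- move=> x; have dp : is_derive x (e_ R j) phi ('D_(e_ R j) phi x).
    by apply: DeriveDef => //; exact: (sm [::]).2.
  by have := is_deriveM (dw x) dp; congr is_derive; rewrite /g /GRing.scale/= [phi x * _]mulrC.
- by rewrite -gE; apply/(integrable_mkcond _ mO).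
- exact: ltr_wpDr M0.
- move=> x Mx; have nOx : ~ Omega x.
    by move=> /OM /squareP xM; have := le_trans Mx xM; rewrite leNgt ltrDl ltr01.
  by rewrite gout//; have [-> _] := out _ nOx; rewrite mulr0.
Qed.

Lemma C1_H1 Omega u : open Omega -> bounded_set Omega -> C1_function u -> H1 Omega u.
Proof.
move=> oO bO [cu du]; have mO := open_measurable_plane oO.
split; first by apply/(L2P _ mO); exact: continuous_sq_integrable.
move=> j; have [w cw dw] := du j; exists w; split.
  by apply/(L2P _ mO); exact: continuous_sq_integrable.
exact: C1_is_weak_partial.
Qed.

Lemma C1_ownerships K Omega (P : 'I_K -> R * R -> R) : open Omega -> bounded_set Omega ->
  (forall i, C1_function (P i)) -> (forall x, simplex (fun i => P i x)) -> ownerships Omega P.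
Proof.
by move=> oO bO CP sP; split; [move=> i; exact: C1_H1|apply: aeW => x _; exact: sP].
Qed.

End C1Functions.

(** * Admissible ownerships *)

Section Urysohn.
Variable R : realType.
Implicit Types (f g u v : R * R -> R) (Omega : set (R * R)) (j : 'I_2).

(** The simplest C^1 function that vanishes exactly for nonpositive arguments. *)
Definition pospart_sqr (t : R) := Num.max 0 t ^+ 2.

Lemma pospart_sqr_ge0 t : 0 <= pospart_sqr t. Proof. exact: sqr_ge0. Qed.

Lemma pospart_sqr_gt0 t : 0 < t -> 0 < pospart_sqr t.
Proof. by move=> t0; rewrite exprn_gt0// lt_max t0 orbT. Qed.

Lemma pospart_sqr_eq0 t : t <= 0 -> pospart_sqr t = 0.
Proof. by move=> t0; rewrite /pospart_sqr max_l// expr0n. Qed.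

Lemma pospart_sqr_le1 t : t <= 1 -> pospart_sqr t <= 1.
Proof. by move=> t1; rewrite expr_le1// ?ge_max ?le_max ?lexx ?ler01. Qed.

Lemma is_derive_pospart_sqr t : is_derive t (1 : R) pospart_sqr (2 * Num.max 0 t).
Proof.
have [t0|t0|->] := ltgtP t 0.
- rewrite mulr0.
  apply: (@near_eq_is_derive _ _ _ (cst 0)).
    by near=> s; rewrite pospart_sqr_eq0//; apply/ltW; near: s; exact: lt_nbhsl.
- have d := is_deriveM1 (is_derive_id t (1 : R)) (is_derive_id t (1 : R)).
  apply: (near_eq_is_derive _ (is_derive_eq d _)).
    near=> s; rewrite /pospart_sqr max_r ?expr2//.
    by apply/ltW; near: s; exact: lt_nbhsr.
  by rewrite /=; ring.
- rewrite ?maxxx mulr0; apply: (@is_derive_at0 _ _ 1); first exact: pospart_sqr_eq0.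
  move=> s; rewrite mul1r ger0_norm ?pospart_sqr_ge0//.
  have [s0|s0] := leP s 0; first by rewrite pospart_sqr_eq0// sqr_ge0.
  by rewrite /pospart_sqr max_r// ltW.
Unshelve. all: by end_near. Qed.

Lemma continuous_pospart : continuous (fun t : R => 2 * Num.max 0 t).
Proof.
have -> : (fun t : R => 2 * Num.max 0 t) = (fun t => t + `|t|).
  apply/funext => t; have [t0|t0] := leP t 0.
    by rewrite ler0_norm// mulr0 subrr.
  by rewrite gtr0_norm// mulr2n mulrDl mul1r.
by move=> t; apply: cvgD; [exact: cvg_id|apply: norm_continuous].
Qed.

Lemma C1_pospart_sqr f : C1_function f -> C1_function (fun x => pospart_sqr (f x)).
Proof. exact: (C1_comp is_derive_pospart_sqr continuous_pospart). Qed.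

Definition round_bump (a : R * R) (r : R) (x : R * R) :=
  pospart_sqr (r ^+ 2 - (x.1 - a.1) ^+ 2) * pospart_sqr (r ^+ 2 - (x.2 - a.2) ^+ 2).

Lemma C1_round_bump a r : C1_function (round_bump a r).
Proof.
have C1p j : C1_function (fun x => r ^+ 2 - (coordinate j x - coordinate j a) ^+ 2).
  have C := C1_affine 1 (- coordinate j a) (@C1_coordinate R j).
  have := C1_affine (-1) (r ^+ 2) (C1_mul C C).
  by congr C1_function; apply/funext => x; ring.
apply: C1_mul; apply: C1_pospart_sqr; first exact: (C1p ord0).
exact: (C1p ord_max).
Qed.

Lemma round_bump_ge0 a r x : 0 <= round_bump a r x.
Proof. by rewrite mulr_ge0// pospart_sqr_ge0. Qed.

Lemma sqr_lt_norm (r s : R) : 0 < r -> (0 < r ^+ 2 - s ^+ 2) = (`|s| < r).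
Proof. by move=> r0; rewrite subr_gt0 -real_normK ?num_real// ltr_pXn2r// nnegrE// ltW. Qed.

Lemma round_bump_gt0 a r x : 0 < r -> ball a r x -> 0 < round_bump a r x.
Proof.
by move=> r0 [h1 h2]; rewrite mulr_gt0// pospart_sqr_gt0// sqr_lt_norm// distrC.
Qed.

Lemma round_bump_out a r x : 0 < r -> ~ ball a r x -> round_bump a r x = 0.
Proof.
move=> r0 nb; rewrite /round_bump.
have [h1|h1] := ltP 0 (r ^+ 2 - (x.1 - a.1) ^+ 2); last by rewrite pospart_sqr_eq0// mul0r.
have [h2|h2] := ltP 0 (r ^+ 2 - (x.2 - a.2) ^+ 2); last by rewrite [X in _ * X]pospart_sqr_eq0// mulr0.
move: h1 h2; rewrite !sqr_lt_norm// => h1 h2; exfalso; apply: nb.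
by split; rewrite /ball/= distrC.
Qed.

(** The C^1 functions that are nonnegative and vanish on F are directed upwards, by
    addition, and for each point of A one of them is positive near this point;
    compactness yields one, f, that is positive on A, hence at least some c > 0
    there.  Then 1 - max(0, 1 - f / c) ^ 2 is 1 on A, 0 on F and C^1. *)
Lemma C1_urysohn (A F : set (R * R)) : compact A -> closed F -> A `&` F = set0 ->
  exists q, [/\ C1_function q, forall x, 0 <= q x <= 1, forall x, A x -> q x = 1 &
    forall x, F x -> q x = 0].
Proof.
move=> cA cF AF0; have [->|/set0P A0] := eqVneq A set0.
  exists (fun=> 0); split => //; [exact: C1_cst|by move=> x; rewrite lexx ler01].
have /choice[r Hr] : forall a, exists r, 0 < r /\ (A a -> forall x, ball a r x -> ~ F x).
  move=> a; have [Aa|nAa] := pselect (A a); last by exists 1.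
  have nFa : (~` F) a by move=> Fa; have : (A `&` F) a by []; rewrite AF0.
  have := cF; rewrite -openC openE => /(_ a nFa) /nbhs_ballP[e /= e0 eF].
  by exists e; split => // _ x /eF.
have r0 a : 0 < r a by case: (Hr a).
pose C : set (R * R -> R) :=
  [set g | [/\ C1_function g, forall x, 0 <= g x & forall x, F x -> g x = 0]].
pose above (g : R * R -> R) : set (R * R -> R) := [set h | C h /\ forall x, g x <= h x].
have Cadd g h : C g -> C h -> C (fun x => g x + h x).
  move=> [g1 g2 g3] [h1 h2 h3]; split; [exact: C1_add|by move=> x; rewrite addr_ge0|].
  by move=> x Fx; rewrite g3// h3// addr0.
(* Compactness in the form of near coverings, along the filter generated by
   the upper sets of C. *)
have FF : Filter (filter_from C above).
  apply: filter_from_filter.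
    by exists (fun=> 0); split => //; exact: C1_cst.
  move=> g h Cg Ch; exists (fun x => g x + h x); first exact: Cadd.
  move=> k [Ck gk]; split; split => // x; apply: le_trans (gk x).
    by rewrite lerDl; case: Ch.
  by rewrite lerDr; case: Cg.
have Cbump a : A a -> C (round_bump a (r a)).
  move=> Aa; split; [exact: C1_round_bump|by move=> x; exact: round_bump_ge0|].
  move=> x Fx; apply: round_bump_out => // xa.
  by case: (Hr a) => _ /(_ Aa x xa).
have := cA; rewrite compact_near_coveringP.
move=> /(_ _ (filter_from C above) (fun g x => 0 < g x) FF) [a Aa|].
  exists (ball a (r a), above (round_bump a (r a))).
    by split; [exact: nbhsx_ballx|exists (round_bump a (r a)) => //; exact: Cbump].
  move=> [x g] /= [xa [_ /(_ x)]]; apply: lt_le_trans; exact: round_bump_gt0.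
move=> f Cf /(_ f) fA'; have {}fA' := fA' (conj Cf (fun x => lexx _)).
have [C1f f0 fF] := Cf.
have fA x : A x -> 0 < f x by exact: fA'.
have [c cA' cmin] := compact_EVT_min A0 cA (continuous_subspaceT C1f.1).
have c0 : 0 < f c by apply: fA; move: cA'; rewrite inE.
exists (fun x => -1 * pospart_sqr (- (f c)^-1 * f x + 1) + 1); split.
- by apply: C1_affine; apply: C1_pospart_sqr; exact: C1_affine.
- move=> x; have := @pospart_sqr_le1 (- (f c)^-1 * f x + 1).
  have := pospart_sqr_ge0 (- (f c)^-1 * f x + 1).
  have : 0 <= (f c)^-1 * f x by rewrite mulr_ge0// invr_ge0 ltW.
  move: (pospart_sqr _) => y h1 h2 h3; have : y <= 1 by apply: h3; lra.
  by move=> h4; apply/andP; split; lra.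
- move=> x Ax; rewrite pospart_sqr_eq0 ?mulr0 ?add0r//.
  have : 1 <= (f c)^-1 * f x by rewrite ler_pdivlMl// mulr1; apply: cmin; rewrite inE.
  lra.
- move=> x Fx; rewrite (fF x Fx) mulr0 add0r /pospart_sqr max_r//; lra.
Qed.

Lemma stick_breaking (q : nat -> R) n :
  \sum_(i < n) (q i * \prod_(j < i) (1 - q j)) = 1 - \prod_(j < n) (1 - q j).
Proof.
elim: n => [|n IH]; first by rewrite !big_ord0 subrr.
by rewrite big_ord_recr IH [in RHS]big_ord_recr/=; ring.
Qed.

Lemma closure_sub_square M (A : set (R * R)) : A `<=` square M -> closure A `<=` square M.
Proof.
move=> AM; rewrite [X in _ `<=` X](closure_id _).1; first exact: closure_subset.
by apply: compact_closed; [exact: norm_hausdorff|exact: compact_square].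
Qed.

(** Let q i be a cutoff function that is 1 on the i-th patch and 0 on the others.
    Stick breaking P i = q i (1 - q 0) ... (1 - q (i - 1)), with the last q
    replaced by 1, gives nonnegative functions of sum 1; on the j-th patch
    P j = 1, which forces the others to vanish there. *)
Lemma supervised_nonempty K Omega (Q : 'I_K -> set (R * R)) : open Omega -> bounded_set Omega ->
  (0 < K)%N -> patches Omega Q ->
  (forall i j : 'I_K, i != j -> closure (Q i) `&` closure (Q j) = set0) ->
  supervised_ownerships Omega Q !=set0.
Proof.
case: K Q => // n Q oO bO _ [_ QO] Qdisj.
have [M _ OM] := bounded_set_square bO.
have cQ i : compact (closure (Q i)).
  apply: (subclosed_compact _ (@compact_square R M)); first exact: closed_closure.
  by apply: closure_sub_square; apply: subset_trans OM; case: (QO i).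
have /choice[q Hq] : forall i, exists q, [/\ C1_function q, forall x, 0 <= q x <= 1,
    forall x, closure (Q i) x -> q x = 1 &
    forall x, (\bigcup_(j in [set j | j != i]) closure (Q j)) x -> q x = 0].
  move=> i; apply: C1_urysohn => //.
    by apply: closed_bigcup => [|j _]; [exact: finite_finset|exact: closed_closure].
  apply/seteqP; split => // x [Qx [j /= ji Qjx]].
  by have : (closure (Q j) `&` closure (Q i)) x by []; rewrite Qdisj.
pose qn k x := if k == n then 1 else q (inord k) x.
pose P (i : 'I_n.+1) x := qn i x * \prod_(j < i) (1 - qn j x).
have C1qn k : C1_function (qn k).
  by rewrite /qn; case: eqP => _; [exact: C1_cst|case: (Hq (inord k))].
have qn01 k x : 0 <= qn k x <= 1.
  rewrite /qn; case: eqP => _; first by rewrite ler01 lexx.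
  by case: (Hq (inord k)).
have sP x : simplex (fun i => P i x).
  split=> [i|]; last first.
    by rewrite (stick_breaking (qn^~ x)) big_ord_recr/= /qn eqxx subrr mulr0 subr0.
  rewrite mulr_ge0//; first by case/andP: (qn01 i x).
  by apply: prodr_ge0 => j _; rewrite subr_ge0; case/andP: (qn01 j x).
have PQ (j : 'I_n.+1) x : Q j x -> P j x = 1.
  move=> Qx; have cQx := subset_closure Qx.
  have -> : P j x = qn j x.
    rewrite /P big1 ?mulr1// => k _; rewrite /qn.
    have kn : (k < n)%N by rewrite (leq_trans (ltn_ord k))// -ltnS.
    rewrite ltn_eqF//; have [_ _ _ ->] := Hq (inord k); first by rewrite subr0.
    exists j => //=; apply/eqP => /(congr1 val)/=; rewrite inordK ?ltnS 1?ltnW// => jk.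
    by have := ltn_ord k; rewrite [X in (_ < X)%N]jk ltnn.
  rewrite /qn; case: eqP => // _; rewrite inord_val.
  by have [_ _ q1 _] := Hq j; exact: q1.
exists P; split.
  apply: C1_ownerships => // i; apply: C1_mul => //.
  have -> : (fun x => \prod_(j < i) (1 - qn j x)) = (fun x => \prod_(j < i) (-1 * qn j x + 1)).
    by apply/funext => x; apply: eq_bigr => j _; ring.
  by apply: C1_prod => j; exact: C1_affine.
move=> i j; apply: aeW => x Qx; have [->|ij] := eqVneq i j; first exact: PQ.
have [P0 P1] := sP x; move: P1; rewrite (bigD1 j)//= PQ// (bigD1 i)//= => h.
have s0 : 0 <= \sum_(k | (k != j) && (k != i)) P k x by apply: sumr_ge0 => k _.
have := P0 i; move: h s0; move: (\sum_(_ | _) _) => s h s0 p0.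
apply/eqP; rewrite eq_le p0 andbT; lra.
Qed.

Lemma unsupervised_nonempty K Omega : open Omega -> bounded_set Omega -> (0 < K)%N ->
  @ownerships R K Omega !=set0.
Proof.
case: K => // n oO bO _; exists (fun i _ => (i == ord0)%:R); apply: C1_ownerships => //.
  by move=> i; exact: C1_cst.
move=> x; split=> [i|]; first exact: ler0n.
by rewrite (bigD1 ord0)//= big1 ?addr0// => i /negbTE ->.
Qed.

End Urysohn.

(** * Existence of minimizers *)

Theorem theorem5 (R : realType) (Omega : set (R * R)) (K : nat)
    (lambda eps : R) (I : R * R -> R)
    (Omega_open : open Omega) (Omega_bounded : bounded_set Omega)
    (Omega_smooth : smooth_boundary Omega)
    (K_gt0 : (0 < K)%N) (lambda_gt0 : 0 < lambda) (eps_gt0 : 0 < eps)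
    (I_L2 : L2 Omega I) :
  (* unsupervised *)
  (exists (P : 'I_K -> R * R -> R) (m : 'I_K -> R),
      is_minimizer (ownerships Omega) (energy Omega lambda eps I) P m) /\
  (* supervised; the constraints are compatible as soon as the patches are
     at positive distance from each other *)
  (forall Q : 'I_K -> set (R * R), patches Omega Q ->
     ((forall i j, i != j -> closure (Q i) `&` closure (Q j) = set0) ->
        supervised_ownerships Omega Q !=set0) /\
     (supervised_ownerships Omega Q !=set0 ->
        exists (P : 'I_K -> R * R -> R) (m : 'I_K -> R),
          is_minimizer (supervised_ownerships Omega Q)
            (energy Omega lambda eps I) P m)).
Proof.
have mO := open_measurable_plane Omega_open.
have Ofin := bounded_set_leb2 Omega_bounded mO.
have sqI : sq_integrable Omega I by apply/(L2P _ mO).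
split; first by apply: unsupervised_minimizer => //; exact: unsupervised_nonempty.
move=> Q pQ; split; first exact: supervised_nonempty.
exact: supervised_minimizer.
Qed.
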